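(* For each $k \in \{3, 4, 5, 6\}$, every planar graph that does not contain $C_k$ (the cycle of length $k$) as a subgraph is DP-$4$-colorable.
   Context: Graphs are finite and simple. $C_k$ denotes the cycle of length $k$; ''without $C_k$'' means having no subgraph (not necessarily induced) isomorphic to $C_k$. List assignments: for a positive integer $m$ write $[m]=\{1,\dots,m\}$. A list assignment of a graph $G$ is a mapping $L: V(G)\to 2^{[m]}$ (for some $m$) that assigns a set of colors to each vertex. It is a $t$-list assignment if $|L(u)|\ge t$ for every $u\in V(G)$. Matching assignments: given a list assignment $L$ of $G$, a matching assignment over $L$ is a family $\mathcal{M}_L=\{M_{L,uv}: uv\in E(G)\}$ where, for each edge $uv$ of $G$, $M_{L,uv}$ is a matching (not necessarily perfect, possibly empty) between $\{u\}\times L(u)$ and $\{v\}\times L(v)$. Cover: the $\mathcal{M}_L$-cover of $G$ is the graph $H$ with vertex set $\bigcup_{u\in V(G)}(\{u\}\times L(u))=\{(u,c): u\in V(G),\ c\in L(u)\}$ such that, for each $u\in V(G)$, the set $\{u\}\times L(u)$ induces a clique in $H$; for each edge $uv$ of $G$, the edges of $H$ between $\{u\}\times L(u)$ and $\{v\}\times L(v)$ are exactly those of $M_{L,uv}$; and there are no other edges. DP-coloring: an $\mathcal{M}_L$-coloring of $G$ is an independent set $I$ in the $\mathcal{M}_L$-cover of $G$ with $|I|=|V(G)|$. The DP-chromatic number $\chi_{\mathrm{DP}}(G)$ is the minimum integer $t$ such that $G$ admits an $\mathcal{M}_L$-coloring for each $t$-list assignment $L$ of $G$ and each matching assignment $\mathcal{M}_L$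 over $L$. The graph $G$ is DP-$t$-colorable if $\chi_{\mathrm{DP}}(G)\le t$. *)

(* Defs.v *)
From mathcomp Require Import all_boot all_order all_algebra.
From mathcomp Require Import all_classical all_reals all_analysis.

Set Implicit Arguments.
Unset Strict Implicit.
Unset Printing Implicit Defensive.

Import Order.TTheory GRing.Theory Num.Theory.
Import numFieldNormedType.Exports.

(* A finite simple graph is a symmetric irreflexive [e : rel V] on a finType
   [V]; the definitions below are meant for such relations. *)

(* For k >= 3: some k pairwise distinct vertices, cyclically adjacent, i.e. a
   (not necessarily induced) subgraph isomorphic to C_k. *)
Definition contains_cycle (V : finType) (e : rel V) (k : nat) : Prop :=
  exists s : seq V, size s = k /\ ucycle e s.

Section Planarity.
Local Open Scope classical_set_scope.
Local Open Scope ring_scope.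

Definition simple_arc (R : realType) (x y : R * R) (A : set (R * R)) : Prop :=
  exists f : R -> R * R,
    [/\ {within `[0, 1], continuous f},
        {in `[0, 1] &, injective f},
        f 0 = x, f 1 = y & f @` `[0, 1] = A].

(* [pos v] is the point representing v; for an edge uv, [curve u v] is the
   closed arc, ends included, representing it. *)
Record plane_drawing (R : realType) (V : finType) (e : rel V)
    (pos : V -> R * R) (curve : V -> V -> set (R * R)) : Prop := PlaneDrawing {
  pos_inj : injective pos;
  curve_arc : forall u v, e u v -> simple_arc (pos u) (pos v) (curve u v);
  curve_sym : forall u v, e u v -> curve u v = curve v u;
  curve_vertex : forall u v w, e u v -> curve u v (pos w) -> w = u \/ w = v;
  curve_disjoint : forall u v x y (p : R * R), e u v -> e x y ->
    (x, y) <> (u, v) -> (x, y) <> (v, u) ->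
    curve u v p -> curve x y p ->
    exists w, [/\ p = pos w, w = u \/ w = v & w = x \/ w = y] }.

Definition planar (R : realType) (V : finType) (e : rel V) : Prop :=
  exists (pos : V -> R * R) (curve : V -> V -> set (R * R)),
    plane_drawing e pos curve.

End Planarity.

(* The palette [m] = {1, ..., m} is rendered as 'I_m = {0, ..., m - 1}. *)
Definition list_assignment (V : finType) (m : nat) := V -> {set 'I_m}.

Definition is_t_list_assignment (V : finType) (m t : nat)
    (L : list_assignment V m) : Prop :=
  forall u, t <= #|L u|.

(* [M u v c d] means that (u, c)(v, d) is an edge of the matching attached to
   the edge uv of the graph. Values of [M] at non-adjacent pairs are ignored. *)
Definition matching_family (V : finType) (m : nat) := V -> V -> rel 'I_m.

(* The first clause says that M u v and M v u are the same matching, seen from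
   either end of the unordered edge uv. *)
Definition is_matching_assignment (V : finType) (e : rel V) (m : nat)
    (L : list_assignment V m) (M : matching_family V m) : Prop :=
  forall u v, e u v ->
    [/\ forall c d, M u v c d = M v u d c,
        forall c d, M u v c d -> c \in L u /\ d \in L v,
        forall c d d', M u v c d -> M u v c d' -> d = d'
      & forall c c' d, M u v c d -> M u v c' d -> c = c'].

Definition cover_vertices (V : finType) (m : nat) (L : list_assignment V m) :
    {set V * 'I_m} :=
  [set p : V * 'I_m | p.2 \in L p.1]%SET.

(* Adjacency in the cover, for p and q in [cover_vertices L]. *)
Definition cover_adj (V : finType) (e : rel V) (m : nat)
    (M : matching_family V m) : rel (V * 'I_m) :=
  fun p q =>
    (p.1 == q.1) && (p.2 != q.2) || e p.1 q.1 && M p.1 q.1 p.2 q.2.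

Definition is_DP_coloring (V : finType) (e : rel V) (m : nat)
    (L : list_assignment V m) (M : matching_family V m)
    (I : {set V * 'I_m}) : Prop :=
  [/\ I \subset cover_vertices L,
      forall p q, p \in I -> q \in I -> ~~ cover_adj e M p q
    & #|I| = #|V|].

Definition all_DP_colorings_exist (V : finType) (e : rel V) (t : nat) : Prop :=
  forall m (L : list_assignment V m) (M : matching_family V m),
    0 < m -> is_t_list_assignment t L -> is_matching_assignment e L M ->
    exists I, is_DP_coloring e L M I.

Definition is_DP_chromatic_number (V : finType) (e : rel V) (n : nat) : Prop :=
  all_DP_colorings_exist e n /\
  forall t, all_DP_colorings_exist e t -> n <= t.

Definition DP_colorable (V : finType) (e : rel V) (t : nat) : Prop :=
  exists n, is_DP_chromatic_number e n /\ n <= t.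

(* Main.v *)
Require Import Defs.
From mathcomp Require Import all_boot all_order all_algebra all_fingroup.
From mathcomp Require Import lra zify.

(** Why planar graphs without C_k are DP-4-colourable, for k = 3, 4, 5, 6.

Colour ever larger vertex sets S.  A vertex with at most three neighbours in S
can be coloured last ([colorable_low]).  If every vertex has at least four, it
suffices to find a reducible cycle: a cycle through vertices with exactly four
neighbours in S, two consecutive of which, say v and w, have different numbers
of neighbours on the cycle.  Once the rest of S is coloured, every vertex of the
cycle keeps at least as many free colours as it has neighbours on the cycle; the
richer v can therefore be given a colour that costs w nothing, and the path from
v round to w is then coloured greedily, w having a colour to spare
([reducible_cycle]).

Reducible cycles come from Euler's formula by discharging.  A dart (an oriented
edge) carries the charge (1 - 4/d) + (1 - 4/l), where d is the degree of its
tail and l the length of its face; the total is at most -8 ([euler_sum]).  Faces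
of length three are the only negative ones when all degrees are at least four.
Without triangles there is none.  Without pentagons a vertex carries at most two
consecutive triangles, and the large faces around pay for all of them
([no_C5_no_dart]).  Without quadrilaterals triangles share no edges and are paid
for by the pentagons, the larger faces and the vertices of degree at least five;
this can only fail at a pentagon which, with an adjacent triangle, has all its
vertices of degree four ([no_C4_no_dart]), and their outer cycle of length six is
reducible ([pentagon_reducible]).  Without hexagons the payments fail only at two
adjacent triangles on four vertices of degree four ([no_C6_no_dart]), whose
boundary is reducible provided the two opposite vertices are not adjacent
([diamond_reducible]).  That analysis needs every triangle of the graph to bound
a face.  It is therefore applied to a smallest piece C of the graph that is cut
off by a triangle T, or by nothing: there no triangle separates
([piece_connected]), a nonseparating triangle is facial
([nonseparating_facial]), and the charge is generous enough to give up what lies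
at the three vertices of T ([piece_reducible]).

The second half turns a drawing by continuous arcs into a combinatorial map that
satisfies Euler's formula, without the Jordan curve theorem.  A map is called
plane here when, whichever edges are kept, a further edge that joins two points
of one component has both its sides in one face ([planar_on]); this passes to
submaps, and is equivalent to Euler's formula ([euler_planar],
[planar_euler]).  The square grid is plane, by inserting its edges row by row
([grid_planar]), and a graph obtained from a plane map by contracting connected
sets is plane: contract a spanning forest, and let the rotation of the graph
follow the single face around each tree ([plane_minor]).  Finally, at a small
enough scale, the pixels met by the drawing form such a grid model: the branch
set of a vertex u consists of the pixels near the first third of each edge at u,
and compactness keeps disjoint pieces of arcs apart ([drawing_plane_map]). *)

Set Implicit Arguments.
Unset Strict Implicit.
Unset Printing Implicit Defensive.

Import Order.TTheory GRing.Theory Num.Theory.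

(** * Cycles of a permutation *)

Section PermOrbits.
Import GroupScope.
Variable T : finType.
Implicit Types (s p : {perm T}) (x y z : T).

Lemma porbit_iter s n x : iter n s x \in porbit s x.
Proof. by rewrite -permX mem_porbit. Qed.

Lemma porbit_step s x : s x \in porbit s x.
Proof. exact: (porbit_iter s 1). Qed.

Lemma porbit_iterP s x y :
  reflect (exists n, y = iter n s x) (y \in porbit s x).
Proof.
apply: (iffP (porbitP _ _ _)) => [[n ->]|[n ->]]; exists n; by rewrite permX.
Qed.

Lemma porbit_ind s (P : pred T) x :
  P x -> (forall y, P y -> P (s y)) -> forall y, y \in porbit s x -> P y.
Proof.
move=> Px Ps y /porbit_iterP[n ->].
by elim: n => //= n IH; apply: Ps.
Qed.

Lemma porbit_trans s x y z :
  y \in porbit s x -> z \in porbit s y -> z \in porbit s x.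
Proof. by rewrite -!eq_porbit_mem => /eqP <-. Qed.

(** Composing with a transposition of two points of one cycle cuts the cycle;
    composing with a transposition of two cycles joins them.  This is all that
    happens to the faces of a map when an edge is added. *)
Lemma porbits_split s x y : x != y -> x \in porbit s y ->
  #|porbits (tperm x y * s)| = #|porbits s|.+1.
Proof.
move=> xy h; have := porbits_mul_tperm s x y.
by rewrite /= h xy /= addn0 addn1.
Qed.

Lemma porbits_merge s x y : x != y -> x \notin porbit s y ->
  #|porbits (tperm x y * s)|.+1 = #|porbits s|.
Proof.
move=> xy h; have := porbits_mul_tperm s x y.
by rewrite /= h xy /= addn2 addn1 => -[].
Qed.

Lemma tperm_split s x y : x != y -> x \in porbit s y ->
  x \notin porbit (tperm x y * s) y.
Proof.
move=> xy h; apply/negP => h'.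
have h1 := porbits_split xy h; have := porbits_split xy h'.
by rewrite mulgA tperm2 mul1g h1; lia.
Qed.

Lemma tperm_merge s x y : x != y -> x \notin porbit s y ->
  x \in porbit (tperm x y * s) y.
Proof.
move=> xy h; apply/negPn/negP => h'.
have h1 := porbits_merge xy h; have := porbits_merge xy h'.
by rewrite mulgA tperm2 mul1g -h1; lia.
Qed.

(** Cycles that contain neither of the two points are left alone. *)
Lemma tperm_orbit_notin s x y z :
  x \notin porbit s z -> y \notin porbit s z ->
  porbit (tperm x y * s) z =i porbit s z.
Proof.
move=> hx hy.
have E n : iter n (tperm x y * s)%g z = iter n s z.
  elim: n => //= n ->; rewrite permM tpermD //.
    by apply: contraNneq hx => ->; apply: porbit_iter.
  by apply: contraNneq hy => ->; apply: porbit_iter.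
by move=> w; apply/porbit_iterP/porbit_iterP => -[n ->]; exists n.
Qed.

Lemma tperm_merge_orbit s x y z : x != y -> x \notin porbit s y ->
  z \in porbit s x -> z \in porbit (tperm x y * s) x.
Proof.
move=> xy h /porbit_iterP[n ->].
have hm := tperm_merge xy h.
elim: n => [|n IH] /=; first exact: porbit_id.
set w := iter n s x in IH *.
have [wx|wx] := eqVneq w x.
  rewrite wx; apply: (porbit_trans (y := y)); first by rewrite porbit_sym.
  by have := porbit_step (tperm x y * s) y; rewrite permM tpermR.
have wy : w != y.
  by apply: contraNneq h => <-; rewrite porbit_sym; apply: porbit_iter.
apply: porbit_trans IH _.
by have := porbit_step (tperm x y * s) w; rewrite permM tpermD // eq_sym.
Qed.

(** Each cycle receives one unit, shared equally by its points. *)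
Lemma sum_porbit (F : realFieldType) s :
  (\sum_(x : T) (#|porbit s x|%:R^-1 : F) = #|porbits s|%:R)%R.
Proof.
rewrite (partition_big_imset (porbit s)) /= -/(porbits s) -sum1_card natr_sum.
apply: eq_bigr => C /imsetP[x _ ->].
rewrite (eq_bigr (fun _ => #|porbit s x|%:R^-1)%R); last by move=> y /eqP ->.
rewrite sumr_const.
have -> : #|[pred y | porbit s y == porbit s x]| = #|porbit s x|.
  by apply: eq_card => y; rewrite !inE eq_porbit_mem.
by rewrite -[LHS]mulr_natr mulVf // pnatr_eq0 card_porbit_neq0.
Qed.
End PermOrbits.

(** * Combinatorial maps and Euler's formula *)

Section Components.
Variable T : finType.

Definition component (e : rel T) x := [set y | connect e x y].
Definition components (e : rel T) := [set component e x | x in T].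

Lemma mem_component e x y : (y \in component e x) = connect e x y.
Proof. by rewrite inE. Qed.

Lemma eq_component e x y : symmetric e ->
  (component e x == component e y) = connect e x y.
Proof.
move=> sym_e; apply/eqP/idP => [E|xy].
  by rewrite -mem_component E mem_component.
by apply/setP => z; rewrite !inE (same_connect (sym_connect_sym sym_e) xy).
Qed.

(** The relation between connectivity in e and in e' says that e' arises from e
    by joining x and y. *)
Lemma components_merge e e' x y : symmetric e -> symmetric e' ->
  (forall z w, connect e' z w =
     [|| connect e z w, connect e z x && connect e y w
       | connect e z y && connect e x w]) ->
  ~~ connect e x y -> #|components e| = #|components e'|.+1.
Proof.
move=> se se' E nxy.
have cs := sym_connect_sym se.
pose Cx := component e x; pose Cy := component e y.
have CxCy : Cx != Cy by rewrite eq_component.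
pose R := components e :\ Cx :\ Cy.
have CxI : Cx \in components e by apply/imsetP; exists x.
have CyI : Cy \in components e by apply/imsetP; exists y.
have cR : #|components e| = #|R|.+2.
  by rewrite (cardsD1 Cx) CxI (cardsD1 Cy) !inE CyI eq_sym CxCy.
have mem' z : component e' z =
    if (z \in Cx) || (z \in Cy) then Cx :|: Cy else component e z.
  apply/setP => w; rewrite inE E !mem_component.
  case: ifP => [/orP[] h|/norP[h1 h2]].
  - rewrite -![connect e z _](same_connect cs h) connect0 !inE.
    by rewrite (negbTE nxy) /= orbF.
  - rewrite -![connect e z _](same_connect cs h) connect0 !inE.
    by rewrite (cs y x) (negbTE nxy) /= orbC.
  by rewrite (cs z x) (negbTE h1) (cs z y) (negbTE h2) !orbF inE.
have -> : components e' = (Cx :|: Cy) |: R.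
  apply/setP => C; apply/imsetP/idP => [[z _ ->]|].
    rewrite mem'; case: ifP => [_|/norP[h1 h2]]; first by rewrite !inE eqxx.
    rewrite !inE -/Cx -/Cy !eq_component //; apply/orP; right.
    move: h1 h2; rewrite !mem_component ![connect e _ z]cs => -> ->.
    by apply/imsetP; exists z.
  rewrite !inE => /orP[/eqP ->|/and3P[nCy nCx /imsetP[z _ Cz]]].
    by exists x => //; rewrite mem' mem_component connect0.
  exists z => //; rewrite mem' Cz; case: ifP => // h.
  move: nCx nCy; rewrite Cz !eq_component // ![connect e z _]cs.
  by move: h; rewrite !mem_component => /orP[] ->.
rewrite cardsU1 cR.
suff -> : Cx :|: Cy \notin R by [].
rewrite !inE; apply/negP => /and3P[h1 _ /imsetP[z _ Ez]].
have zx : x \in component e z by rewrite -Ez !inE connect0.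
have zy : y \in component e z by rewrite -Ez !inE connect0 orbT.
move: zx zy nxy; rewrite !mem_component => zx zy.
by rewrite -(same_connect cs zx) zy.
Qed.
End Components.

Section Maps.
Variables (D : finType) (s : {perm D}) (a : D -> D).
Hypothesis aK : involutive a.
Implicit Types (A : {set D}) (x y z : D).

(** The involution a followed only along the edges in A; the other darts are
    left dangling as half-edges.  Keeping them as fixed points lets every submap
    live on the same set of darts with the same rotation s, so that the faces
    for all A are permutations of one type. *)
Definition act A x := if (x \in A) && (a x \in A) then a x else x.

Lemma actK A : involutive (act A).
Proof.
move=> x; rewrite /act; case: (boolP ((x \in A) && (a x \in A))) => [|h].
  by rewrite aK andbC => ->.
by rewrite (negbTE h).
Qed.

Definition actp A : {perm D} := perm (inv_inj (actK A)).
Definition face A : {perm D} := (actp A * s)%g.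

Lemma faceE A x : face A x = s (act A x).
Proof. by rewrite permM permE. Qed.

Definition link A : rel D := fun x y => [|| y == s x, x == s y | y == act A x].

Lemma link_sym A : symmetric (link A).
Proof.
move=> x y; rewrite /link orbCA; congr [|| _, _ | _].
by apply/eqP/eqP => ->; rewrite actK.
Qed.

Notation conn A := (connect (link A)).

Lemma conn_sym A : connect_sym (link A).
Proof. exact/sym_connect_sym/link_sym. Qed.

Lemma conn_s A x : conn A x (s x).
Proof. by apply: connect1; rewrite /link eqxx. Qed.

Lemma conn_act A x : conn A x (act A x).
Proof. by apply: connect1; rewrite /link eqxx !orbT. Qed.

Lemma conn_face A x y : y \in porbit (face A) x -> conn A x y.
Proof.
apply: (porbit_ind (P := connect (link A) x)); first exact: connect0.
move=> z xz; rewrite faceE; apply: connect_trans xz _.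
exact: connect_trans (conn_act A z) (conn_s A _).
Qed.

Lemma conn_rotation A x y : y \in porbit s x -> conn A x y.
Proof.
apply: (porbit_ind (P := connect (link A) x)); first exact: connect0.
by move=> z xz; apply: connect_trans xz (conn_s A z).
Qed.

(** Stability under s is asked as an equation because links follow s in both
    directions; act A is its own inverse. *)
Lemma conn_ind A (P : pred D) x : P x ->
  (forall z, P z = P (s z)) -> (forall z, P z -> P (act A z)) ->
  forall y, conn A x y -> P y.
Proof.
move=> Px Ps Pa y /connectP[p]; elim: p x Px => [|z p IH] x Px /=.
  by move=> _ ->.
case/andP=> /or3P[] /eqP E; apply: IH.
- by rewrite E -Ps.
- by rewrite Ps -E.
- by rewrite E Pa.
Qed.

Lemma conn_mono A1 A2 : A1 \subset A2 ->
  forall z w, conn A1 z w -> conn A2 z w.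
Proof.
move=> sA z w; apply: connect_sub => u v /or3P[] /eqP ->.
- exact: conn_s.
- by rewrite conn_sym conn_s.
- rewrite /act; case: ifP => [/andP[h1 h2]|_]; last exact: connect0.
  have := conn_act A2 u.
  by rewrite /act (subsetP sA _ h1) (subsetP sA _ h2).
Qed.

Definition add_edge A x := x |: (a x |: A).

Section AddEdge.
Variables (A : {set D}) (x : D).
Hypotheses (xA : act A x = x) (xa : a x != x).

Let xA' : ~~ ((x \in A) && (a x \in A)).
Proof. by apply/negP => h; move: xA xa; rewrite /act h => ->; rewrite eqxx. Qed.

Lemma act_add z : act (add_edge A x) z = act A (tperm x (a x) z).
Proof.
have axA : act A (a x) = a x by rewrite /act aK andbC (negbTE xA').
case: tpermP => [->|->|zx zax].
- by rewrite axA /act /add_edge !inE !eqxx !orbT.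
- by rewrite xA /act /add_edge !inE aK !eqxx !orbT.
rewrite /act /add_edge !inE (can2_eq aK aK) (inj_eq (inv_inj aK)).
by move/eqP/negbTE: (zx) => ->; move/eqP/negbTE: (zax) => ->.
Qed.

(** The whole effect of an edge on the faces is one transposition, whence the
    counts below. *)
Lemma face_add : face (add_edge A x) = (tperm x (a x) * face A)%g.
Proof. by apply/permP => z; rewrite permM !faceE act_add. Qed.

Lemma conn_add z w : conn (add_edge A x) z w =
  [|| conn A z w, conn A z x && conn A (a x) w
    | conn A z (a x) && conn A x w].
Proof.
have m : {in predT &, forall u v, conn A u v -> conn (add_edge A x) u v}.
  move=> u v _ _; apply: conn_mono.
  by apply/subsetP => u'; rewrite !inE => ->; rewrite !orbT.
have xax : conn (add_edge A x) x (a x).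
  have := conn_act (add_edge A x) x.
  by rewrite act_add tpermL /act aK andbC (negbTE xA').
apply/idP/or3P.
  move=> h; apply/or3P; move: w h.
  apply: (conn_ind (P := fun w => [|| conn A z w, conn A z x && conn A (a x) w
    | conn A z (a x) && conn A x w])).
  - by rewrite connect0.
  - move=> u; have us := conn_s A u.
    by rewrite !(same_connect_r (@conn_sym A) us).
  - move=> u; rewrite act_add.
    have h1 := conn_act A (tperm x (a x) u).
    rewrite -!(same_connect_r (@conn_sym A) h1).
    case: tpermP => [->|->|_ _] //.
    + case/or3P=> [->|/andP[-> _]|/andP[-> _]]; rewrite ?connect0 ?orbT //.
    + case/or3P=> [->|/andP[-> _]|/andP[-> _]]; rewrite ?connect0 ?orbT //.
case=> [|/andP[h1 h2]|/andP[h1 h2]]; first exact: m.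
- apply: connect_trans (m _ _ _ _ h1) _ => //.
  exact: connect_trans xax (m _ _ _ _ h2).
- apply: connect_trans (m _ _ _ _ h1) _ => //.
  by rewrite conn_sym in xax; apply: connect_trans xax (m _ _ _ _ h2).
Qed.
End AddEdge.

(** The sets of darts that are unions of edges, fixed points of a not counting
    as edges. *)
Definition edge_set A := [forall x in A, (a x \in A) && (a x != x)].

Lemma edge_setP A x : edge_set A -> x \in A -> (a x \in A) /\ a x != x.
Proof. by move=> /forall_inP h /h /andP. Qed.

Lemma edge_set_mem A x : edge_set A -> (a x \in A) = (x \in A).
Proof.
move=> eA; apply/idP/idP => h; last by case: (edge_setP eA h).
by case: (edge_setP eA h); rewrite aK.
Qed.

Lemma edge_set_act A x : edge_set A -> act A x = if x \in A then a x else x.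
Proof. by move=> eA; rewrite /act edge_set_mem // andbb. Qed.

Lemma edge_set0 : edge_set set0.
Proof. by apply/forall_inP => x; rewrite inE. Qed.

Lemma edge_set_add A x : edge_set A -> a x != x -> edge_set (add_edge A x).
Proof.
move=> eA ax; apply/forall_inP => y; rewrite !inE.
case/or3P=> [/eqP->|/eqP->|/(edge_setP eA)[h1 h2]].
- by rewrite eqxx orbT.
- by rewrite aK eqxx eq_sym.
- by rewrite h1 !orbT.
Qed.

Lemma card_add_edge A x : edge_set A -> a x != x -> x \notin A ->
  #|add_edge A x| = #|A|.+2.
Proof.
move=> eA ax xA; rewrite !cardsU1 !inE negb_or eq_sym ax xA edge_set_mem //.
by rewrite xA.
Qed.

Lemma add_edge_sub A B x : edge_set B -> A \subset B -> x \in B ->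
  add_edge A x \subset B.
Proof.
move=> eB sAB xB; rewrite !subUset !sub1set xB sAB.
by rewrite (edge_set_mem _ eB) xB.
Qed.

Definition ncomp A := #|components (link A)|.

(** Faces, vertices, components and edges enter Euler's formula as 2 (V + F) = 4
    C + (number of darts); the two sides are kept apart since they are natural
    numbers. *)
Definition euler_lhs A := 2 * (#|porbits s| + #|porbits (face A)|).
Definition euler_rhs A := 4 * ncomp A + #|A|.

Section Step.
Variables (A : {set D}) (x : D).
Hypotheses (eA : edge_set A) (xA : x \notin A) (ax : a x != x).

Let actx : act A x = x. Proof. by rewrite edge_set_act // (negbTE xA). Qed.

(** The edge is a bridge: one component and one face fewer. *)
Lemma step_join : ~~ conn A x (a x) ->
  euler_lhs A + euler_rhs (add_edge A x) =
  euler_lhs (add_edge A x) + euler_rhs A.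
Proof.
move=> nc; rewrite /euler_lhs /euler_rhs card_add_edge // /ncomp face_add //.
have -> : #|components (link A)| = #|components (link (add_edge A x))|.+1.
  apply: (@components_merge _ _ _ x (a x)) => //; try exact: link_sym.
  by move=> z w; apply: conn_add.
have <- : #|porbits ((tperm x (a x) * face A)%g)|.+1 = #|porbits (face A)|.
  apply: porbits_merge; first by rewrite eq_sym.
  by rewrite porbit_sym; apply: contra nc; apply: conn_face.
lia.
Qed.

Lemma ncomp_add : conn A x (a x) -> ncomp (add_edge A x) = ncomp A.
Proof.
move=> cx; rewrite /ncomp; congr #|pred_of_set _|.
apply: eq_imset => z; apply/setP => w; rewrite !inE conn_add //.
apply/or3P/idP => [[]|] //; last by move=> ->; apply: Or31.
  by case/andP=> h1 h2; apply: connect_trans h1 (connect_trans cx h2).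
case/andP=> h1 h2; apply: connect_trans h1 (connect_trans _ h2).
by rewrite conn_sym.
Qed.

(** The edge cuts a face in two. *)
Lemma step_split : conn A x (a x) -> a x \in porbit (face A) x ->
  euler_lhs A + euler_rhs (add_edge A x) =
  euler_lhs (add_edge A x) + euler_rhs A.
Proof.
move=> cx fx; rewrite /euler_lhs /euler_rhs card_add_edge // ncomp_add //.
by rewrite face_add // porbits_split; [lia | rewrite eq_sym | rewrite porbit_sym].
Qed.

(** The edge joins two faces of one component: this is a handle, and the only
    way in which Euler's formula is lost. *)
Lemma step_handle : conn A x (a x) -> a x \notin porbit (face A) x ->
  euler_lhs A + euler_rhs (add_edge A x) =
  euler_lhs (add_edge A x) + euler_rhs A + 4.
Proof.
move=> cx fx; rewrite /euler_lhs /euler_rhs card_add_edge // ncomp_add //.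
rewrite face_add //; have := @porbits_merge _ (face A) x (a x).
by rewrite eq_sym ax porbit_sym fx => /(_ isT isT) <-; lia.
Qed.

Lemma step_le :
  euler_lhs (add_edge A x) + euler_rhs A <=
  euler_lhs A + euler_rhs (add_edge A x).
Proof.
have [cx|nc] := boolP (conn A x (a x)); last by rewrite step_join.
have [fx|fx] := boolP (a x \in porbit (face A) x).
  by rewrite step_split.
by rewrite step_handle // leq_addr.
Qed.
End Step.

(** Every set of edges between A and B is reached from A by adding edges one at
    a time. *)
Lemma edge_set_ind (P : {set D} -> Prop) A B : edge_set A -> edge_set B ->
  A \subset B -> P A ->
  (forall C x, edge_set C -> A \subset C -> C \subset B -> x \in B ->
     x \notin C -> a x != x -> P C -> P (add_edge C x)) ->
  P B.
Proof.
move=> eA eB; have [n] := ubnP #|B :\: A|; elim: n A eA => // n IH A eA.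
rewrite ltnS => le sAB PA step.
have [/eqP|[x]] := set_0Vmem (B :\: A).
  by rewrite setD_eq0 => sBA; have <- : A = B by apply/eqP; rewrite eqEsubset sAB.
rewrite inE => /andP[xA xB]; have [axB ax] := edge_setP eB xB.
apply: (IH (add_edge A x)).
- exact: edge_set_add.
- apply: leq_trans le; apply: proper_card; apply/properP; split.
    by apply/setDS/subsetP => z zA; rewrite !inE zA !orbT.
  by exists x; rewrite !inE ?xA ?xB // eqxx.
- exact: add_edge_sub.
- exact: step.
move=> C y eC sC; apply: step => //.
apply: subset_trans sC; apply/subsetP => z zA; by rewrite !inE zA !orbT.
Qed.

Lemma euler_set0 : euler_lhs set0 = euler_rhs set0.
Proof.
have E : face set0 = s.
  by apply/permP => x; rewrite faceE edge_set_act ?edge_set0 // inE.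
rewrite /euler_lhs /euler_rhs cards0 E addn0 /ncomp.
suff -> : components (link set0) = porbits s by lia.
apply: eq_imset => x; apply/setP => y; rewrite inE.
apply/idP/idP; last exact: conn_rotation.
move: y; apply: (conn_ind (P := fun y => y \in porbit s x)).
- exact: porbit_id.
- move=> z; apply/idP/idP => h.
    by apply: porbit_trans h (porbit_step _ _).
  by apply: porbit_trans h _; rewrite porbit_sym porbit_step.
- by move=> z; rewrite edge_set_act ?edge_set0 // inE.
Qed.

Lemma euler_le_mono A B : edge_set A -> edge_set B -> A \subset B ->
  euler_lhs B + euler_rhs A <= euler_lhs A + euler_rhs B.
Proof.
move=> eA eB sAB.
apply: (edge_set_ind (P := fun B =>
  euler_lhs B + euler_rhs A <= euler_lhs A + euler_rhs B) eA eB sAB) => //.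
move=> C x eC _ _ _ xC ax IH; have := step_le eC xC ax; lia.
Qed.

Lemma euler_le A : edge_set A -> euler_lhs A <= euler_rhs A.
Proof.
move=> eA; have := euler_le_mono edge_set0 eA (sub0set A).
by rewrite euler_set0; lia.
Qed.

(** Discrete Jordan property: no edge of U ever makes a handle, in whatever
    order edges are inserted.  Unlike Euler's equation it is inherited by
    subsets, and its use in proofs is that two darts joined by an edge lie in
    one face of what is already there. *)
Definition planar_on (U : {set D}) := forall A x, edge_set A ->
  A \subset U -> x \in U -> x \notin A -> conn A x (a x) ->
  a x \in porbit (face A) x.

(** A handle at any stage costs four that later steps cannot recover. *)
Lemma euler_planar U : edge_set U -> euler_rhs U <= euler_lhs U -> planar_on U.
Proof.
move=> eU EU A x eA sAU xU xA cx; have [_ ax] := edge_setP eU xU.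
apply/negPn/negP => fx.
have := step_handle eA xA ax cx fx.
have := euler_le_mono (edge_set_add eA ax) eU (add_edge_sub eU sAU xU).
have := euler_le eA; lia.
Qed.

Lemma planar_euler U : edge_set U -> planar_on U -> euler_lhs U = euler_rhs U.
Proof.
move=> eU pU; pose P B := euler_lhs B = euler_rhs B.
apply: (edge_set_ind (P := P) edge_set0 eU (sub0set U)); rewrite /P.
  exact: euler_set0.
move=> C x eC _ sCU xU xC ax IH.
have [cx|nc] := boolP (conn C x (a x)).
  have := step_split eC xC ax cx (pU _ _ eC sCU xU xC cx); lia.
have := step_join eC xC ax nc; lia.
Qed.

End Maps.

(** * The square grid is plane *)

Section Grid.
Variable n : nat.
Notation N := n.+1.

(** The dart ((i, j), (v, b)) sits at the point (i, j) and points vertically if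
    v, horizontally otherwise, and in the increasing direction if b.  At the
    border of the grid some darts dangle; [grid_a] fixes them, which keeps all
    points alike. *)
Definition grid_dart : finType := ('I_N * 'I_N * (bool * bool))%type.

Definition grid_rot (x : grid_dart) : grid_dart :=
  let: (p, (v, b)) := x in (p, (~~ v, if v then b else ~~ b)).

Lemma grid_rot_inj : injective grid_rot.
Proof. by move=> [p [[] []]] [q [[] []]] //= [->]. Qed.

Definition grid_s : {perm grid_dart} := perm grid_rot_inj.

Definition can_step (b : bool) (i : 'I_N) := if b then i < n else 0 < i.
Arguments can_step : simpl never.
(** The successor or predecessor of a coordinate; the default of [inord] only
    matters outside the grid, where [can_step] fails. *)
Definition grid_step (b : bool) (i : 'I_N) : 'I_N :=
  inord (if b then i.+1 else i.-1).

Lemma val_step b i : can_step b i ->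
  grid_step b i = (if b then i.+1 else i.-1) :> nat.
Proof.
by case: b => h; rewrite inordK // ltnS // (leq_trans (leq_pred _)) // -ltnS.
Qed.

Lemma can_step_step b i : can_step b i -> can_step (~~ b) (grid_step b i).
Proof.
move=> h; have := val_step h; rewrite /can_step.
by case: b h; rewrite /can_step /= => h ->; have := ltn_ord i; lia.
Qed.

Lemma grid_stepK b i : can_step b i -> grid_step (~~ b) (grid_step b i) = i.
Proof.
move=> h; apply/val_inj => /=; rewrite val_step ?can_step_step // val_step //.
by move: h; rewrite /can_step; case: b => //=; case: (nat_of_ord i).
Qed.

Definition grid_inside (x : grid_dart) : bool :=
  let: ((i, j), (v, b)) := x in can_step b (if v then j else i).

Definition grid_a (x : grid_dart) : grid_dart :=
  let: ((i, j), (v, b)) := x in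
  if grid_inside x then
    ((if v then i else grid_step b i, if v then grid_step b j else j), (v, ~~ b))
  else x.

Lemma grid_inside_a x : grid_inside x -> grid_inside (grid_a x).
Proof.
case: x => [[i j] [v b]] /=; case: v => h; rewrite h /=; exact: can_step_step.
Qed.

Lemma grid_aK : involutive grid_a.
Proof.
move=> x; have [h|h] := boolP (grid_inside x); last first.
  have E : grid_a x = x.
    by case: x h => [[i j] [v b]] /= /negbTE ->.
  by rewrite !E.
have := grid_inside_a h; case: x h => [[i j] [v b]] /=.
by case: v => h; rewrite h /= => ->; rewrite negbK grid_stepK.
Qed.

Definition grid_edges := [set x | grid_inside x].

Lemma grid_edgesP : edge_set grid_a grid_edges.
Proof.
apply/forall_inP => x; rewrite !inE => h; rewrite grid_inside_a //=.
case: x h => [[i j] [v b]] /= h; rewrite h.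
by apply/eqP => -[_ _]; case: (b).
Qed.

(** The edges are inserted row by row, and for each point first the edge below
    it, then the edge on its left.  An edge is ranked through its dart in the
    decreasing direction; doubling separates the two edges of one point. *)
Definition neg_rank (x : grid_dart) : nat :=
  let: ((i, j), (v, b)) := x in ((j * N + i).*2 + ~~ v)%N.
Definition rank (x : grid_dart) : nat :=
  neg_rank (if x.2.2 then grid_a x else x).

Lemma rank_a x : grid_inside x -> rank (grid_a x) = rank x.
Proof.
move=> h; rewrite /rank.
have -> : (grid_a x).2.2 = ~~ x.2.2.
  by case: x h => [[i j] [v b]] /= ->.
by case: (x.2.2) => //=; rewrite grid_aK.
Qed.

Lemma neg_rank_inj (x y : grid_dart) : x.2.2 = false -> y.2.2 = false ->
  neg_rank x = neg_rank y -> x = y.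
Proof.
case: x y => [[i j] [v b]] [[i' j'] [v' b']] /= -> -> h.
have vv : v = v' by move: h; case: v v' => -[]; lia.
have ij : (j * N + i = j' * N + i')%N by move: h; rewrite vv; lia.
have jj : j = j' :> nat.
  have := congr1 (divn^~ N) ij.
  by rewrite !divnMDl // !divn_small // !addn0.
have ii : i = i' :> nat by move: ij; rewrite jj => /addnI.
by rewrite vv (val_inj jj) (val_inj ii).
Qed.

Definition grid_upto m := [set x in grid_edges | rank x < m].

Lemma grid_upto_edges m : edge_set grid_a (grid_upto m).
Proof.
apply/forall_inP => x; rewrite !inE => /andP[h r].
rewrite grid_inside_a // rank_a // r /=.
by case: (edge_setP grid_edgesP (x := x)) => //; rewrite inE.
Qed.

Lemma grid_mem_upto m i j v b : (i, j, (v, b)) \in grid_upto m =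
  can_step b (if v then j else i) &&
  ((if b then (if v then (j.+1 * N + i).*2 else (j * N + i.+1).*2.+1)
    else ((j * N + i).*2 + ~~ v)) < m).
Proof.
rewrite !inE /=; case h: (can_step _ _) => //=; rewrite /rank /=.
case: b h => h //=; rewrite h /=; case: v h => /= h; rewrite val_step //=.
  by rewrite addn0.
by rewrite addn1.
Qed.

Lemma grid_upto_step m x : x \in grid_edges -> x.2.2 = false -> rank x = m ->
  grid_upto m.+1 = add_edge grid_a (grid_upto m) x.
Proof.
move=> xU nx rx; have xi : grid_inside x by move: xU; rewrite inE.
apply/setP => y; rewrite !inE ltnS leq_eqVlt.
apply/andP/or3P => [[yU /orP[/eqP ry|ry]]|[/eqP ->|/eqP ->|/andP[yU ry]]].
- case ny: y.2.2; last first.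
    apply: Or31; apply/eqP; apply: neg_rank_inj => //.
    by move: rx ry; rewrite /rank nx ny => -> ->.
  apply: Or32; apply/eqP; apply: (can_inj grid_aK); rewrite grid_aK.
  have nay : (grid_a y).2.2 = false.
    by move: yU ny; case: (y) => [[i j] [v b]] /= -> ->.
  apply: neg_rank_inj => //.
  by move: rx ry; rewrite /rank nx ny => -> ->.
- by apply: Or33; rewrite yU ry.
- by rewrite rx eqxx.
- by rewrite grid_inside_a // rank_a // rx eqxx.
- by rewrite yU ry orbT.
Qed.

Notation gface m := (face grid_s grid_aK (grid_upto m)).

Lemma grid_face m i j v b : gface m (i, j, (v, b)) =
  grid_rot (if (i, j, (v, b)) \in grid_upto m then grid_a (i, j, (v, b))
            else (i, j, (v, b))).
Proof. by rewrite faceE permE edge_set_act ?grid_upto_edges //; apply: grid_aK. Qed.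

(** When the edge on the left of (i, j) comes, three sides of the unit square
    below it are present, and four steps of the face inside this square lead
    from one end of the missing side to the other. *)
Lemma grid_square (i j : 'I_N) : 0 < i -> 0 < j ->
  (i, j, (false, false)) \in
    porbit (gface (rank (i, j, (false, false)))) (grid_a (i, j, (false, false))).
Proof.
move=> i0 j0; rewrite /rank /=; set m := (_ + _)%N.
have mE : m = (j * N + i).*2.+1 by rewrite /m addn1.
rewrite mE {mE}; clearbody m.
have si : can_step false i by [].
have sj : can_step false j by [].
have vi := val_step si; have vj := val_step sj; rewrite /= in vi vj.
have sTi : can_step true (grid_step false i) by apply: can_step_step si.
have sTj : can_step true (grid_step false j) by apply: can_step_step sj.
have ki := grid_stepK si; have kj := grid_stepK sj.
have [iN jN] := (ltn_ord i, ltn_ord j).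
rewrite /= si; apply/porbit_iterP; exists 4; rewrite /=.
rewrite grid_face grid_mem_upto sTi /= vi prednK // ltnn /=.
rewrite grid_face grid_mem_upto sj /= vi.
have -> : (j * N + i.-1).*2 + 0 < (j * N + i).*2.+1 by lia.
rewrite /= sj /= grid_face grid_mem_upto sTi /= vi vj.
have -> : (j.-1 * N + i.-1.+1).*2.+1 < (j * N + i).*2.+1.
  by rewrite prednK // ltnS ltn_double ltn_add2r ltn_pmul2r // ltn_predL.
rewrite /= sTi /= ki grid_face grid_mem_upto sTj /= vj prednK //.
rewrite ltnS leqnn.
by rewrite /= sTj /= kj.
Qed.

(** A point without edges yet: the first edge at a point is always a bridge. *)
Lemma grid_isolated m (x : grid_dart) :
  (forall y, y.1 = x.1 -> y \notin grid_upto m) -> x \in grid_edges ->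
  ~~ connect (link grid_s grid_a (grid_upto m)) x (grid_a x).
Proof.
move=> iso xU; apply/negP => cx.
have : (grid_a x).1 == x.1.
  apply: (conn_ind (P := fun y : grid_dart => y.1 == x.1) (eqxx _) _ _ cx) => [z|z /eqP zx].
    by rewrite permE; case: z => [p [v b]].
  by rewrite (edge_set_act (@grid_aK)) ?grid_upto_edges ?(negbTE (iso _ zx)) ?zx.
move: xU; case: (x) => [[i j] [v b]]; rewrite inE /= => h; rewrite h /=.
rewrite xpair_eqE; have := val_step h.
by case: v h => h e /andP[/eqP h1 /eqP h2];
  [move: e; rewrite h2|move: e; rewrite h1]; move: h; rewrite /can_step;
  case: b {h1 h2} => /=; lia.
Qed.

Arguments grid_a : simpl never.

(** Each inserted edge is either the first one at its point or closes a unit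
    square, hence never a handle. *)
Lemma grid_euler m : euler_lhs grid_s grid_aK (grid_upto m) =
  euler_rhs grid_s grid_a (grid_upto m).
Proof.
elim: m => [|m IH].
  have -> : grid_upto 0 = set0 by apply/setP => x; rewrite !inE ltn0 andbF.
  exact: euler_set0.
have [/existsP[x]|h] :=
  boolP [exists x, [&& x \in grid_edges, ~~ x.2.2 & rank x == m]]; last first.
  suff -> : grid_upto m.+1 = grid_upto m by [].
  apply/setP => y; rewrite !inE ltnS leq_eqVlt andb_orr.
  case: (boolP (grid_inside y && (rank y == m))) => // /andP[yi yr].
  case/negP: h; apply/existsP.
  case ny: y.2.2; last by exists y; rewrite inE yi ny yr.
  exists (grid_a y); rewrite inE grid_inside_a // rank_a // yr andbT.
  by move: yi ny; rewrite /grid_a; case: (y) => [[i j] [v b]] /= -> ->.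
case/and3P=> xU /negbTE nx /eqP rx.
have xA : x \notin grid_upto m by rewrite !inE rx ltnn andbF.
have [_ ax] := edge_setP grid_edgesP xU.
rewrite (grid_upto_step xU nx rx).
suff E : euler_lhs grid_s grid_aK (grid_upto m) +
  euler_rhs grid_s grid_a (add_edge grid_a (grid_upto m) x) =
  euler_lhs grid_s grid_aK (add_edge grid_a (grid_upto m) x) +
  euler_rhs grid_s grid_a (grid_upto m) by lia.
have [cx|nc] := boolP (connect (link grid_s grid_a (grid_upto m)) x (grid_a x));
  last by apply: step_join => //; apply: grid_upto_edges.
apply: step_split => //; first exact: grid_upto_edges.
rewrite porbit_sym -rx.
case: x xU nx rx {xA ax} cx => [[i j] [v b]] /= + nb; rewrite nb => xU rx cx.
have x2 : can_step false (if v then j else i) by move: xU; rewrite inE.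
case: v x2 xU rx cx => /= x2 xU rx cx; last first.
  have [j0|j0] := posnP j; last exact: grid_square.
  exfalso; move: cx; apply/negP; apply: grid_isolated => //.
  move=> [[i' j'] [v b']] /= [-> ->]; rewrite grid_mem_upto -rx /rank /= /can_step.
  by case: v; case: b' => /=; rewrite ?j0 //=; lia.
exfalso; move: cx; apply/negP; apply: grid_isolated => //.
move=> [[i' j'] [v b']] /= [-> ->]; rewrite grid_mem_upto -rx /rank /= /can_step.
by case: v; case: b' => /=; lia.
Qed.

(** Euler's formula holds for the whole grid, hence for all its subgraphs. *)
Theorem grid_planar : planar_on grid_s grid_aK grid_edges.
Proof.
apply: euler_planar; first exact: grid_edgesP.
have -> : grid_edges = grid_upto (\max_x rank x).+1.
  by apply/setP => x; rewrite !inE ltnS leq_bigmax andbT.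
by rewrite grid_euler.
Qed.
End Grid.
Arguments can_step {n} b i : simpl never.
Arguments grid_a {n} x : simpl never.

(** * Minors of plane maps *)

Section FirstReturn.
Variables (D D' : finType) (p : {perm D}) (h : D' -> D).
Hypothesis h_inj : injective h.

(** The permutation induced by p on a subset, here the range of h: follow p
    until the subset is met again. *)
Definition first_return (r : D' -> D') := forall x, exists k,
  h (r x) = iter k.+1 p (h x) /\
  forall j, j < k -> iter j.+1 p (h x) \notin codom h.

Lemma first_return_exists : exists r, first_return r.
Proof.
have ex x : exists k, iter k.+1 p (h x) \in codom h.
  exists #|porbit p (h x)|.-1; rewrite prednK ?iter_porbit ?codom_f //.
  by rewrite lt0n card_porbit_neq0.
have fr x : {y | exists k, h y = iter k.+1 p (h x) /\
    forall j, j < k -> iter j.+1 p (h x) \notin codom h}.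
  case: (ex_minnP (ex x)) => k kh kmin.
  exists (iinv kh), k; rewrite f_iinv; split=> // j jk.
  by apply/negP => /kmin; rewrite leqNgt jk.
by exists (fun x => sval (fr x)) => x; case: (fr x).
Qed.

Variable r : D' -> D'.
Hypothesis rP : first_return r.

Lemma iter_perm_inj k : injective (iter k p).
Proof. by elim: k => //= k IH x y /perm_inj /IH. Qed.

Lemma first_return_inj : injective r.
Proof.
move=> x y rxy; have [k [kE kmin]] := rP x; have [l [lE lmin]] := rP y.
have E : iter k.+1 p (h x) = iter l.+1 p (h y) by rewrite -kE -lE rxy.
wlog kl : x y k l rxy kE kmin lE lmin E / k <= l.
  move=> W; case/orP: (leq_total k l) => h'; first exact: (W x y k l rxy kE kmin lE lmin E h').
  exact/esym/(W y x l k (esym rxy) lE lmin kE kmin (esym E) h').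
have E' : h x = iter (l - k) p (h y).
  apply: (@iter_perm_inj k.+1); rewrite -iterD E.
  by have -> : k.+1 + (l - k) = l.+1 by lia.
case: (posnP (l - k)) E' => [-> /h_inj //|].
case lk: (l - k) => [|j] // _ E'; have := lmin j.
by rewrite -E' codom_f => /(_ _)/negP; case; [lia|].
Qed.

Lemma first_return_orbit x : h (r x) \in porbit p (h x).
Proof. by have [k [-> _]] := rP x; apply: porbit_iter. Qed.

Lemma first_return_iter x y : h y \in porbit p (h x) ->
  exists m, y = iter m r x.
Proof.
(* induct on the number of steps of p; the first return after k + 1 of them *)
case/porbit_iterP => n; have [m] := ubnP n; elim: m n x => // m IH n x nm E.
have [k [kE kmin]] := rP x.
case: n nm E => [|n] nm E; first by exists 0; apply: h_inj.
case: (ltnP n k) => nk; first by have := kmin _ nk; rewrite -E codom_f.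
have E1 : h y = iter (n - k) p (h (r x)).
  by rewrite E kE -iterD; have -> : n - k + k.+1 = n.+1 by lia.
have [|q ->] := IH (n - k) (r x) _ E1; first lia.
by exists q.+1; rewrite iterSr.
Qed.
End FirstReturn.

(** A plane embedding of the simple graph e.  The darts at a vertex form one
    cycle of the rotation, and a dart is determined by its two ends. *)
Record plane_map (V : finType) (e : rel V) := PlaneMap {
  graph_sym : symmetric e;
  graph_irr : irreflexive e;
  dart : finType;
  rot : {perm dart};
  opp : dart -> dart;
  tail : dart -> V;
  oppK : involutive opp;
  tail_rot : forall x, tail (rot x) = tail x;
  tail_orbit : forall x y, tail x = tail y -> y \in porbit rot x;
  dart_inj : forall x y, tail x = tail y -> tail (opp x) = tail (opp y) -> x = y;
  dart_edge : forall x, e (tail x) (tail (opp x));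
  edge_dart : forall u v, e u v -> exists x, tail x = u /\ tail (opp x) = v;
  map_planar : planar_on rot oppK [set: dart] }.

Section Minor.
Variables (D : finType) (s : {perm D}) (a : D -> D) (aK : involutive a).
Variable U : {set D}.
Hypotheses (eU : edge_set a U) (pU : planar_on s aK U).
Variables (V : finType) (e : rel V) (e_sym : symmetric e) (e_irr : irreflexive e).
Variable lab : D -> option V.
Hypothesis lab_s : forall x, lab (s x) = lab x.

Let I := [set x in U | lab x == lab (a x)].

Hypothesis lab_conn : forall u x y, lab x = Some u -> lab y = Some u ->
  connect (link s a I) x y.
Hypothesis lab_edge : forall u v, e u v ->
  exists x, [/\ x \in U, lab x = Some u & lab (a x) = Some v].

Notation conn A := (connect (link s a A)).
Notation face A := (face s aK A).

Let eI : edge_set a I.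
Proof.
apply/forall_inP => x; rewrite !inE => /andP[xU xl].
by have [axU ax] := edge_setP eU xU; rewrite axU aK eq_sym xl ax.
Qed.

(** Joining two trees by an edge joins their contours: around a forest there is
    exactly one face per component. *)
Lemma conn_face_add B x : edge_set a B -> a x != x -> x \notin B ->
  ~~ conn B x (a x) ->
  (forall y z, conn B y z -> z \in porbit (face B) y) ->
  forall y z, conn (add_edge a B x) y z ->
    z \in porbit (face (add_edge a B x)) y.
Proof.
move=> eB ax xB nc H.
have actx : act a B x = x by rewrite edge_set_act // (negbTE xB).
have fx : x \notin porbit (face B) (a x).
  by apply: contra nc => /conn_face; rewrite (conn_sym s aK).
have xa : x != a x by rewrite eq_sym.
set F' := face _.
have F'E : F' = (tperm x (a x) * face B)%g by rewrite /F' face_add.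
have jx y : conn B x y -> y \in porbit F' x.
  by move/H; rewrite F'E; apply: tperm_merge_orbit.
have ja y : conn B (a x) y -> y \in porbit F' x.
  move/H => h; apply: (porbit_trans (y := a x)).
    by rewrite F'E porbit_sym; apply: tperm_merge.
  rewrite F'E tpermC; apply: tperm_merge_orbit => //.
  by rewrite porbit_sym.
have j2 y z : y \in porbit F' x -> z \in porbit F' x -> z \in porbit F' y.
  by move=> h1 h2; apply: porbit_trans h2; rewrite porbit_sym.
move=> y z; rewrite conn_add //; case/or3P=> [yz|/andP[h1 h2]|/andP[h1 h2]].
- have [xy|xy] := boolP (conn B x y).
    by apply: j2; apply: jx => //; apply: connect_trans xy yz.
  have [ay|ay] := boolP (conn B (a x) y).
    by apply: j2; apply: ja => //; apply: connect_trans ay yz.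
  rewrite F'E tperm_orbit_notin; first exact: H.
    by apply: contra xy => /conn_face; rewrite (conn_sym s aK).
  by apply: contra ay => /conn_face; rewrite (conn_sym s aK).
- by apply: j2; [apply: jx; rewrite (conn_sym s aK)|apply: ja].
- by apply: j2; [apply: ja; rewrite (conn_sym s aK)|apply: jx].
Qed.

(** A maximal set of edges inside the branch sets with a single face per
    component; maximality makes it connect as much as all of I does, so it is a
    spanning forest of the branch sets. *)
Lemma forest_exists : exists B : {set D},
  [/\ B \subset I, edge_set a B,
      forall y z, conn B y z -> z \in porbit (face B) y
    & forall y z, conn I y z -> conn B y z].
Proof.
pose P (B : {set D}) := [&& B \subset I, edge_set a B &
  [forall y, forall z, conn B y z ==> (z \in porbit (face B) y)]].
have P0 : P set0.
  rewrite /P sub0set edge_set0 /=; apply/forallP => y; apply/forallP => z.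
  apply/implyP; move: z; apply: (conn_ind (P := fun z => z \in porbit (face set0) y)).
  - exact: porbit_id.
  - have E : face set0 = s.
      by apply/permP => x; rewrite faceE edge_set_act ?edge_set0 // inE.
    move=> z; rewrite E; apply/idP/idP => h.
      exact: porbit_trans h (porbit_step _ _).
    by apply: porbit_trans h _; rewrite porbit_sym porbit_step.
  - by move=> z; rewrite edge_set_act ?edge_set0 // inE.
case: (arg_maxnP (fun B : {set D} => #|B|) P0) => B /and3P[BI eB BP] Bmax.
have BP' y z : conn B y z -> z \in porbit (face B) y.
  by move/forallP: BP => /(_ y)/forallP/(_ z)/implyP.
exists B; split=> // y z.
apply: connect_sub => u v /or3P[] /eqP ->.
- exact: conn_s.
- by rewrite (conn_sym s aK) conn_s.
rewrite edge_set_act //; case: ifP => uI; last exact: connect0.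
apply/negPn/negP => nc.
have [_ au] := edge_setP eI uI.
have uB : u \notin B.
  by apply: contra nc => uB; have := conn_act s a B u; rewrite edge_set_act // uB.
suff /Bmax : P (add_edge a B u) by rewrite /= card_add_edge // ltnNge leqnSn.
rewrite /P add_edge_sub // edge_set_add //=.
apply/forallP => y'; apply/forallP => z'; apply/implyP.
exact: conn_face_add.
Qed.

(** Contract the trees of a spanning forest B of the branch sets.  The contour
    of the tree of u meets the chosen darts towards the neighbours of u in a
    cyclic order, which is the rotation at u; so the rotation of the minor is
    the first return of the face permutation of B to the chosen darts.  A face
    of a submap of the minor is then again a first return, of the face
    permutation of B together with the corresponding chosen edges, and the
    Jordan property is inherited. *)
Theorem plane_minor : inhabited (plane_map e).
Proof.
have [B [BI eB Bface Bconn]] := forest_exists.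
pose dG : finType := {p : V * V | e p.1 p.2}.
have aG_proof (x : dG) : e (val x).2 (val x).1 by rewrite e_sym (valP x).
pose aG (x : dG) : dG := exist _ ((val x).2, (val x).1) (aG_proof x).
have aGK : involutive aG by move=> x; apply: val_inj; case: x => [[]].
(* a host dart for each edge of the graph, chosen for one orientation *)
have ex_del (x : dG) : exists y, [&& y \in U, lab y == Some (val x).1
    & lab (a y) == Some (val x).2].
  have [y [yU h1 h2]] := lab_edge (valP x).
  by exists y; rewrite yU h1 h2 !eqxx.
pose del0 (x : dG) := xchoose (ex_del x).
pose lt (x : dG) := enum_rank (val x).1 < enum_rank (val x).2.
pose del x := if lt x then del0 x else a (del0 (aG x)).
have delP x : [/\ del x \in U, lab (del x) = Some (val x).1
    & lab (a (del x)) = Some (val x).2].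
  rewrite /del; case: ifP => _; rewrite /del0.
    by have /and3P[? /eqP ? /eqP ?] := xchooseP (ex_del x).
  have /and3P[h1 /eqP h2 /eqP h3] := xchooseP (ex_del (aG x)).
  by rewrite aK (edge_set_mem aK _ eU).
have del_a x : del (aG x) = a (del x).
  rewrite /del aGK; have ltC : lt (aG x) = ~~ lt x.
    rewrite /lt /= -leqNgt [RHS]leq_eqVlt; case: eqP => //= /ord_inj /enum_rank_inj E.
    by have := valP x; rewrite E e_irr.
  by rewrite ltC; case: (lt x); rewrite /= ?aK.
have del_inj : injective del.
  move=> x y E; have [_ h1 h2] := delP x; have [_ h3 h4] := delP y.
  apply: val_inj; rewrite (surjective_pairing (val x)) (surjective_pairing (val y)).
  by move: h3 h4; rewrite -E h1 h2 => -[->] [->].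
have [r rP] := first_return_exists (face B) del.
have lab_conn_eq y z : conn B y z -> lab y = lab z.
  move=> yz; apply/eqP; move: z yz.
  apply: (conn_ind (P := fun z => lab y == lab z)) => // [z|z /eqP ->].
    by rewrite lab_s.
  rewrite edge_set_act //; case: ifP => // /(subsetP BI).
  by rewrite inE => /andP[].
pose sG : {perm dG} := perm (first_return_inj del_inj rP).
have sGE x : sG x = r x by rewrite permE.
have sG_orb x y : (val x).1 = (val y).1 -> y \in porbit sG x.
  move=> E; have [_ h1 _] := delP x; have [_ h2 _] := delP y.
  have c : conn B (del x) (del y) by apply/Bconn/(lab_conn h1); rewrite E.
  have [m ->] := first_return_iter del_inj rP (Bface _ _ c).
  by apply/porbit_iterP; exists m; apply: eq_iter => z; rewrite sGE.
have sG_tail x : (val (sG x)).1 = (val x).1.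
  have [_ h1 _] := delP x; have [_ h2 _] := delP (sG x).
  have := lab_conn_eq _ _ (conn_face (first_return_orbit rP x)).
  by rewrite -sGE h1 h2 => -[].
have del_nB x : del x \notin B.
  apply/negP => /(subsetP BI); rewrite inE => /andP[_].
  have [_ -> ->] := delP x; move=> /eqP[E].
  by have := valP x; rewrite E e_irr.
split.
apply: (@PlaneMap _ _ e_sym e_irr dG sG aG (fun x => (val x).1)) => //.
- move=> x y /= h1 h2; apply: val_inj.
  by rewrite (surjective_pairing (val x)) (surjective_pairing (val y)) h1 h2.
- by move=> x; apply: valP x.
- by move=> u v uv; exists (exist _ (u, v) uv).
move=> A x eA _ _ xA cx.
pose A' := B :|: del @: A.
have mem_dA y : (del y \in del @: A) = (y \in A) by apply: mem_imset.
have eA' : edge_set a A'.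
  apply/forall_inP => y; rewrite !inE => /orP[yB|/imsetP[z zA ->]].
    by have [-> ->] := edge_setP eB yB.
  have [dU _ _] := delP z; have [_ ->] := edge_setP eU dU.
  by rewrite -del_a mem_dA (edge_setP eA zA).1 orbT.
have mem_A' y : (del y \in A') = (y \in A).
  by rewrite inE mem_dA (negbTE (del_nB y)).
have FA' z : z \notin codom del -> face A' z = face B z.
  move=> zd; rewrite !faceE !edge_set_act // inE.
  case zB: (z \in B) => //=; case: ifP => // /imsetP[y _ E].
  by rewrite E codom_f in zd.
have FA'del y : face A' (del y) = face B (del (act aG A y)).
  rewrite !faceE !edge_set_act // mem_A' (negbTE (del_nB _)).
  by case: ifP => // _; rewrite del_a.
have frA : first_return (face A') del (act aG A \; r).
  move=> y; have [k [kE kmin]] := rP (act aG A y).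
  have it j : j <= k -> iter j.+1 (face A') (del y) =
      iter j.+1 (face B) (del (act aG A y)).
    elim: j => [_|j IH jk]; first by rewrite /= FA'del.
    by rewrite [LHS]iterS [RHS]iterS IH ?FA' ?kmin // ltnW.
  exists k; split; first by rewrite it.
  by move=> j jk; rewrite it ?kmin // ltnW.
have cB y z : conn B y z -> conn A' y z.
  by apply: conn_mono => //; apply: subsetUl.
have c' y : connect (link sG aG A) x y -> conn A' (del x) (del y).
  move: y; apply: (conn_ind (P := fun y => conn A' (del x) (del y))).
  - exact: connect0.
  - move=> y; apply: (same_connect_r (conn_sym s aK A')); apply: cB.
    by rewrite sGE; apply: conn_face (first_return_orbit rP y).
  - move=> y xy; apply: connect_trans xy _.
    have := conn_act s a A' (del y); rewrite !edge_set_act // mem_A'.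
    by case: ifP; rewrite ?del_a.
have dxU : del x \in U by case: (delP x).
have A'U : A' \subset U.
  rewrite subUset; apply/andP; split.
    by apply: subset_trans BI _; apply/subsetP => y; rewrite inE => /andP[].
  by apply/subsetP => _ /imsetP[y _ ->]; case: (delP y).
have := pU eA' A'U dxU; rewrite mem_A' xA -del_a => /(_ isT (c' _ cx)).
case/(first_return_iter del_inj frA) => m E.
rewrite E; apply/porbit_iterP; exists m; apply: eq_iter => z.
by rewrite faceE sGE.
Qed.
End Minor.

(** * Graphs drawn by walks in a grid *)

Section GridModel.
Variable n : nat.
Notation pixel := ('I_n.+1 * 'I_n.+1)%type.
Implicit Types (p q : pixel).

(** Two pixels that are equal or share a side. *)
Definition touch : rel pixel := fun p q =>
  (p == q) || [exists d : bool * bool, grid_inside (p, d : bool * bool) &&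
     ((grid_a (p, d)).1 == q)].

Lemma touch_refl p : touch p p. Proof. by rewrite /touch eqxx. Qed.

Lemma touch_sym : symmetric touch.
Proof.
have H p q : touch p q -> touch q p.
  case/orP=> [/eqP ->|/existsP[d /andP[di /eqP <-]]]; first exact: touch_refl.
  apply/orP; right; apply/existsP; exists (grid_a (p, d)).2.
  by rewrite -surjective_pairing grid_inside_a // grid_aK eqxx.
by move=> p q; apply/idP/idP; apply: H.
Qed.

Lemma touch_hor (i i' j : 'I_n.+1) : i <= i'.+1 -> i' <= i.+1 ->
  touch (i, j) (i', j).
Proof.
wlog le : i i' / i <= i' => [W|] h1 h2.
  by case/orP: (leq_total i i') => h; [|rewrite touch_sym]; apply: W.
case: (eqVneq i i') => [->|ne]; first exact: touch_refl.
have lt : i < i' by rewrite ltn_neqAle ne.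
have ci : can_step true i by rewrite /can_step; have := ltn_ord i'; lia.
apply/orP; right; apply/existsP; exists (false, true) => /=.
rewrite ci /grid_a /= ci /= xpair_eqE eqxx andbT.
by apply/eqP/val_inj; rewrite /= val_step //=; lia.
Qed.

Lemma touch_ver (i j j' : 'I_n.+1) : j <= j'.+1 -> j' <= j.+1 ->
  touch (i, j) (i, j').
Proof.
wlog le : j j' / j <= j' => [W|] h1 h2.
  by case/orP: (leq_total j j') => h; [|rewrite touch_sym]; apply: W.
case: (eqVneq j j') => [->|ne]; first exact: touch_refl.
have lt : j < j' by rewrite ltn_neqAle ne.
have ci : can_step true j by rewrite /can_step; have := ltn_ord j'; lia.
apply/orP; right; apply/existsP; exists (true, true) => /=.
rewrite ci /grid_a /= ci /= xpair_eqE eqxx /=.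
by apply/eqP/val_inj; rewrite /= val_step //=; lia.
Qed.

Variables (V : finType) (e : rel V) (e_sym : symmetric e) (e_irr : irreflexive e).
Variables (c : V -> pixel) (hw mw : V -> V -> seq pixel).
Local Notation "u <<< v" := (enum_rank u < enum_rank v) (at level 70).

Hypothesis hw_path : forall u v, e u v -> path touch (c u) (hw u v).
Hypothesis mw_path : forall u v, e u v -> u <<< v ->
  path touch (last (c u) (hw u v)) (mw u v).
Hypothesis mw_last : forall u v, e u v -> u <<< v ->
  last (last (c u) (hw u v)) (mw u v) = last (c v) (hw v u).
Hypothesis hw_disjoint : forall u v x y p, e u v -> e x y ->
  p \in c u :: hw u v -> p \in c x :: hw x y -> u = x.
Hypothesis mw_hw_disjoint : forall u v x y p, e u v -> u <<< v -> e x y ->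
  p \in mw u v -> p \in c x :: hw x y -> x = u \/ x = v.
Hypothesis mw_disjoint : forall u v x y p, e u v -> u <<< v -> e x y -> x <<< y ->
  p \in mw u v -> p \in mw x y -> u = x /\ v = y.

(** The walk hw u v starts at the centre c u of u and covers the part of the
    edge uv near u; the walk mw u v leads from its end to the end of hw v u, and
    exists in one direction only, from the smaller to the larger end. *)
Let star u p := [exists v, e u v && (p \in c u :: hw u v)].
(** The middle walk is cut just before it first meets the star of v; the part
    before that is given to u, so that the branch sets of u and v touch without
    overlapping. *)
Let ext u v := take (find (star v) (mw u v)) (mw u v).
Let branch u p :=
  star u p || [exists v, [&& e u v, u <<< v & p \in ext u v]].

Let lt_total u v : e u v -> (u <<< v) = ~~ (v <<< u).
Proof.
move=> uv; rewrite -leqNgt [RHS]leq_eqVlt.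
by case: eqP => // /ord_inj /enum_rank_inj E; rewrite E e_irr in uv.
Qed.

Let ext_sub u v p : p \in ext u v -> p \in mw u v.
Proof. exact: mem_take. Qed.

Let ext_star u v p : p \in ext u v -> ~~ star v p.
Proof.
move=> /(nthP p)[i]; rewrite size_take_min => hi <-.
have lt : i < find (star v) (mw u v) by move: hi; rewrite leq_min => /andP[].
by rewrite nth_take // (before_find _ lt).
Qed.

Let starP u p : reflect (exists2 v, e u v & p \in c u :: hw u v) (star u p).
Proof.
by apply: (iffP existsP) => [[v /andP[]]|[v h1 h2]]; exists v => //; rewrite h1.
Qed.

(** Different vertices have disjoint branch sets. *)
Let branch_inj u x p : branch u p -> branch x p -> u = x.
Proof.
wlog: u x / star u p => [W|].
  move=> bu bx; case/orP: (bu) => [su|]; first exact: W.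
  case/orP: (bx) => [sx|]; first by rewrite (W x u).
  case/existsP=> y /and3P[xy ltxy py] /existsP[v /and3P[uv ltuv pv]].
  by have [] := mw_disjoint uv ltuv xy ltxy (ext_sub pv) (ext_sub py).
move=> su _; have [v uv pu] := starP _ _ su.
case/orP=> [/starP[y xy px]|/existsP[y /and3P[xy lt py]]].
  exact: hw_disjoint uv xy pu px.
have [//|E] := mw_hw_disjoint xy lt uv (ext_sub py) pu.
by have := ext_star py; rewrite -E su.
Qed.

Let lab (x : grid_dart n) : option V := [pick u | branch u x.1].

Let labE u x : branch u x.1 -> lab x = Some u.
Proof.
move=> bu; rewrite /lab; case: pickP => [w bw|/(_ u)]; last by rewrite bu.
by rewrite (branch_inj bw bu).
Qed.

Let labP u x : lab x = Some u -> branch u x.1.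
Proof. by rewrite /lab; case: pickP => // w bw [<-]. Qed.

Let I := [set x in grid_edges n | lab x == lab (grid_a x)].
Let conn := connect (link (@grid_s n) (@grid_a n) I).

Let connC : connect_sym (link (@grid_s n) (@grid_a n) I).
Proof. exact/conn_sym/grid_aK. Qed.

Let conn_pixel p d d' : conn (p, d) (p, d').
Proof.
have st v b : conn (p, (v, b)) (p, (~~ v, if v then b else ~~ b)).
  by have := conn_s (@grid_s n) (@grid_a n) I (p, (v, b)); rewrite permE.
have to d1 : conn (p, (true, true)) (p, d1).
  case: d1 => [[] []]; first exact: connect0.
  - exact: connect_trans (st true true) (st false true).
  - exact: (st true true).
  - exact: connect_trans (connect_trans (st true true) (st false true)) (st true false).
by apply: connect_trans (to d'); rewrite /conn connC; apply: to.
Qed.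

Let conn_touch u p q d d' : branch u p -> branch u q -> touch p q ->
  conn (p, d) (q, d').
Proof.
move=> bp bq /orP[/eqP <-|/existsP[f /andP[fi /eqP fq]]]; first exact: conn_pixel.
apply: connect_trans (conn_pixel p d f) _.
have fI : (p, f) \in I.
  have bq' : branch u (grid_a (p, f)).1 by rewrite fq.
  by rewrite !inE fi (@labE u (p, f) bp) (labE bq') eqxx.
have := conn_act (@grid_s n) (@grid_a n) I (p, f).
have -> : act (@grid_a n) I (p, f) = grid_a (p, f).
  rewrite /act fI; suff -> : grid_a (p, f) \in I by [].
  move: fI; rewrite !inE => /andP[gi /eqP E].
  by rewrite grid_inside_a // grid_aK E eqxx.
move=> h; apply: connect_trans h _.
by rewrite (surjective_pairing (grid_a (p, f))) fq; apply: conn_pixel.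
Qed.

Let conn_walk u p s q d d' : branch u p -> path touch p s ->
  {subset s <= branch u} -> q \in p :: s -> conn (p, d) (q, d').
Proof.
move=> bp ps sb; elim: s p d bp ps sb => [|r s IH] p d bp /=.
  by move=> _ _; rewrite inE => /eqP ->; apply: conn_pixel.
case/andP=> pr rs sb; rewrite in_cons => /predU1P[->|]; first exact: conn_pixel.
move=> qs; have br : branch u r by apply: sb; rewrite mem_head.
apply: connect_trans (conn_touch d d' bp br pr) _.
by apply: IH => // x xs; apply: sb; rewrite in_cons xs orbT.
Qed.

Let star_branch u v p : e u v -> p \in c u :: hw u v -> branch u p.
Proof. by move=> uv pu; apply/orP; left; apply/starP; exists v. Qed.

Let conn_center u x d : branch u x.1 -> conn (c u, d) x.
Proof.
case: x => [p d'] /=.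
have hs v q d1 : e u v -> q \in c u :: hw u v -> conn (c u, d) (q, d1).
  move=> uv; apply: (@conn_walk u) (hw_path uv) _.
    by apply: (star_branch uv); rewrite mem_head.
  by move=> r rs; apply: (star_branch uv); rewrite in_cons rs orbT.
case/orP=> [/starP[v uv pu]|/existsP[v /and3P[uv lt pe]]]; first exact: (hs v).
apply: connect_trans (hs v _ d uv (mem_last _ _)) _.
apply: (@conn_walk u) (_ : p \in _ :: ext u v).
- by apply: (star_branch uv); apply: mem_last.
- by apply: take_path; apply: mw_path.
- move=> r rs; apply/orP; right; apply/existsP; exists v.
  by rewrite uv lt rs.
- by rewrite in_cons pe orbT.
Qed.

(** Where the middle walk enters the star of v, it leaves the branch set of u.
    *)
Let lab_edge_lt u v : e u v -> u <<< v ->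
  exists x, [/\ x \in grid_edges n, lab x = Some u & lab (grid_a x) = Some v].
Proof.
move=> uv lt; have vu : e v u by rewrite e_sym.
set p0 := last (c u) (hw u v).
have bp0 : branch u p0 by apply: (star_branch uv); apply: mem_last.
have sv : star v (last p0 (mw u v)).
  by apply/starP; exists u => //; rewrite mw_last // mem_last.
have hs : has (star v) (mw u v).
  case: (lastP (mw u v)) sv => [/= sv|s r]; last by rewrite last_rcons has_rcons => ->.
  by have := branch_inj bp0 (introT orP (or_introl sv)) => E; rewrite E e_irr in uv.
set k := find (star v) (mw u v); have kl : k < size (mw u v) by rewrite -has_find.
set q := nth p0 (mw u v) k; set p := nth p0 (p0 :: mw u v) k.
have bq : branch v q by apply/orP; left; apply: nth_find.
have bp : branch u p.
  rewrite /p; case kE: k => [|j] //=; apply/orP; right.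
  apply/existsP; exists v; rewrite uv lt /=.
  have -> : nth p0 (mw u v) j = nth p0 (ext u v) j.
    by rewrite /ext nth_take // -/k kE.
  by apply: mem_nth; rewrite /ext size_takel -/k ?kE // -kE ltnW.
have pq : touch p q.
  by have /(pathP p0)/(_ k kl) := mw_path uv lt.
case/orP: pq => [/eqP E|/existsP[f /andP[fi /eqP fq]]].
  by have := branch_inj bp; rewrite E => /(_ _ bq) E'; rewrite E' e_irr in uv.
exists (p, f); rewrite in_set fi; split=> //; first exact: labE.
by apply: labE; rewrite fq.
Qed.

(** The branch sets are connected and touch along each edge, so that the graph
    is a minor of the grid. *)
Theorem grid_model_planar : inhabited (plane_map e).
Proof.
apply: (@plane_minor _ _ _ _ _ (@grid_edgesP n) (@grid_planar n) V e e_sym e_irr lab).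
- by move=> [p [v b]]; rewrite permE.
- move=> u x y /labP bx /labP by_.
  apply: connect_trans (_ : conn x (c u, (true, true))) (conn_center _ by_).
  by rewrite /conn connC; apply: conn_center.
move=> u v uv; case: (boolP (u <<< v)) => [|]; first exact: lab_edge_lt.
move=> lt; have vu : e v u by rewrite e_sym.
have [|x [xU x1 x2]] := lab_edge_lt vu; first by rewrite lt_total.
exists (grid_a x); rewrite grid_aK; split=> //.
by move: xU; rewrite !in_set; apply: grid_inside_a.
Qed.
End GridModel.

(** * Faces of a plane map and Euler's formula on darts *)

Lemma nat_inv_le (F : realFieldType) (m n : nat) : 0 < m <= n -> ((n%:R : F)^-1 <= m%:R^-1)%R.
Proof.
move=> /andP[m0 mn]; rewrite lef_pV2 ?posrE ?ltr0n ?ler_nat //.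
exact: leq_trans mn.
Qed.

Lemma sum_perm (K : realFieldType) (D : finType) (p : {perm D}) (F : D -> K) :
  (\sum_x F (p x) = \sum_x F x)%R.
Proof. by rewrite [RHS](reindex_inj (@perm_inj _ p)). Qed.

(** Discharging arguments look at all the corners of a vertex, or of a face, at
    once; summed over the darts, that is an average over shifts. *)
Lemma sum_iter (K : realFieldType) (D : finType) (p : {perm D}) (F : D -> K) k :
  (\sum_x F (iter k p x) = \sum_x F x)%R.
Proof.
by elim: k => // k IH; rewrite -[RHS]IH -(sum_perm p (fun x => F (iter k p x)));
  apply: eq_bigr => x _; rewrite iterSr.
Qed.

Lemma sum_inv (K : realFieldType) (D : finType) (a : D -> D) (F : D -> K) : involutive a ->
  (\sum_x F (a x) = \sum_x F x)%R.
Proof. by move=> aK; rewrite [RHS](reindex_inj (inv_inj aK)). Qed.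

Section OrbitIter.
Variables (D : finType) (p : {perm D}) (x : D).

Lemma card_porbit_gt0 : 0 < #|porbit p x|.
Proof. by rewrite lt0n card_porbit_neq0. Qed.

Lemma card_porbit_le n : 0 < n -> iter n p x = x -> #|porbit p x| <= n.
Proof.
move=> n0 E; rewrite leqNgt; apply/negP => lt.
have := uniq_traject_porbit p x; rewrite -[#|_|]prednK ?card_porbit_gt0 //=.
case/andP=> + _; move/negP; case.
apply/trajectP; exists n.-1; last by rewrite -iterSr prednK.
by have := card_porbit_gt0; lia.
Qed.

Lemma iter_neq i j : i < j < #|porbit p x| -> iter i p x != iter j p x.
Proof.
move=> /andP[ij jn]; have u := uniq_traject_porbit p x.
have iN : i < #|porbit p x| by apply: ltn_trans jn.
have := @nth_uniq _ x _ i j _ _ u.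
rewrite !size_traject !nth_traject // => -> //.
by rewrite neq_ltn ij.
Qed.

Lemma iter_neq0 j : 0 < j < #|porbit p x| -> iter j p x != x.
Proof. by move=> h; rewrite eq_sym; apply: (@iter_neq 0). Qed.
End OrbitIter.

Lemma adj_neq (V : finType) (e : rel V) u v : irreflexive e -> e u v -> u != v.
Proof. by move=> ei; apply: contraTneq => ->; rewrite ei. Qed.

(** Short lists of explicit vertices have to be recognised as cycles throughout;
    these tactics collect the adjacencies and the inequalities from the context,
    up to symmetry. *)
Ltac neq_leaf e_irr e_sym := first [ done | assumption | rewrite eq_sym; assumption
  | apply: (adj_neq e_irr); assumption | rewrite eq_sym; apply: (adj_neq e_irr); assumption
  | rewrite e_sym; assumption ].
Ltac cycle_tac e_irr e_sym := rewrite /ucycle /= ?inE ?negb_or;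
  repeat (apply/andP; split); neq_leaf e_irr e_sym.

Section Discharge.
Variables (V : finType) (e : rel V) (M : plane_map e).
Let e_irr : irreflexive e := graph_irr M.
Let e_sym : symmetric e := graph_sym M.

Notation D := (dart M).
Notation s := (rot M).
Notation a := (@opp _ _ M).
Notation t := (@tail _ _ M).
Let aK : involutive a := @oppK _ _ M.

(** The next dart on the face of x.  This face has a corner at the tail of x,
    between the dart before x around that vertex and x itself. *)
Definition phi : {perm D} := face s aK setT.
Definition head (x : D) := t (a x).
Definition deg (x : D) := #|porbit s x|.
Definition len (x : D) := #|porbit phi x|.

Lemma opp_neq x : a x != x.
Proof. by apply/eqP => E; have := dart_edge x; rewrite E e_irr. Qed.

Lemma edge_setT : edge_set a setT.
Proof. by apply/forall_inP => x _; rewrite inE opp_neq. Qed.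

Lemma phiE x : phi x = s (a x).
Proof. by rewrite faceE edge_set_act ?edge_setT // inE. Qed.

Lemma phi_opp x : phi (a x) = s x.
Proof. by rewrite phiE aK. Qed.

Lemma phi_rotV x : phi (a (s^-1%g x)) = x.
Proof. by rewrite phi_opp permKV. Qed.

Lemma tail_phi x : t (phi x) = head x.
Proof. by rewrite phiE tail_rot. Qed.

Lemma head_opp x : head (a x) = t x. Proof. by rewrite /head aK. Qed.

Lemma tail_rotV x : t (s^-1%g x) = t x.
Proof. by rewrite -{2}(permKV s x) tail_rot. Qed.

Lemma head_inj x y : t x = t y -> head x = head y -> x = y.
Proof. exact: dart_inj. Qed.

Lemma edge x : e (t x) (head x). Proof. exact: dart_edge. Qed.

Lemma len_phi x : len (phi x) = len x.
Proof.
by rewrite /len; have := porbit_perm phi 1 x; rewrite expg1 => ->.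
Qed.

Lemma deg_rot x : deg (s x) = deg x.
Proof. by rewrite /deg; have := porbit_perm s 1 x; rewrite expg1 => ->. Qed.

Lemma deg_tail x y : t x = t y -> deg x = deg y.
Proof.
by move=> /tail_orbit; rewrite porbit_sym -eq_porbit_mem /deg => /eqP ->.
Qed.

Lemma len_opp x : len (a x) = len (s x).
Proof. by rewrite -phi_opp len_phi. Qed.

Lemma iter_deg x : iter (deg x) s x = x. Proof. exact: iter_porbit. Qed.
Lemma iter_len x : iter (len x) phi x = x. Proof. exact: iter_porbit. Qed.

Lemma degE x : deg x = #|[set v | e (t x) v]|.
Proof.
rewrite /deg -(card_in_imset (f := head) (D := mem (porbit s x))); last first.
  have tx y : y \in porbit s x -> t y = t x.
    move=> yx; apply/eqP; move: y yx; apply: porbit_ind => // y.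
    by rewrite tail_rot.
  by move=> y z /tx ty /tx tz h; apply: head_inj => //; rewrite ty tz.
apply: eq_card => v; rewrite inE; apply/imsetP/idP => [[y yx ->]|h].
  have -> : t x = t y; last exact: edge.
  apply/eqP; move: y yx; apply: (porbit_ind (P := fun y => t x == t y)) => // y.
  by rewrite tail_rot.
have [y [ty hy]] := edge_dart M h.
by exists y => //; apply: tail_orbit.
Qed.

(** Euler's formula V - E + F >= 2, each vertex and each face being shared
    equally by its darts; a map that is not connected has even more. *)
Lemma euler_sum (K : realFieldType) : 0 < #|D| ->
  (\sum_(x : D) ((deg x)%:R^-1 + (len x)%:R^-1 - 2^-1 : K) >= 2)%R.
Proof.
move=> D0; rewrite !big_split /= sumr_const !sum_porbit.
have := planar_euler edge_setT (@map_planar _ _ M).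
rewrite /euler_lhs /euler_rhs -/phi cardsT => E.
have nc : 0 < ncomp s a setT.
  case/card_gt0P: D0 => x _; apply/card_gt0P.
  by exists (component (link s a setT) x); apply/imsetP; exists x.
have E' : (2%:R * (#|porbits s|%:R + #|porbits phi|%:R) =
           4%:R * (ncomp s a setT)%:R + #|D|%:R :> K)%R.
  by rewrite -natrD -(natrM K) -(natrM K) -natrD E.
have nc' : (1 <= (ncomp s a setT)%:R :> K)%R by rewrite ler1n.
rewrite -[(- _ *+ _)%R]mulr_natr; lra.
Qed.

(** No vertex has degree one; this is what makes faces of length two impossible
    and short faces honest cycles. *)
Definition no_leaf := forall x : D, s x != x.
Hypothesis deg2 : no_leaf.

Lemma phi_neq_opp x : phi x != a x.
Proof. by rewrite phiE. Qed.

(** A face turns back only at a vertex of degree one. *)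
Lemma nonbacktrack x : head (phi x) != t x.
Proof.
apply: contra (phi_neq_opp x) => /eqP E; apply/eqP/head_inj.
  exact: tail_phi.
by rewrite E head_opp.
Qed.

Lemma tail_neq_head x : t x != head x.
Proof. by apply/eqP => E; have := edge x; rewrite E e_irr. Qed.

Lemma len_ge3 x : 3 <= len x.
Proof.
have := iter_len x; have := card_porbit_gt0 phi x; rewrite -/(len x).
case: (len x) => [|[|[|n]]] //= _ E.
  by have := tail_phi x; rewrite E => /eqP; rewrite (negbTE (tail_neq_head x)).
by have := nonbacktrack x; rewrite -tail_phi E eqxx.
Qed.

(** The neighbours before and after a dart coincide only at a vertex of degree
    two. *)
Lemma head_rot_neq x : s (s x) != x -> head (s x) != head (s^-1%g x).
Proof.
apply: contra => /eqP h; apply/eqP.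
have := head_inj _ h; rewrite tail_rotV tail_rot => /(_ erefl) {1}->.
by rewrite permKV.
Qed.

Lemma head_iter_neq x i j : i < j < deg x ->
  head (iter i s x) != head (iter j s x).
Proof.
move=> h; apply: contra (iter_neq h) => /eqP E; apply/eqP/head_inj => //.
have ti k : t (iter k s x) = t x by elim: k => //= k; rewrite tail_rot.
by rewrite !ti.
Qed.

Lemma rot_adj x : e (t x) (head (s x)).
Proof. by have := edge (s x); rewrite tail_rot. Qed.

Lemma head_adj x : e (head x) (head (phi x)).
Proof. by have := edge (phi x); rewrite tail_phi. Qed.

(** The last dart of the face of x comes from the dart before x around its tail.
    *)
Lemma phi_last x n : len x = n.+1 -> iter n phi x = a (s^-1%g x).
Proof.
move=> E; apply: (@perm_inj _ phi); rewrite phi_rotV.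
by have := iter_len x; rewrite E.
Qed.

Lemma head_rotV x n : len x = n.+2 -> head (s^-1%g x) = head (iter n phi x).
Proof. by move/phi_last => /= h; rewrite -[RHS]tail_phi h. Qed.

Definition is_tri x := len x == 3.

Lemma tri_phi x : is_tri (phi x) = is_tri x.
Proof. by rewrite /is_tri len_phi. Qed.

Lemma tri_opp x : is_tri (a x) = is_tri (s x).
Proof. by rewrite /is_tri len_opp. Qed.

(** The third vertex of a triangular face is reached from either end. *)
Lemma tri_apex x : is_tri x -> head (s^-1%g x) = head (phi x).
Proof. by move=> /eqP /(@head_rotV _ 1). Qed.

Lemma tri_adj x : is_tri x -> e (head (phi x)) (t x).
Proof.
by move=> /tri_apex <-; rewrite e_sym -{1}tail_rotV edge.
Qed.

Lemma tri_cycle x : is_tri x -> ucycle e [:: t x; head x; head (phi x)].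
Proof.
move=> tx; have h1 := edge x; have h2 := head_adj x; have h3 := tri_adj tx.
by cycle_tac e_irr e_sym.
Qed.

Lemma quad_cycle x : len x = 4 ->
  ucycle e [:: t x; head x; head (phi x); head (phi (phi x))].
Proof.
move=> lx; have h1 := edge x; have h2 := head_adj x; have h3 := head_adj (phi x).
have h4 : e (head (phi (phi x))) (t x).
  by rewrite -(@head_rotV x 2 lx) e_sym -{1}tail_rotV edge.
have n1 := nonbacktrack x; have n2 := nonbacktrack (phi x).
rewrite tail_phi in n2.
by cycle_tac e_irr e_sym.
Qed.

Lemma penta_cycle x : len x = 5 ->
  ucycle e [:: t x; head x; head (phi x); head (phi (phi x));
               head (phi (phi (phi x)))].
Proof.
move=> lx; have h1 := edge x; have h2 := head_adj x; have h3 := head_adj (phi x).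
have h4 := head_adj (phi (phi x)).
have h5 : e (head (phi (phi (phi x)))) (t x).
  by rewrite -(@head_rotV x 3 lx) e_sym -{1}tail_rotV edge.
have n1 := nonbacktrack x; have n2 := nonbacktrack (phi x).
have n3 := nonbacktrack (phi (phi x)).
have n4 := nonbacktrack (phi (phi (phi x))).
have n5 := nonbacktrack (phi (phi (phi (phi x)))).
have E5 : phi (phi (phi (phi (phi x)))) = x by have := iter_len x; rewrite lx.
have hE : head (phi (phi (phi (phi x)))) = t x by rewrite -tail_phi E5.
rewrite E5 !tail_phi in n2 n3 n4 n5; rewrite hE in n4.
by cycle_tac e_irr e_sym.
Qed.

End Discharge.

(** * Graphs without triangles, graphs without pentagons *)

Definition no_cycle (V : finType) (e : rel V) k :=
  forall c : seq V, size c = k -> ucycle e c -> False.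

Section NoTriangle.
Variable K : realFieldType.
Variables (V : finType) (e : rel V) (M : plane_map e).
Hypothesis deg4 : forall x : dart M, 4 <= deg x.
Hypothesis noC3 : no_cycle e 3.

Lemma deg4_no_leaf : no_leaf M.
Proof. by move=> x; apply: (@iter_neq0 _ _ _ 1); have := deg4 x; rewrite /deg; lia. Qed.

(** Without triangles all faces have length at least four, and no term of
    Euler's sum is positive. *)
Lemma no_triangle_no_dart : 0 < #|dart M| -> False.
Proof.
move/(@euler_sum _ _ M K); suff : (\sum_(x : dart M)
    ((deg x)%:R^-1 + (len x)%:R^-1 - 2^-1 : K) <= 0)%R by lra.
apply: sumr_le0 => x _.
have l4 : 4 <= len x.
  have := len_ge3 deg4_no_leaf x; rewrite leq_eqVlt => /orP[/eqP l3|] //.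
  have tx : is_tri x by rewrite /is_tri -l3.
  by case: (noC3 _ (tri_cycle tx)).
have := @nat_inv_le K 4 (deg x); rewrite deg4 => /(_ isT).
have := @nat_inv_le K 4 (len x); rewrite l4 => /(_ isT); lra.
Qed.
End NoTriangle.

Section NoC5.
Variable K : realFieldType.
Variables (V : finType) (e : rel V) (M : plane_map e).
Let e_irr : irreflexive e := graph_irr M.
Let e_sym : symmetric e := graph_sym M.
Hypothesis deg4 : forall x : dart M, 4 <= deg x.
Hypothesis noC5 : no_cycle e 5.
Notation D := (dart M).
Notation s := (rot M).
Notation a := (@opp _ _ M).
Notation t := (@tail _ _ M).
Notation phi := (phi M).
Implicit Types x y : D.

Let deg2 := deg4_no_leaf deg4.

Let rot2 x : s (s x) != x.
Proof. by apply: (@iter_neq0 _ _ _ 2); have := deg4 x; rewrite /deg; lia. Qed.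

Let len_neq5 x : len x != 5.
Proof. by apply/eqP => l5; case: (noC5 _ (penta_cycle deg2 l5)). Qed.

(** A triangle next to a quadrilateral closes a pentagon. *)
Let big_opp x : is_tri x -> ~~ is_tri (a x) -> 6 <= len (a x).
Proof.
move=> tx nt; have := len_ge3 deg2 (a x); have := len_neq5 (a x).
case l4: (len (a x) == 4); last by move: nt l4; rewrite /is_tri; lia.
move: l4 => /eqP l4 _ _; exfalso.
pose o := head (phi x); pose y := head (s x); pose w := head (phi (s x)).
have ph : phi (a x) = s x by apply: phi_opp.
have oy : o != y.
  by rewrite /o /y -tri_apex // eq_sym head_rot_neq.
have hw : head (s^-1%g (a x)) = w by rewrite (@head_rotV _ _ _ _ 2 l4) /= ph.
have ow : o != w.
  rewrite -hw; have -> : o = head (s (a x)) by rewrite /o phiE.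
  exact: head_rot_neq.
have h1 : e (t x) y by apply: rot_adj.
have h2 : e y w by apply: head_adj.
have h3 : e w (head x).
  by rewrite -hw e_sym -[head x]/(t (a x)) -(tail_rotV (a x)) edge.
have h4 := head_adj x; have h5 := tri_adj tx.
have n1 : y != head x.
  by have := nonbacktrack deg2 (a x); rewrite ph.
have n2 : w != t x.
  by have := nonbacktrack deg2 (s x); rewrite tail_rot.
have h6 := edge x.
by apply: (noC5 (c := [:: o; t x; y; w; head x])) => //; cycle_tac e_irr e_sym.
Qed.

(** Three consecutive triangles at a vertex close a pentagon. *)
Let tri_run x : is_tri x -> is_tri (s x) -> is_tri (s (s x)) -> False.
Proof.
move=> t1 t2 t3; pose y := s^-1%g x.
have E : s y = x by rewrite permKV.
have dy : 4 <= deg y := deg4 y.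
have n01 : head y != head x.
  by have := @head_iter_neq _ _ _ y 0 1; rewrite /= E => -> //; lia.
have n02 : head y != head (s x).
  by have := @head_iter_neq _ _ _ y 0 2; rewrite /= E => -> //; lia.
have n03 : head y != head (s (s x)).
  by have := @head_iter_neq _ _ _ y 0 3; rewrite /= E => -> //; lia.
have n12 : head x != head (s x).
  by have := @head_iter_neq _ _ _ y 1 2; rewrite /= E => -> //; lia.
have n13 : head x != head (s (s x)).
  by have := @head_iter_neq _ _ _ y 1 3; rewrite /= E => -> //; lia.
have n23 : head (s x) != head (s (s x)).
  by have := @head_iter_neq _ _ _ y 2 3; rewrite /= E => -> //; lia.
have a1 : e (head x) (head y) by rewrite (tri_apex t1) head_adj.
have a2 : e (head (s x)) (head x).
  by rewrite -{2}(permK s x) (tri_apex t2) head_adj.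
have a3 : e (head (s (s x))) (head (s x)).
  by rewrite -{2}(permK s (s x)) (tri_apex t3) head_adj.
have b0 : e (t x) (head y) by rewrite -(tail_rotV x) edge.
have b1 := edge x.
have b2 : e (t x) (head (s x)) by apply: rot_adj.
have b3 : e (t x) (head (s (s x))) by rewrite -(tail_rot x) rot_adj.
apply: (noC5 (c := [:: t x; head y; head x; head (s x); head (s (s x))])) => //.
by cycle_tac e_irr e_sym.
Qed.

(** The edges with triangles on both sides: the only sides through which a
    triangle takes nothing. *)
Let shared x := is_tri x && is_tri (s x).
Let big x := 6 <= len x.
Let big_edge x := big x && big (s x).

Let shared_rot x : shared x -> ~~ shared (s x).
Proof.
by case/andP=> h1 h2; apply/negP => /andP[_ h3]; apply: tri_run h1 h2 h3.
Qed.

(** At a vertex of degree four, opposite to an edge between two triangles, there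
    is an edge between two large faces, through which nothing is taken either;
    it compensates. *)
Let shared_big x : deg x = 4 -> shared x -> big_edge (s (s x)).
Proof.
move=> d4 sx; have /andP[t1 t2] := sx.
have E4 : s (s (s (s x))) = x by have := iter_deg x; rewrite d4.
apply/andP; split.
  have := big_opp t2; rewrite tri_opp len_opp; apply.
  by have := shared_rot sx; rewrite /shared t2.
have Ev : s^-1%g x = s (s (s x)) by rewrite -{1}E4 permK.
have t1' : is_tri (phi (phi x)) by rewrite !tri_phi.
have Ep : phi (phi x) = a (s (s (s x))).
  by rewrite -Ev; apply: (@phi_last _ _ _ _ 2); apply/eqP.
have := big_opp t1'; rewrite Ep oppK; apply.
apply/negP => t3; have := tri_run (x := s (s (s x))).
by rewrite E4 => /(_ t3 t1 t2).
Qed.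

Local Open Scope ring_scope.
Let q (b : bool) : K := if b then 1 else 0.

(** Each side of a triangle lacks 1/3, which a face of length at least six can
    pay through each of its sides.  The missing payments across edges with two
    triangles are made up for by edges with two large faces at vertices of
    degree four, and by the charge of the vertex at larger degrees, where two
    such edges are never consecutive. *)
Lemma no_C5_no_dart : (0 < #|dart M|)%N -> False.
Proof.
move/(@euler_sum _ _ M K) => EU.
pose vch x : K := 1 - 4 * (deg x)%:R^-1.
have deg_ch x : 0 <= vch x.
  by rewrite /vch; have := @nat_inv_le K 4 (deg x); rewrite deg4 => /(_ isT); lra.
have len_ch x : 1 - 4 * (len x)%:R^-1 >= (q (big x) - q (is_tri x)) / 3 :> K.
  have := len_ge3 deg2 x; rewrite /q /big /is_tri.
  case: (leqP 6 (len x)) => h6.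
    have -> : (len x == 3) = false by apply/eqP; lia.
    have := @nat_inv_le K 6 (len x); rewrite h6 => /(_ isT) /=; lra.
  move: h6; case: (len x) => [|[|[|[|[|[|//]]]]]] //= _ _; lra.
have H1 x : q (is_tri x) - q (shared x) <= q (is_tri x) * q (big (a x)).
  have := @big_opp x; rewrite /q /shared -tri_opp /big.
  case: (is_tri x); case: (is_tri (a x)); case: (6 <= len (a x))%N;
    move=> h; (try by have := h isT isT); rewrite /=; lra.
have H2 x : q (is_tri x) * q (big (a x)) + q (big x) * q (big (a x)) <= q (big (a x)).
  rewrite /q /big /is_tri; case: eqP => [->|_] /=; first by case: (_ <= _)%N; lra.
  by case: (_ <= _)%N; case: (_ <= _)%N => /=; lra.
have E2 : \sum_(x : D) q (big (a x)) = \sum_(x : D) q (big x).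
  exact: (sum_inv (fun x => q (big x)) (@oppK _ _ M)).
have vch4 x : vch (s x) = vch x by rewrite /vch deg_rot.
have H3 x : q (shared x) + q (shared (s x)) <=
    q (big_edge (s (s x))) + q (big_edge (s (s (s x)))) + 6 * vch x.
  have := deg_ch x; case: (eqVneq (deg x) 4) => d4.
    have := @shared_big x d4; have := @shared_big (s x).
    rewrite deg_rot d4 /q; case: (shared x); case: (shared (s x));
    case: (big_edge _); case: (big_edge _) => //= h1 h2;
    try (by have := h1 erefl isT); try (by have := h2 erefl isT); lra.
  have d5 : (5 <= deg x)%N by have := deg4 x; lia.
  have := @nat_inv_le K 5 (deg x); rewrite d5 /vch => /(_ isT).
  have := @shared_rot x; rewrite /q; case: (shared x); case: (shared (s x)) => /=;
    try (by move/(_ isT)); 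
    case: (big_edge _); case: (big_edge _) => //= *; lra.
have S1 : \sum_(x : D) q (shared (s x)) = \sum_x q (shared x).
  exact: (sum_perm s (fun x => q (shared x))).
have S2 : \sum_(x : D) q (big_edge (s (s x))) = \sum_x q (big_edge x).
  exact: (sum_iter s (fun x => q (big_edge x)) 2).
have S3 : \sum_(x : D) q (big_edge (s (s (s x)))) = \sum_x q (big_edge x).
  exact: (sum_iter s (fun x => q (big_edge x)) 3).
have H3s : \sum_(x : D) q (shared x) <= \sum_(x : D) q (big_edge x)
    + 3 * \sum_(x : D) vch x.
  have H := ler_sum (index_enum D) (fun x (_ : true) => H3 x).
  rewrite !big_split /= -mulr_sumr S1 S2 S3 in H; lra.
have H2s : \sum_(x : D) q (is_tri x) - \sum_(x : D) q (shared x) +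
    \sum_(x : D) q (big_edge x) <= \sum_(x : D) q (big x).
  rewrite -E2 -sumrB -big_split /=; apply: ler_sum => x _.
  have := H1 x; have := H2 x.
  have -> : q (big_edge x) = q (big x) * q (big (a x)).
    by rewrite /q /big_edge /big len_opp; case: (_ <= _)%N; case: (_ <= _)%N => /=; lra.
  lra.
have Ls : \sum_(x : D) (1 - 4 * (len x)%:R^-1 : K) >=
    (\sum_(x : D) q (big x) - \sum_(x : D) q (is_tri x)) / 3.
  rewrite -sumrB mulr_suml; apply: ler_sum => x _; exact: len_ch.
have : \sum_(x : D) ((deg x)%:R^-1 + (len x)%:R^-1 - 2^-1 : K) * (-4) =
   \sum_(x : D) vch x + \sum_(x : D) (1 - 4 * (len x)%:R^-1 : K).
  by rewrite -big_split /=; apply: eq_bigr => x _; rewrite /vch; lra.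
rewrite -mulr_suml; lra.
Qed.
End NoC5.

(** * Graphs without quadrilaterals *)

(** The amount, in sixths of the unit of charge, that one edge of a pentagon,
    whose other side is a triangle, receives from one of its ends, a vertex of
    degree at least five.  The argument tri1 says whether the other edge of the
    pentagon at this end also borders a triangle; big2 and tri2 describe what
    follows this other edge on the pentagon, namely whether its far end has
    degree at least five, and whether the edge after it borders a triangle.  The
    argument want says whether the same triangle must also help the pentagon
    opposite to this end. *)
Definition share (want tri1 big2 tri2 : bool) : nat :=
  if tri1 then (if want then 1 else 2)
  else if want then 0 else if big2 then 1 else if tri2 then 2 else 0.

Lemma share_le want tri1 big2 tri2 :
  share want tri1 big2 tri2 <= (if want then tri1 : nat else 2).
Proof. by case: want tri1 big2 tri2 => -[] [] []. Qed.

(** An edge of a pentagon that borders no triangle saves two units; the other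
    edges depend on help from their ends. *)
Definition edge_gets (T Bt Bh WT WH Tp Bp Tpp Tn Bn Tnn : bool) : nat :=
  if T then (if Bt then share WT Tp Bp Tpp else 0) +
            (if Bh then share WH Tn Bn Tnn else 0)
  else 2.

Lemma edge_gets_tail (T Bt Bh WT WH Tp Bp Tpp Tn Bn Tnn : bool) : T -> Bt ->
  share WT Tp Bp Tpp <= edge_gets T Bt Bh WT WH Tp Bp Tpp Tn Bn Tnn.
Proof. by rewrite /edge_gets => -> ->; apply: leq_addr. Qed.

Lemma edge_gets_head (T Bt Bh WT WH Tp Bp Tpp Tn Bn Tnn : bool) : T -> Bh ->
  share WH Tn Bn Tnn <= edge_gets T Bt Bh WT WH Tp Bp Tpp Tn Bn Tnn.
Proof. by rewrite /edge_gets => -> ->; apply: leq_addl. Qed.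

Lemma share_tri (W B T : bool) : 0 < share W true B T.
Proof. by rewrite /share; case: W. Qed.

Section Want.
Variables T1 T2 B1 B2 B3 WT1 WT2 WH1 WH2 : bool.

Lemma want_right (Tp Bp Tpp Tnn Bn Bx Tx Ty By Tz : bool) : (T1 ==> B2 && WH1) ->
  2 <= edge_gets T1 B1 B2 WT1 WH1 Tp Bp Tpp T2 Bx Tx +
       edge_gets T2 B2 B3 WT2 WH2 T1 By Ty Tnn Bn Tz.
Proof.
case: T1 => [|_]; last by rewrite {1}/edge_gets; lia.
rewrite implyTb => /andP[-> ->]; case: T2; last by rewrite {2}/edge_gets; lia.
have h1 := @edge_gets_head true B1 true WT1 true Tp Bp Tpp true Bx Tx isT isT.
have h2 := @edge_gets_tail true true B3 WT2 WH2 true By Ty Tnn Bn Tz isT isT.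
by have := share_tri WT2 By Ty; rewrite /share in h1 h2 *; lia.
Qed.

Lemma want_left (Tp Bp Tpp Tnn Bn Bx Tx Ty By Tz : bool) : (T2 ==> B2 && WT2) ->
  2 <= edge_gets T2 B2 B3 WT2 WH2 T1 By Ty Tnn Bn Tz +
       edge_gets T1 B1 B2 WT1 WH1 Tp Bp Tpp T2 Bx Tx.
Proof.
case: T2 => [|_]; last by rewrite {1}/edge_gets; lia.
rewrite implyTb => /andP[-> ->]; case: T1; last by rewrite {2}/edge_gets; lia.
have h1 := @edge_gets_head true B1 true WT1 WH1 Tp Bp Tpp true Bx Tx isT isT.
have h2 := @edge_gets_tail true true B3 true WH2 true By Ty Tnn Bn Tz isT isT.
by have := share_tri WH1 Bx Tx; rewrite /share in h1 h2 *; lia.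
Qed.
End Want.

Section Pentagon.
Variables T0 T1 T2 T3 T4 B0 B1 B2 B3 B4 : bool.
Variables WT0 WT1 WT2 WT3 WT4 WH0 WH1 WH2 WH3 WH4 : bool.
Hypotheses
  (wt0 : T0 -> WT0 -> T1 ==> B2 && WH1)
  (wt1 : T1 -> WT1 -> T2 ==> B3 && WH2)
  (wh4 : T4 -> WH4 -> T3 ==> B3 && WT3)
  (wh3 : T3 -> WH3 -> T2 ==> B2 && WT2).

(** A pentagon is short of four units when it pays two through each edge with a
    triangle behind.  Around a vertex of degree at least five, the edges before
    and after it supply them: either they border no triangle, or that vertex
    pays, or, where it pays less because of a want, the hypotheses say that the
    want propagates to the next edge, which is then supplied from there. *)
Lemma pentagon_needs : B0 ->
  4 <= edge_gets T0 B0 B1 WT0 WH0 T4 B4 T3 T1 B2 T2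
     + edge_gets T1 B1 B2 WT1 WH1 T0 B0 T4 T2 B3 T3
     + edge_gets T2 B2 B3 WT2 WH2 T1 B1 T0 T3 B4 T4
     + edge_gets T3 B3 B4 WT3 WH3 T2 B2 T1 T4 B0 T0
     + edge_gets T4 B4 B0 WT4 WH4 T3 B3 T2 T0 B1 T1.
Proof.
move=> b0; set c0 := edge_gets T0 _ _ _ _ _ _ _ _ _ _.
set c1 := edge_gets T1 _ _ _ _ _ _ _ _ _ _.
set c2 := edge_gets T2 _ _ _ _ _ _ _ _ _ _.
set c3 := edge_gets T3 _ _ _ _ _ _ _ _ _ _.
set c4 := edge_gets T4 _ _ _ _ _ _ _ _ _ _.
have n0 : ~~ T0 -> c0 = 2 by rewrite /c0 /edge_gets => /negbTE ->.
have n1 : ~~ T1 -> c1 = 2 by rewrite /c1 /edge_gets => /negbTE ->.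
have n3 : ~~ T3 -> c3 = 2 by rewrite /c3 /edge_gets => /negbTE ->.
have n4 : ~~ T4 -> c4 = 2 by rewrite /c4 /edge_gets => /negbTE ->.
have g0 : T0 -> share WT0 T4 B4 T3 <= c0.
  by move=> h; apply: edge_gets_tail.
have g4 : T4 -> share WH4 T0 B1 T1 <= c4.
  by move=> h; apply: edge_gets_head.
have r0 : T0 -> WT0 -> 2 <= c1 + c2.
  by move=> h1 h2; apply: want_right; apply: wt0.
have r1 : T1 -> WT1 -> 2 <= c2 + c3.
  by move=> h1 h2; apply: want_right; apply: wt1.
have l4 : T4 -> WH4 -> 2 <= c3 + c2.
  by move=> h1 h2; apply: want_left; apply: wh4.
have l3 : T3 -> WH3 -> 2 <= c2 + c1.
  by move=> h1 h2; apply: want_left; apply: wh3.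
have g3 : T3 -> B4 -> share WH3 T4 B0 T0 <= c3.
  by move=> h1 h2; apply: edge_gets_head.
have g1 : T1 -> B1 -> share WT1 T0 B0 T4 <= c1.
  by move=> h1 h2; apply: edge_gets_tail.
clearbody c0 c1 c2 c3 c4; clear wt0 wt1 wh4 wh3; rewrite b0 in g1 g3.
move: n0 n4 g0 g4 r0 l4 g1 g3; rewrite /share.
case: T0; case: T4 => n0 n4 g0 g4 r0 l4 g1 g3.
- have := g0 isT; have := g4 isT.
  case: WT0 r0 {g0} => r0; first by have := r0 isT isT; case: WH4; lia.
  by case: WH4 l4 {g4} => l4; first have := l4 isT isT; lia.
- have := n4 isT; have := g0 isT; case: WT0 r0 {g0} => r0.
    by have := r0 isT isT; lia.
  case: B4 g3 => g3; last by case: T3 n3 => n3; [lia | have := n3 isT; lia].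
  case: T3 n3 g3 l3 => n3 g3 l3; last by have := n3 isT; lia.
  have := g3 isT isT; case: WH3 l3 {g3} => l3; last by lia.
  by have := l3 isT isT; lia.
- have := n0 isT; have := g4 isT; case: WH4 l4 {g4} => l4.
    by have := l4 isT isT; lia.
  case: B1 g1 => g1; last by case: T1 n1 => n1; [lia | have := n1 isT; lia].
  case: T1 n1 g1 r1 => n1 g1 r1; last by have := n1 isT; lia.
  have := g1 isT isT; case: WT1 r1 {g1} => r1; last by lia.
  by have := r1 isT isT; lia.
- by have := n0 isT; have := n4 isT; lia.
Qed.
End Pentagon.

Section NoC4.
Variable K : realFieldType.
Variables (V : finType) (e : rel V) (M : plane_map e).
Let e_irr : irreflexive e := graph_irr M.
Let e_sym : symmetric e := graph_sym M.
Hypothesis deg4 : forall x : dart M, 4 <= deg x.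
Hypothesis noC4 : no_cycle e 4.
Notation D := (dart M).
Notation s := (rot M).
Notation a := (@opp _ _ M).
Notation t := (@tail _ _ M).
Notation phi := (phi M).
Implicit Types x y z d : D.

Let aK : involutive a := @oppK _ _ M.
Let deg2 := deg4_no_leaf deg4.
Let penta x := len x == 5.
Let big x := 4 < deg x.
Let prev x := a (s^-1%g x).
(** The vertices around the face of x all have degree four: such a pentagon gets
    nothing from its own vertices. *)
Let all_small x := [forall y in porbit phi x, deg y == 4].

Hypothesis no_pentagon_tri : forall x, penta x -> is_tri (a x) -> all_small x ->
  deg (phi (phi (a x))) = 4 -> False.

Let rot2 x : s (s x) != x.
Proof. by apply: (@iter_neq0 _ _ _ 2); have := deg4 x; rewrite /deg; lia. Qed.

Let prevK x : phi (prev x) = x. Proof. exact: phi_rotV. Qed.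

Let prev_phi x : prev (phi x) = x.
Proof. by apply: (@perm_inj _ phi); rewrite prevK. Qed.

Let len_neq4 x : len x != 4.
Proof. by apply/eqP => l4; case: (noC4 _ (quad_cycle deg2 l4)). Qed.

Let not_big x : ~~ big x -> deg x = 4.
Proof. by rewrite /big; have := deg4 x; lia. Qed.

Let tri_apart x : is_tri x -> ~~ is_tri (s x).
Proof.
move=> tx; apply/negP; rewrite -tri_opp => tax.
have n1 : head (phi (a x)) != head (phi x).
  by rewrite phi_opp -tri_apex // head_rot_neq.
have h1 := edge x; have h2 := head_adj x; have h3 := tri_adj tx.
have h4 := head_adj (a x); have h5 := tri_adj tax; rewrite head_opp in h4.
apply: (noC4 (c := [:: t x; head (phi (a x)); head x; head (phi x)])) => //.
by rewrite -/(head x) in h5; cycle_tac e_irr e_sym.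
Qed.

Let tri3 x : is_tri x -> phi (phi (phi x)) = x.
Proof. by move/eqP => l3; have := iter_len x; rewrite l3. Qed.

Let penta5 x : penta x -> phi (phi (phi (phi (phi x)))) = x.
Proof. by move/eqP => l5; have := iter_len x; rewrite l5. Qed.

Let penta_phi x : penta (phi x) = penta x.
Proof. by rewrite /penta len_phi. Qed.

Let all_small_phi x : all_small (phi x) = all_small x.
Proof.
apply: eq_forallb => y.
by have := porbit_perm phi 1 x; rewrite expg1 => ->.
Qed.

Let all_smallP x : all_small x -> deg x = 4.
Proof. by move/forall_inP/(_ x (porbit_id _ _))/eqP. Qed.

(** The pentagon behind the side of the triangle opposite to the corner y is one
    whose vertices all have degree four; it can only be helped by the vertex at
    y, across the triangle. *)
Let want y := [&& is_tri y, penta (a (phi y)) & all_small (a (phi y))].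

(** Payments of one unit are attached to the darts of the receiving pentagon: by
    the head and by the tail of the dart when the side borders a triangle, and
    by the third vertex of this triangle when the pentagon has only vertices of
    degree four. *)
Let pay_head d : nat := if [&& penta d, is_tri (a d) & big (phi d)] then
  share (want (a d)) (is_tri (a (phi d))) (big (phi (phi d)))
        (is_tri (a (phi (phi d)))) else 0.
Let pay_tail d : nat := if [&& penta d, is_tri (a d) & big d] then
  share (want (s d)) (is_tri (a (prev d))) (big (prev d))
        (is_tri (a (prev (prev d)))) else 0.
Let pay_apex d : nat := [&& penta d, is_tri (a d) & all_small d].

(** This is where the forbidden configuration is used: the vertex asked for help
    has degree at least five. *)
Let want_big y : want y -> big y.
Proof.
case/and3P=> ty p5 sm; apply/negPn/negP => /not_big d4.
have := no_pentagon_tri p5 _ sm; rewrite aK tri_phi ty tri3 // => /(_ isT d4).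
by [].
Qed.

(** The head of x has degree four, being on a wanting pentagon.  Its four faces
    are the face of x, the triangle behind x, the wanting pentagon and the face
    behind phi x; if the latter is a triangle, its corner opposite to this
    vertex faces the same wanting pentagon. *)
Let want_tail x : is_tri (a x) -> want (s x) ->
  is_tri (a (phi x)) -> big (phi (phi x)) && want (a (phi x)).
Proof.
move=> tx wx tpx; suff w : want (a (phi x)).
  rewrite w andbT; have := want_big w; rewrite /big.
  by rewrite (@deg_tail _ _ M _ (phi (phi x))) // tail_phi.
case/and3P: wx => ts p5 sm.
(* around the head of x, of degree four: x's face, its triangle, the wanting
   pentagon, and the triangle on phi x *)
have E1 : phi (s x) = prev (a x).
  apply: (@perm_inj _ phi); rewrite prevK; apply: (@perm_inj _ phi).
  by rewrite phi_opp tri3.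
have E2 : a (phi (s x)) = s^-1%g (a x) by rewrite E1 /prev aK.
have d4 : deg (a x) = 4.
  have := all_smallP sm; rewrite E2 => <-; apply: deg_tail.
  by rewrite tail_rotV.
have E3 : phi (a (phi x)) = s^-1%g (s^-1%g (a x)).
  have E4 : s (s (s (s (a x)))) = a x by have := iter_deg (a x); rewrite d4.
  rewrite phi_opp phiE; apply: (@perm_inj _ s); apply: (@perm_inj _ s).
  by rewrite E4 !permKV.
rewrite /want tpx E3.
have E5 : a (s^-1%g (s^-1%g (a x))) = prev (s^-1%g (a x)) by [].
by rewrite E5 -E2 -penta_phi prevK p5 -all_small_phi prevK sm.
Qed.

(** Mirror image of the previous lemma. *)
Let want_head x : is_tri (a x) -> want (a x) ->
  is_tri (a (prev x)) -> big (prev x) && want (s (prev x)).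
Proof.
move=> tx wx tpx; suff w : want (s (prev x)).
  rewrite w andbT; have := want_big w; rewrite /big.
  by rewrite (@deg_tail _ _ M _ (prev x)) // tail_rot.
case/and3P: wx => ts p5 sm.
have Epx : a (phi (a x)) = a (s x) by rewrite phi_opp.
rewrite Epx in p5 sm.
have d4 : deg (phi (a (s x))) = 4 by apply: all_smallP; rewrite all_small_phi.
have E4 : s (s (s (s x))) = x.
  have := iter_deg x; rewrite -[deg x](@deg_tail _ _ M (phi (a (s x)))) ?d4 //.
  by rewrite tail_phi head_opp tail_rot.
have E6 : a (prev x) = s^-1%g x by rewrite /prev aK.
have t3 : is_tri (s^-1%g x) by rewrite -E6.
have E7 : s^-1%g x = s (s (s x)) by rewrite -{1}E4 permK.
have E8 : s (prev x) = phi (s^-1%g x) by rewrite /prev phiE.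
rewrite /want E8 tri_phi t3 /=.
have E9 : phi (phi (s^-1%g x)) = prev (s^-1%g x).
  by apply: (@perm_inj _ phi); rewrite prevK tri3.
have E10 : a (phi (phi (s^-1%g x))) = s (s x).
  by rewrite E9 /prev aK E7 permK.
by rewrite E10 -(phi_opp (s x)) penta_phi p5 all_small_phi.
Qed.

Let gets d := 2 * ~~ is_tri (a d) + pay_tail d + pay_head d + pay_apex d.

Let face_gets d := gets d + gets (phi d) + gets (phi (phi d)) +
  gets (phi (phi (phi d))) + gets (phi (phi (phi (phi d)))).

Let face_gets_phi d : penta d -> face_gets (phi d) = face_gets d.
Proof. by move=> /penta5 E5; rewrite /face_gets E5 addnC !addnA. Qed.

Let penta_gets d : penta d -> 4 <= face_gets d.
Proof.
have ge y : penta y -> edge_gets (is_tri (a y)) (big y) (big (phi y))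
    (want (s y)) (want (a y)) (is_tri (a (prev y))) (big (prev y))
    (is_tri (a (prev (prev y)))) (is_tri (a (phi y))) (big (phi (phi y)))
    (is_tri (a (phi (phi y)))) <= gets y.
  move=> py; rewrite /gets /pay_tail /pay_head py /edge_gets /=.
  by case: (is_tri (a y)) => //=; rewrite leq_addr.
have main x : penta x -> big x -> 4 <= face_gets x.
  move=> px bx; have E5 := penta5 px.
  set x1 := phi x; set x2 := phi x1; set x3 := phi x2; set x4 := phi x3.
  have Ex : phi x4 = x by [].
  have p1 : prev x1 = x by apply: prev_phi.
  have p2 : prev x2 = x1 by apply: prev_phi.
  have p3 : prev x3 = x2 by apply: prev_phi.
  have p4 : prev x4 = x3 by apply: prev_phi.
  have p0 : prev x = x4 by rewrite -Ex prev_phi.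
  have P1 : penta x1 by rewrite penta_phi.
  have P2 : penta x2 by rewrite penta_phi.
  have P3 : penta x3 by rewrite penta_phi.
  have P4 : penta x4 by rewrite penta_phi.
  have wt y : is_tri (a y) -> want (s y) ->
    is_tri (a (phi y)) ==> big (phi (phi y)) && want (a (phi y)).
    by move=> h1 h2; apply/implyP; apply: want_tail.
  have wh y : is_tri (a y) -> want (a y) ->
    is_tri (a (prev y)) ==> big (prev y) && want (s (prev y)).
    by move=> h1 h2; apply/implyP; apply: want_head.
  have wt0 := wt x; have wt1 := wt x1; have wh4 := wh x4; have wh3 := wh x3.
  rewrite -/x1 -/x2 in wt0; rewrite -/x2 -/x3 in wt1; rewrite p4 in wh4.
  rewrite p3 in wh3.
  have N := @pentagon_needs (is_tri (a x)) (is_tri (a x1)) (is_tri (a x2))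
   (is_tri (a x3)) (is_tri (a x4)) (big x) (big x1) (big x2) (big x3) (big x4)
   (want (s x)) (want (s x1)) (want (s x2)) (want (s x3)) (want (s x4))
   (want (a x)) (want (a x1)) (want (a x2)) (want (a x3)) (want (a x4))
   wt0 wt1 wh4 wh3 bx.
  have := ge x px; have := ge x1 P1; have := ge x2 P2; have := ge x3 P3.
  have := ge x4 P4; rewrite /= -/x1 -/x2 -/x3 -/x4 Ex -/x1.
  rewrite !(p0, p1, p2, p3, p4) => g4 g3 g2 g1 g0.
  by apply: leq_trans N _; rewrite /face_gets; repeat apply: leq_add.
move=> pd; have E5 := penta5 pd.
case b0: (big d); first exact: main.
have P1 : penta (phi d) by rewrite penta_phi.
have P2 : penta (phi (phi d)) by rewrite penta_phi.
have P3 : penta (phi (phi (phi d))) by rewrite penta_phi.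
have P4 : penta (phi (phi (phi (phi d)))) by rewrite penta_phi.
case b1: (big (phi d)); first by have := main _ P1 b1; rewrite !face_gets_phi.
case b2: (big (phi (phi d))); first by have := main _ P2 b2; rewrite !face_gets_phi.
case b3: (big (phi (phi (phi d)))); first by have := main _ P3 b3; rewrite !face_gets_phi.
case b4: (big (phi (phi (phi (phi d))))); first by have := main _ P4 b4; rewrite !face_gets_phi.
have sm : all_small d.
  apply/forall_inP => y; rewrite porbit_traject -/(len d) (eqP pd) !inE.
  by case/or4P => [/eqP->|/eqP->|/eqP->|/orP[]/eqP->];
    apply/eqP/not_big/negbT.
have one y : penta y -> all_small y -> 1 <= gets y.
  by move=> py sy; rewrite /gets /pay_apex py sy andbT /=; case: (is_tri (a y)); rewrite ?addn1.
have h0 := one _ pd sm; have := one _ P1; have := one _ P2; have := one _ P3.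
have := one _ P4; rewrite !all_small_phi sm /face_gets => h4 h3 h2 h1.
have {}h1 := h1 isT; have {}h2 := h2 isT; have {}h3 := h3 isT.
have {}h4 := h4 isT.
exact: leq_trans (leq_add (leq_add (leq_add (leq_add h0 h1) h2) h3) h4).
Qed.

(** What the vertex of y pays through the triangle at the corner y. *)
Let pay y := pay_tail (s^-1%g y) + pay_head (a y) +
  pay_apex (a (phi y)).

Let payE y : pay y =
  if is_tri y && big y then
    (if penta (s^-1%g y) then share (want y) (is_tri (s^-1%g (s^-1%g y)))
       (big (prev (s^-1%g y))) (is_tri (a (prev (prev (s^-1%g y))))) else 0)
    + (if penta (s y) then share (want y) (is_tri (s (s y)))
       (big (phi (s y))) (is_tri (a (phi (s y)))) else 0) + want y
  else 0.
Proof.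
rewrite /pay /pay_tail /pay_head /pay_apex !aK tri_phi.
have -> : is_tri (a (s^-1%g y)) = is_tri y by rewrite tri_opp permKV.
have -> : big (s^-1%g y) = big y by rewrite /big (@deg_tail _ _ M _ y) // tail_rotV.
have -> : phi (a y) = s y by apply: phi_opp.
have -> : penta (a y) = penta (s y) by rewrite /penta len_opp.
have -> : big (s y) = big y by rewrite /big deg_rot.
rewrite permKV (tri_opp (s y)).
case ty: (is_tri y) => /=; last by rewrite !andbF.
case by_: (big y) => /=; rewrite ?andbT ?andbF //.
  by rewrite /want ty.
case w: (penta _ && _) => //; have := @want_big y.
by rewrite /want ty w by_ => /(_ isT).
Qed.

Let pay_le y : pay y <= 4 * is_tri y.
Proof.
rewrite payE; case: (is_tri y) => //=; case: (big y) => //=; rewrite muln1.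
have h1 := share_le (want y) (is_tri (s^-1%g (s^-1%g y)))
       (big (prev (s^-1%g y))) (is_tri (a (prev (prev (s^-1%g y))))).
have h2 := share_le (want y) (is_tri (s (s y))) (big (phi (s y))) (is_tri (a (phi (s y)))).
move: h1 h2; case: (want y) => /= h1 h2; case: (penta _); case: (penta _); lia.
Qed.

Let pay_small y : ~~ big y -> pay y = 0.
Proof. by move=> /negbTE nb; rewrite payE nb andbF. Qed.

(** At a vertex of degree five, the triangles at y and at its second successor
    are separated by two faces that are not triangles; only if both triangles
    serve pentagons on both sides could eight units be due, and the amounts in
    [share] prevent that. *)
Let pay_pair y : deg y = 5 -> is_tri y -> is_tri (s (s y)) ->
  pay y + pay (s (s y)) <= 6.
Proof.
move=> d5 ty t2; rewrite !payE ty t2 /=.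
have by_ : big y by rewrite /big d5.
have -> : big (s (s y)) by rewrite /big !deg_rot d5.
rewrite by_ !permK.
have E5 : s (s (s (s (s y)))) = y by have := iter_deg y; rewrite d5.
have Ev : s^-1%g y = s (s (s (s y))) by rewrite -{1}E5 permK.
rewrite Ev permK.
set g := s (s (s y)); set h := s g.
have ng : is_tri g = false by apply/negbTE/tri_apart.
have nh : is_tri h = false.
  by apply/negbTE/negP => th; have := tri_apart th; rewrite /h /g E5 ty.
rewrite ng nh ty /share.
have Ep : prev h = a g by rewrite /prev /h permK.
rewrite Ep.
have Eb : big (phi g) = big (a g).
  by rewrite /big (@deg_tail _ _ M _ (a g)) // tail_phi.
rewrite Eb.
case bg: (big (a g)).
  by case: (want y); case: (want (s (s y)));
   case: (penta _); case: (penta _); case: (penta _).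
have d4 : deg (a g) = 4 by apply: not_big; rewrite bg.
have E4 : s (s (s (s (a g)))) = a g by have := iter_deg (a g); rewrite d4.
have e1 : is_tri (a (prev (a g))) = is_tri (s (s (s (a g)))).
  by rewrite /prev aK -{1}E4 permK.
have e2 : is_tri (a (phi g)) = is_tri (s (s (a g))) by rewrite tri_opp phiE.
rewrite e1 e2.
case t4: (is_tri (s (s (a g)))).
  have -> : is_tri (s (s (s (a g)))) = false by apply/negbTE/tri_apart.
  by case: (want y); case: (want (s (s y)));
   case: (penta _); case: (penta _); case: (penta _).
by case: (is_tri (s (s (s (a g))))); case: (want y); case: (want (s (s y)));
   case: (penta _); case: (penta _); case: (penta _).
Qed.

(** A vertex of degree five owns 6/5 units per corner, six in all, and has at
    most two triangles. *)
Let pay_five y : deg y = 5 ->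
  pay y + pay (s y) + pay (s (s y)) + pay (s (s (s y))) + pay (s (s (s (s y)))) <= 6.
Proof.
move=> d5; set y1 := s y; set y2 := s y1; set y3 := s y2; set y4 := s y3.
have E5 : s y4 = y by have := iter_deg y; rewrite d5.
have d1 : deg y1 = 5 by rewrite deg_rot.
have d2 : deg y2 = 5 by rewrite deg_rot.
have d3 : deg y3 = 5 by rewrite deg_rot.
have d4 : deg y4 = 5 by rewrite deg_rot.
have := pay_pair d5; have := pay_pair d1; have := pay_pair d2.
have := pay_pair d3; have := pay_pair d4.
rewrite -/y1 -/y2 -/y3 -/y4 E5 -/y1 -/y2.
have := @tri_apart y; have := @tri_apart y1; have := @tri_apart y2.
have := @tri_apart y3; have := @tri_apart y4.
rewrite -/y1 -/y2 -/y3 -/y4 E5.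
have := pay_le y; have := pay_le y1; have := pay_le y2; have := pay_le y3.
have := pay_le y4.
move: (pay y) (pay y1) (pay y2) (pay y3) (pay y4) => p0 p1 p2 p3 p4.
case: (is_tri y); case: (is_tri y1) => l4 l3 l2 l1 l0 a4 a3 a2 a1 a0 q4 q3 q2 q1 q0;
  try (by have := a0 isT);
  move: l4 l3 l2 l1 l0 a4 a3 a2 a1 a0 q4 q3 q2 q1 q0;
  case: (is_tri y2); case: (is_tri y3);
  case: (is_tri y4) => l4 l3 l2 l1 l0 a4 a3 a2 a1 a0 q4 q3 q2 q1 q0;
  (try by have := a4 isT); (try by have := a3 isT); (try by have := a2 isT);
  (try by have := a1 isT);
  (try have {}q0 := q0 isT isT); (try have {}q1 := q1 isT isT);
  (try have {}q2 := q2 isT isT); (try have {}q3 := q3 isT isT);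
  (try have {}q4 := q4 isT isT); lia.
Qed.

Local Open Scope ring_scope.
Let ind (b : bool) : K := if b then 1 else 0.

(** The charges are multiplied by six: a triangle lacks two units per side,
    which the faces behind its sides provide; a pentagon owns 6/5 per side, four
    units less than the ten it may have to give, and gets these four from the
    vertices; a face of length at least six owns two units per side. *)
Lemma no_C4_no_dart : (0 < #|dart M|)%N -> False.
Proof.
move/(@euler_sum _ _ M K) => EU.
pose vch x : K := 6 - 24 * (deg x)%:R^-1.
pose lch x : K := 6 - 24 * (len x)%:R^-1.
have tot : \sum_(x : D) vch x + \sum_(x : D) lch x < 0.
  have : \sum_(x : D) ((deg x)%:R^-1 + (len x)%:R^-1 - 2^-1 : K) * (-24) =
    \sum_(x : D) vch x + \sum_(x : D) lch x.
    by rewrite -big_split /=; apply: eq_bigr => x _; rewrite /vch /lch; lra.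
  by rewrite -mulr_suml => <-; lra.
pose P y : K := (pay y)%:R.
(* the vertices can afford what they pay *)
have vert : \sum_(y : D) P y <= \sum_(y : D) vch y.
  rewrite -subr_ge0 -sumrB.
  pose g5 y : K := if deg y == 5 then vch y - P y else 0.
  pose g6 y : K := if deg y == 5 then 0 else vch y - P y.
  have E y : vch y - P y = g5 y + g6 y by rewrite /g5 /g6; case: eqP; lra.
  rewrite (eq_bigr _ (fun y _ => E y)) big_split /=.
  have S5 : 0 <= \sum_(y : D) g5 y.
    have s1 := sum_iter s g5 1; have s2 := sum_iter s g5 2.
    have s3 := sum_iter s g5 3; have s4 := sum_iter s g5 4.
    have : 0 <= \sum_(y : D) (g5 y + g5 (iter 1 s y) + g5 (iter 2 s y) +
       g5 (iter 3 s y) + g5 (iter 4 s y)).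
      apply: sumr_ge0 => y _; rewrite /g5 /= !deg_rot /vch !deg_rot.
      case: eqP => [d5|_]; last by lra.
      have h : P y + P (s y) + P (s (s y)) + P (s (s (s y))) +
         P (s (s (s (s y)))) <= 6%:R.
        by rewrite /P -!natrD ler_nat; apply: pay_five.
      by rewrite d5; lra.
    by rewrite !big_split s1 s2 s3 s4 /=; lra.
  have S6 : 0 <= \sum_(y : D) g6 y.
    have s1 := sum_iter s g6 1.
    have : 0 <= \sum_(y : D) (g6 y + g6 (iter 1 s y)).
      apply: sumr_ge0 => y _; rewrite /g6 /= !deg_rot /vch !deg_rot.
      case: eqP => [d5|d5]; first by lra.
      case b: (big y); last first.
        have d4 := not_big (negbT b).
        have bs : ~~ big (s y) by rewrite /big deg_rot d4.
        by rewrite /P !pay_small ?b // d4; lra.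
      have d6 : (6 <= deg y)%N by move: b; rewrite /big; lia.
      have := @nat_inv_le K 6 (deg y); rewrite d6 => /(_ isT) di.
      have : P y + P (s y) <= 4.
        rewrite /P -natrD ler_nat; have := pay_le y; have := pay_le (s y).
        move: (pay y) (pay (s y)) => p0 p1; have := @tri_apart y.
        by case: (is_tri y); case: (is_tri (s y)) => h; (try by have := h isT); lia.
      lra.
    by rewrite big_split s1 /=; lra.
  exact: addr_ge0.
(* a triangle takes two units through each side *)
have face : \sum_(x : D) (if penta x then 2 * ind (~~ is_tri (a x)) - 4 / 5 else 0)
    <= \sum_(x : D) lch x.
  pose f x : K := (if is_tri x then - 2 else if penta x then 6 / 5 else 2).
  apply: (@le_trans _ _ (\sum_(x : D) f x)); last first.
    apply: ler_sum => x _; rewrite /f /lch /is_tri /penta.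
    have l3 := len_ge3 deg2 x; have l4 := len_neq4 x.
    case: eqP => [->|n3]; first by lra.
    case: eqP => [->|n5]; first by lra.
    have l6 : (6 <= len x)%N by move: l3 l4 n3 n5; lia.
    by have := @nat_inv_le K 6 (len x); rewrite l6 => /(_ isT); lra.
  pose f' x : K := (if is_tri x then 0 else if penta x then 6 / 5 else 2)
     - 2 * ind (is_tri (a x)).
  have -> : \sum_(x : D) f x = \sum_(x : D) f' x.
    rewrite /f' sumrB; have st := sum_inv (fun x => 2 * ind (is_tri x)) aK.
    rewrite st -sumrB; apply: eq_bigr => x _.
    by rewrite /f /ind; case: (is_tri x); lra.
  apply: ler_sum => x _; rewrite /f' /ind.
  have tp : is_tri x -> penta x = false by rewrite /penta /is_tri => /eqP ->.
  have := @tri_apart x; rewrite -tri_opp.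
  case tx: (is_tri x) tp => tp; first by rewrite tp //; case: (is_tri (a x)) => /= h; lra.
  by move=> _; case: (penta x); case: (is_tri (a x)) => /=; lra.
have paid : \sum_(y : D) P y = \sum_(x : D)
   ((pay_tail x)%:R + (pay_head x)%:R + (pay_apex x)%:R : K).
  rewrite /P /pay; under eq_bigr do rewrite !natrD.
  rewrite !big_split /=; congr (_ + _ + _).
  - exact: (sum_perm s^-1%g (fun x => (pay_tail x)%:R)).
  - exact: (sum_inv (fun x => (pay_head x)%:R) aK).
  - rewrite (sum_perm phi (fun x => (pay_apex (a x))%:R)).
    exact: (sum_inv (fun x => (pay_apex x)%:R) aK).
pose w x : K := if penta x then (gets x)%:R - 4 / 5 else 0.
have W : 0 <= \sum_(x : D) w x.
  have s1 := sum_iter phi w 1; have s2 := sum_iter phi w 2.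
  have s3 := sum_iter phi w 3; have s4 := sum_iter phi w 4.
  have : 0 <= \sum_(y : D) (w y + w (iter 1 phi y) + w (iter 2 phi y) +
       w (iter 3 phi y) + w (iter 4 phi y)).
    apply: sumr_ge0 => y _; rewrite /w /= !penta_phi.
    case py: (penta y); last by lra.
    have h : 4%:R <= (gets y)%:R + (gets (phi y))%:R + (gets (phi (phi y)))%:R
       + (gets (phi (phi (phi y))))%:R
       + (gets (phi (phi (phi (phi y)))))%:R :> K.
      by rewrite -!natrD ler_nat; apply: penta_gets.
    lra.
  by rewrite !big_split s1 s2 s3 s4 /=; lra.
have : \sum_(x : D) w x <= \sum_(x : D) lch x + \sum_(y : D) vch y.
  apply: le_trans (lerD face vert); rewrite paid -big_split /=.
  apply: ler_sum => x _; rewrite /w /gets !natrD /ind.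
  have g1 : 0 <= (pay_tail x)%:R :> K := ler0n _ _.
  have g2 : 0 <= (pay_head x)%:R :> K := ler0n _ _.
  have g3 : 0 <= (pay_apex x)%:R :> K := ler0n _ _.
  by case: (penta x); case: (is_tri (a x)); rewrite /= ?muln0 ?muln1; lra.
lra.
Qed.

End NoC4.

(** * Nonseparating triangles are faces *)

Section Jordan.
Variables (V : finType) (e : rel V) (M : plane_map e).
Let e_irr : irreflexive e := graph_irr M.
Let e_sym : symmetric e := graph_sym M.
Notation D := (dart M).
Notation s := (rot M).
Notation a := (@opp _ _ M).
Notation t := (@tail _ _ M).
Notation phi := (phi M).
Let aK : involutive a := @oppK _ _ M.
Hypothesis deg2 : no_leaf M.

Variable (x : D) (w : V).
Hypotheses (vw : e (head x) w) (wu : e w (t x)).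

Let tri : {set V} := [set t x; head x; w].
(** The graph without the triangle. *)
Definition avoid : rel V := fun p q => [&& e p q, p \notin tri & q \notin tri].
Hypothesis nonseparating : forall y z : D, t y \notin tri -> t z \notin tri ->
  connect avoid (t y) (t z).

Let A : {set D} := [set y | (t y \in tri) == (head y \in tri)].

Let eA : edge_set a A.
Proof.
apply/forall_inP => y; rewrite !inE /head aK eq_sym => ->.
exact: opp_neq.
Qed.

Notation F := (face s aK A).
Notation conn B := (connect (link s a B)).

Let F_tri y : t y \in tri -> t (F y) \in tri.
Proof.
move=> ty; rewrite faceE tail_rot edge_set_act //; case: ifP => //.
by rewrite inE ty => /eqP <-.
Qed.

Let F_orbit_tri y z : t y \in tri -> z \in porbit F y -> t z \in tri.
Proof. by move=> ty; apply: (porbit_ind (P := fun z => t z \in tri)) => // z'; apply: F_tri. Qed.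

(** Walk along one side of the triangle, in the map A that has lost the edges
    between the triangle and the rest: either nothing leaves the triangle on
    that side, which is then a face, or a lost edge starts in the face of A on
    that side. *)
Let side (x1 x2 x3 : D) : tri = [set t x1; t x2; t x3] ->
  head x1 = t x2 -> head x2 = t x3 -> head x3 = t x1 ->
  [/\ phi x1 = x2, phi x2 = x3 & phi x3 = x1] \/
  exists d, [/\ d \in porbit F x1, t d \in tri & head d \notin tri].
Proof.
move=> E h1 h2 h3.
have mem y z : t y \in tri -> head y = t z -> t z \in tri ->
    F y = s (a y) by move=> ty hy tz; rewrite faceE edge_set_act // inE hy ty tz.
have T1 : t x1 \in tri by rewrite E !inE eqxx.
have T2 : t x2 \in tri by rewrite E !inE eqxx !orbT.
have T3 : t x3 \in tri by rewrite E !inE eqxx !orbT.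
have step y1 y2 y3 : tri = [set t y1; t y2; t y3] -> t y1 \in tri ->
   t y2 \in tri -> y1 \in porbit F x1 -> head y1 = t y2 -> head y2 = t y3 ->
   phi y1 = y2 \/ exists d, [/\ d \in porbit F x1, t d \in tri & head d \notin tri].
  move=> E' t1 t2 o1 e1 e2; rewrite phiE.
  case: (boolP (head (s (a y1)) \in tri)) => hd; last first.
    right; exists (s (a y1)); rewrite tail_rot -/(head y1) e1; split=> //.
    by apply: porbit_trans o1 _; rewrite -(mem y1 y2) // porbit_step.
  left; move: hd; rewrite E' !inE => /orP[/orP[]|] /eqP hd.
  - have Eq : s (a y1) = a y1.
      by apply: head_inj; rewrite ?tail_rot // hd head_opp.
    by have := deg2 (a y1); rewrite Eq eqxx.
  - have := tail_neq_head (s (a y1)).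
    by rewrite tail_rot -/(head y1) e1 hd eqxx.
  - by apply: head_inj; rewrite ?tail_rot -/(head y1) ?e1 // hd.
have Er : tri = [set t x2; t x3; t x1].
  by rewrite E; apply/setP => y; rewrite !inE; do 3![case: (y == _)].
have Er' : tri = [set t x3; t x1; t x2].
  by rewrite Er; apply/setP => y; rewrite !inE; do 3![case: (y == _)].
have [p1|] := step x1 x2 x3 E T1 T2 (porbit_id _ _) h1 h2; last by right.
have o2 : x2 \in porbit F x1.
  by have := porbit_step F x1; rewrite (mem x1 x2) // -phiE p1.
have [p2|] := step x2 x3 x1 Er T2 T3 o2 h2 h3; last by right.
have o3 : x3 \in porbit F x1.
  by apply: porbit_trans o2 _; have := porbit_step F x2; rewrite (mem x2 x3) // -phiE p2.
have [p3|] := step x3 x1 x2 Er' T3 T1 o3 h3 h1; last by right.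
by left.
Qed.

Let face_tri (x1 x2 x3 : D) : phi x1 = x2 -> phi x2 = x3 -> phi x3 = x1 ->
  is_tri x1 /\ head (phi x1) = head x2.
Proof.
move=> p1 p2 p3; split; last by rewrite p1.
rewrite /is_tri eqn_leq len_ge3 // andbT.
by apply: card_porbit_le; rewrite //= p1 p2 p3.
Qed.

(** Otherwise edges leave the triangle on both sides.  In the submap A, which
    keeps the triangle, the edges inside the rest and nothing in between, the
    two sides of the triangle are different faces, by planarity.  Add the edge
    that leaves on one side: now everything is connected, so that the edge
    leaving on the other side has both its ends in one face.  But the face on
    that other side has not been touched and meets only the triangle. *)
Theorem nonseparating_facial :
  (is_tri x /\ head (phi x) = w) \/ (is_tri (a x) /\ head (phi (a x)) = w).
Proof.
have [x2 [t2 h2]] := edge_dart M vw; have [x3 [t3 h3]] := edge_dart M wu.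
rewrite -/(head x2) in h2; rewrite -/(head x3) in h3.
have E1 : tri = [set t x; t x2; t x3] by rewrite t2 t3.
have [[p1 p2 p3]|[d [dL dT dh]]] := side E1 (esym t2) (etrans h2 (esym t3)) h3.
  by left; have [-> ->] := face_tri p1 p2 p3.
have E2 : tri = [set t (a x); t (a x3); t (a x2)].
  rewrite -/(head x) -/(head x3) -/(head x2) h3 h2.
  by apply/setP => y; rewrite !inE; do 3![case: (y == _)].
have k1 : head (a x) = t (a x3) by rewrite head_opp -/(head x3) h3.
have k2 : head (a x3) = t (a x2) by rewrite head_opp -/(head x2) h2 t3.
have k3 : head (a x2) = t (a x) by rewrite head_opp -/(head x) t2.
have [[p1 p2 p3]|[d' [dR dT' dh']]] := side E2 k1 k2 k3.
  by right; have [-> ->] := face_tri p1 p2 p3; rewrite head_opp t3.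
exfalso.
have tu : t x \in tri by rewrite !inE eqxx.
have tv : head x \in tri by rewrite !inE eqxx !orbT.
have tw : w \in tri by rewrite !inE eqxx !orbT.
have xA : x \in A by rewrite inE tu tv.
have uv : t x != head x by apply: tail_neq_head.
have wv : head x != w by apply: adj_neq e_irr vw.
have wu' : w != t x by apply: adj_neq e_irr wu.
(* the two sides of the cycle are different faces *)
(* the triangle without its side x is a path, so x joins two points of one
component and adding it splits a face *)
pose A0 := A :\: [set x; a x].
have eA0 : edge_set a A0.
  apply/forall_inP => y; rewrite !inE => /andP[/norP[yx yax] yA].
  rewrite (inv_eq aK) (inj_eq (inv_inj aK)) negb_or yax yx opp_neq andbT /=.
  by rewrite /head aK eq_sym.
have AE : A = add_edge a A0 x.
  apply/setP => y; rewrite [RHS]inE in_set1 [_ \in a x |: _]inE in_set1.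
  rewrite [_ \in A0]inE in_set2; case: eqP => [->|_] //=.
  case: eqP => [->|_] //=.
  by rewrite inE -/(head x) head_opp tu tv.
have memA0 y : (t y \in tri) -> head y \in tri -> y != x -> y != a x -> y \in A0.
  by move=> h1 h3' h4 h5; rewrite !inE negb_or h4 h5; move: h1 h3'; rewrite !inE => -> ->.
have x2A : x2 \in A0.
  apply: memA0; rewrite ?t2 ?h2 //.
    by apply: contra uv => /eqP xe; rewrite -{1}xe t2.
  by apply: contra wu' => /eqP xe; rewrite -h2 xe head_opp.
have x3A : x3 \in A0.
  apply: memA0; rewrite ?t3 ?h3 //.
    by apply: contra wu' => /eqP xe; rewrite -t3 xe.
  by apply: contra wv => /eqP xe; rewrite -t3 xe.
have xA0 : x \notin A0 by rewrite !inE eqxx.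
have rotc B y z : t y = t z -> conn B y z.
  by move=> h; apply: conn_rotation; apply: tail_orbit.
have actc B y : edge_set a B -> y \in B -> conn B y (a y).
  by move=> eB yB; have := conn_act s a B y; rewrite edge_set_act // yB.
have cA0 : conn A0 x (a x).
  apply: connect_trans (rotc A0 x (a x3) _) _; first by rewrite -/(head x3) h3.
  rewrite (conn_sym s aK).
  apply: connect_trans (rotc A0 (a x) x2 _) _; first by rewrite t2.
  apply: connect_trans (actc A0 x2 eA0 x2A) _.
  apply: connect_trans (rotc A0 (a x2) x3 _) (actc A0 x3 eA0 x3A).
  by rewrite -/(head x2) h2 t3.
have sep : x \notin porbit F (a x).
  have := @map_planar _ _ M _ _ eA0 (subsetT _) (in_setT x) xA0 cA0.
  rewrite porbit_sym => o.
  have actx : act a A0 x = x by rewrite edge_set_act // (negbTE xA0).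
  rewrite AE face_add ?opp_neq //; apply: tperm_split => //.
  by rewrite eq_sym opp_neq.
have tax : t (a x) \in tri by [].
have dA : d \notin A by rewrite inE dT (negbTE dh).
have dA' : d' \notin A by rewrite inE dT' (negbTE dh').
pose A1 := add_edge a A d.
have eA1 : edge_set a A1 by apply: edge_set_add => //; apply: opp_neq.
have sub1 : A \subset A1 by apply/subsetP => y yA; rewrite !in_setU yA !orbT.
have cT y z : t y \in tri -> t z \in tri -> conn A y z.
  have c1 y' : t y' \in tri -> conn A y' x.
    rewrite !inE => /orP[/orP[]|] /eqP ty; first exact: rotc.
      apply: connect_trans (rotc A y' (a x) ty) _.
      by rewrite (conn_sym s aK); apply: actc.
    apply: connect_trans (rotc A y' x3 _) _; first by rewrite t3.
    apply: connect_trans (actc A x3 eA _) (rotc _ _ _ h3).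
    by move: x3A; rewrite inE => /andP[].
  move=> h1 h4; apply: connect_trans (c1 y h1) _.
  by rewrite (conn_sym s aK); apply: c1.
have cW y z : t y \notin tri -> t z \notin tri -> conn A y z.
  move=> hy hz; have /connectP[p pp lp] := nonseparating hy hz.
  elim: p y hy pp lp => [|q p IH] y hy /=; first by move=> _ h; apply: rotc.
  case/andP=> /and3P[yq _ qT] pp lp.
  have [d1 [td hd]] := edge_dart M yq.
  apply: connect_trans (rotc A y d1 (esym td)) _.
  apply: connect_trans (actc A d1 eA _) _.
    by rewrite in_set td /head hd (negbTE hy) (negbTE qT).
  by apply: IH; rewrite hd.
have dd' : d != d'.
  apply: contra sep => /eqP dd; rewrite -dd in dR.
  by apply: porbit_trans dR _; rewrite porbit_sym.
have d'A1 : d' \notin A1.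
  rewrite !in_setU1 (negbTE dA') orbF negb_or eq_sym dd' /=.
  by apply: contra dh => /eqP d'a; move: dT'; rewrite d'a.
have c' : conn A1 d' (a d').
  apply: connect_trans (conn_mono aK sub1 (cT _ _ dT' dT)) _.
  apply: connect_trans (actc A1 d eA1 _) _; first by rewrite in_setU1 eqxx.
  by apply: (conn_mono aK sub1); apply: cW.
have := @map_planar _ _ M _ _ eA1 (subsetT _) (in_setT d') d'A1 c'.
rewrite face_add ?opp_neq //; last by rewrite edge_set_act // (negbTE dA).
rewrite tperm_orbit_notin; first by move/(F_orbit_tri dT'); apply/negP.
  apply: contra sep => dd; apply: porbit_trans dR _.
  by apply: porbit_trans dd _; rewrite porbit_sym.
by apply: contra dh => /(F_orbit_tri dT').
Qed.
End Jordan.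

(** * Graphs without hexagons *)

(** To bound a sum over all darts it suffices to bound the sum over k successive
    darts. *)
Lemma sum_shift_le0 (K : realFieldType) (D : finType) (p : {perm D}) (F : D -> K) k :
  0 < k -> (forall x, \sum_(i < k) F (iter i p x) <= 0)%R -> (\sum_x F x <= 0)%R.
Proof.
move=> k0 H; have : (\sum_x \sum_(i < k) F (iter i p x) <= 0)%R.
  by apply: sumr_le0 => x _.
rewrite exchange_big /= (eq_bigr (fun=> \sum_x F x)%R); last first.
  by move=> i _; rewrite sum_iter.
by rewrite sumr_const card_ord pmulrn_lle0.
Qed.

Section NoC6.
Variables (V : finType) (e : rel V) (M : plane_map e) (KV : {set V}).
Let e_irr : irreflexive e := graph_irr M.
Let e_sym : symmetric e := graph_sym M.
Notation D := (dart M).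
Notation s := (rot M).
Notation a := (@opp _ _ M).
Notation t := (@tail _ _ M).
Notation phi := (phi M).
Let aK : involutive a := @oppK _ _ M.
Implicit Types x y z : D.

Hypothesis deg2 : no_leaf M.
(** KV is the vertex set of the triangle that cuts a piece off the graph, or
    empty.  Its vertices may have lost neighbours outside of the piece, so that
    only the others are known to have degree at least four. *)
Hypothesis deg4 : forall x, t x \notin KV -> 4 <= deg x.
Hypothesis facial : forall x w, e (head x) w -> e w (t x) ->
  (is_tri x /\ head (phi x) = w) \/ (is_tri (a x) /\ head (phi (a x)) = w).
Hypothesis noC6 : no_cycle e 6.
Hypothesis KV_clique : {in KV &, forall u v, u != v -> e u v}.
Hypothesis KV_card : KV = set0 \/ #|KV| = 3.

(** The triangular face bounded by KV itself does not count as a triangle: its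
    vertices may have small degrees, and it may be needed to give rather than to
    receive. *)
Definition blank x :=
  [&& is_tri x, t x \in KV, head x \in KV & head (phi x) \in KV].
Definition tri x := is_tri x && ~~ blank x.

Lemma is_tri3 x : is_tri x -> phi (phi (phi x)) = x.
Proof. by move/eqP => l3; have := iter_len x; rewrite l3. Qed.

Lemma tri_head2 x : is_tri x -> head (phi (phi x)) = t x.
Proof. by move=> tx; rewrite -tail_phi is_tri3. Qed.

Lemma blank_phi x : blank (phi x) = blank x.
Proof.
rewrite /blank tri_phi tail_phi; case tx: (is_tri x) => //=.
by rewrite tri_head2 //; case: (t x \in KV); case: (head x \in KV); rewrite /= ?andbT ?andbF.
Qed.

Lemma tri_phi' x : tri (phi x) = tri x.
Proof. by rewrite /tri tri_phi blank_phi. Qed.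

Lemma blank_opp x : blank (a x) = blank (s x).
Proof. by rewrite -(phi_opp x) blank_phi. Qed.

Lemma tri_opp' x : tri (a x) = tri (s x).
Proof. by rewrite -(phi_opp x) tri_phi'. Qed.

Lemma triW x : tri x -> is_tri x. Proof. by case/andP. Qed.

Lemma KV_le3 (c : seq V) : uniq c -> {subset c <= KV} -> size c <= 3.
Proof.
move=> uc sc; have := @uniq_leq_size _ c (enum KV) uc.
move=> H; have {H} : size c <= size (enum KV).
  by apply: H => v /sc; rewrite mem_enum.
by rewrite -cardE; case: KV_card => ->; rewrite ?cards0; lia.
Qed.

Lemma KV_no4 u v w q : u \in KV -> v \in KV -> w \in KV -> q \in KV ->
  ~~ uniq [:: u; v; w; q].
Proof.
move=> h1 h2 h3 h4; apply/negP => U; have := KV_le3 U.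
have sub : {subset [:: u; v; w; q] <= KV}.
  by move=> y; rewrite !inE => /or4P[] /eqP ->.
by move=> /(_ sub).
Qed.

(** The triangle KV bounds a face as every other triangle does, so that each of
    its vertices has a corner there. *)
Lemma KV_corner x : t x \in KV -> exists y, t y = t x /\ blank y.
Proof.
move=> tK; have c3 : #|KV| = 3 by case: KV_card => // E; rewrite E inE in tK.
have c2 : #|KV :\ t x| = 2 by move: c3; rewrite (cardsD1 (t x)) tK; lia.
have /cards2P[v [w [vw E]]] : #|KV :\ t x| == 2 by rewrite c2.
have : v \in KV :\ t x by rewrite E !inE eqxx.
have : w \in KV :\ t x by rewrite E !inE eqxx orbT.
rewrite !inE => /andP[wx wK] /andP[vx vK].
have xv : e (t x) v by apply: KV_clique => //; rewrite eq_sym.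
have [d [td hd]] := edge_dart M xv.
have [||[h1 h2]|[h1 h2]] := facial (x := d) (w := w).
- by rewrite /head hd; apply: KV_clique.
- by rewrite td; apply: KV_clique.
- by exists d; rewrite /blank td h1 h2 /head hd tK vK wK.
exists (phi (a d)); rewrite tail_phi head_opp td; split=> //.
by rewrite blank_phi /blank h1 h2 head_opp td hd tK vK wK.
Qed.

Lemma low2_KV x : s (s x) = x -> t x \in KV.
Proof.
move=> E; apply/negPn/negP => /deg4.
by rewrite leqNgt ltnS (leq_trans (card_porbit_le _ (_ : iter 2 s x = x))).
Qed.

Lemma low3_KV x : s (s (s x)) = x -> t x \in KV.
Proof.
move=> E; apply/negPn/negP => /deg4.
by rewrite leqNgt ltnS (leq_trans (card_porbit_le _ (_ : iter 3 s x = x))).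
Qed.

(** A vertex of degree two lies in KV and hence has one of its two corners in
    the face of KV. *)
Lemma low2_blank x : s (s x) = x -> blank x \/ blank (s x).
Proof.
move=> E; have [y [ty by_]] := KV_corner (low2_KV E).
have : (y == x) || (y == s x).
  apply: (porbit_ind (P := fun y => (y == x) || (y == s x))) (tail_orbit (esym ty)).
    by rewrite eqxx.
  by move=> y' /orP[] /eqP ->; rewrite ?E ?eqxx ?orbT.
by case/orP=> /eqP yE; rewrite yE in by_; [left|right].
Qed.

Lemma low3_blank x : s (s (s x)) = x -> [\/ blank x, blank (s x) | blank (s (s x))].
Proof.
move=> E; have [y [ty by_]] := KV_corner (low3_KV E).
have : [|| y == x, y == s x | y == s (s x)].
  apply: (porbit_ind (P := fun y => [|| y == x, y == s x | y == s (s x)])) (tail_orbit (esym ty)).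
    by rewrite eqxx.
  by move=> y' /or3P[] /eqP ->; rewrite ?E ?eqxx ?orbT.
by case/or3P=> /eqP yE; rewrite yE in by_; [apply: Or31|apply: Or32|apply: Or33].
Qed.

Lemma rotV_eq x : s (s x) = x -> s^-1%g x = s x.
Proof. by move=> E; rewrite -{1}E permK. Qed.

Lemma tri_deg3 x : tri x -> s (s x) != x.
Proof.
case/andP=> tx nb; apply/eqP => E; have [h|h] := low2_blank E.
  by rewrite h in nb.
move: h; rewrite /blank => /and4P[ts tK hK aK'].
move/negP: nb; apply; rewrite /blank tx.
move: aK'; rewrite -tri_apex // permK => ->.
by rewrite -tri_apex // rotV_eq // hK -(tail_rot x) tK.
Qed.

Lemma tri_deg3h x : tri x -> s (s (a x)) != a x.
Proof.
move=> tx; have : tri (phi x) by rewrite tri_phi'.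
move/tri_deg3; rewrite phiE; apply: contra => /eqP E.
by rewrite E eqxx.
Qed.

Lemma head_neq x y : t x = t y -> x != y -> head x != head y.
Proof. by move=> h; apply: contra => /eqP h'; apply/eqP/head_inj. Qed.

(** The graph around is a K4 all of whose triangles are faces: its four vertices
    have degree three and hence lie in KV, which has only three. *)
Lemma tri_wheel3 x : is_tri x -> is_tri (s x) -> is_tri (s (s x)) ->
  s (s (s x)) = x -> False.
Proof.
have rim x' : is_tri x' -> is_tri (s x') -> is_tri (s (s x')) ->
    s (s (s x')) = x' -> head x' \in KV.
  move=> t1 t2 t3 E; have Ev : s^-1%g x' = s (s x') by rewrite -{1}E permK.
  pose z := phi (s x').
  have hz : head z = head x' by rewrite /z -tri_apex // permK.
  have tz : t z = head (s x') by rewrite /z tail_phi.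
  have apx : head (phi x') = head (s (s x')) by rewrite -tri_apex // Ev.
  have [||[h1 h2]|[h1 h2]] := facial (x := z) (w := head (s (s x'))).
  - by rewrite hz -apx head_adj.
  - have := head_adj (s (s x')); rewrite -tri_apex // permK.
    by rewrite tz.
  - have := tail_neq_head (s (s x')); rewrite !tail_rot -h2 /z tri_head2 //.
    by rewrite tail_rot eqxx.
  suff : s (s (s (a x'))) = a x' by move/low3_KV.
  have E1 : s (a x') = phi x' by rewrite phiE.
  have E2 : a (phi x') = phi (phi (a z)).
    apply: head_inj.
      by rewrite tail_phi h2 -[t (a _)]/(head (phi x')) apx.
    by rewrite head_opp tail_phi tri_head2 // -hz.
  have E3 : s (phi x') = a z.
    by rewrite -phi_opp E2 is_tri3.
  rewrite E1 E3 -phi_opp aK; apply: head_inj.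
    by rewrite tail_phi hz.
  by rewrite /z tri_head2 // head_opp tail_rot.
move=> t1 t2 t3 E.
have h0 : t x \in KV by apply: low3_KV.
have h1 : head x \in KV by apply: rim.
have h2 : head (s x) \in KV by apply: rim => //; rewrite E.
have h3 : head (s (s x)) \in KV by apply: rim => //; rewrite E.
have n1 := deg2 x; have n2 : s (s x) != x.
  by apply/eqP => E2; have := deg2 x; rewrite -{2}E E2 eqxx.
have := KV_no4 h0 h1 h2 h3; apply/negP; rewrite negbK /= !inE !negb_or.
have a1 := tail_neq_head x; have a2 := tail_neq_head (s x).
have a3 := tail_neq_head (s (s x)); rewrite !tail_rot in a2 a3.
rewrite a1 a2 a3 /= andbT !head_neq ?tail_rot //; try by rewrite eq_sym.
Qed.

(** If the ends of a path of length two on a face are adjacent, the triangle so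
    formed bounds a face, and it is not the face of the path: the middle vertex
    has degree two. *)
Lemma ear x : ~~ is_tri x -> e (head (phi x)) (t x) ->
  is_tri (a x) /\ s (s (a x)) = a x.
Proof.
move=> nt cl; have [||[h1 h2]|[h1 h2]] := facial (x := x) (w := head (phi x)) => //.
- exact: head_adj.
- by rewrite h1 in nt.
split=> //; apply/eqP/negPn/negP => /head_rot_neq.
by rewrite tri_apex // h2 phiE eqxx.
Qed.

Lemma ear_KV x : ~~ is_tri x -> e (head (phi x)) (t x) -> head x \in KV.
Proof. by move=> h1 h2; have [_ /low2_KV] := ear h1 h2. Qed.

(** A face of length six that meets one vertex twice consists of two triangles
    joined at this vertex; the ears make four vertices of degree two, all in KV.
    *)
Lemma bowtie x : len x = 6 -> t x = t (phi (phi (phi x))) -> False.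
Proof.
move=> l6 E; have nt y : len y = 6 -> ~~ is_tri y by rewrite /is_tri => ->.
have E6 : phi (phi (phi (phi (phi (phi x))))) = x.
  by have := iter_len x; rewrite l6.
set x1 := phi x in E E6 *; set x2 := phi x1 in E E6 *; set x3 := phi x2 in E E6 *.
set x4 := phi x3 in E6 *; set x5 := phi x4 in E6 *.
have h1 : head x = t x1 by rewrite tail_phi.
have h2 : head x1 = t x2 by rewrite tail_phi.
have h3 : head x2 = t x3 by rewrite tail_phi.
have h4 : head x3 = t x4 by rewrite tail_phi.
have h5 : head x4 = t x5 by rewrite tail_phi.
have h0 : head x5 = t x by rewrite -tail_phi E6.
have k1 : head x \in KV.
  by apply: ear_KV; [exact: nt | rewrite -/x1 h2 E -h3 edge].
have k2 : head x1 \in KV.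
  by apply: ear_KV; [apply: nt; rewrite len_phi | rewrite -/x2 h3 -E -h1 edge].
have k4 : head x3 \in KV.
  by apply: ear_KV; [apply: nt; rewrite !len_phi | rewrite -/x4 h5 -E -h0 edge].
have k5 : head x4 \in KV.
  by apply: ear_KV; [apply: nt; rewrite !len_phi | rewrite -/x5 h0 E -h4 edge].
have := KV_no4 k1 k2 k4 k5; apply/negP; rewrite negbK /= !inE !negb_or.
have d3 : x != x3 by have := @iter_neq0 _ phi x 3; rewrite -/(len x) l6 eq_sym; apply.
have d25 : x2 != x5.
  apply/eqP => E2; have := @iter_neq _ phi x 2 5; rewrite -/(len x) l6 => /(_ isT).
  by rewrite /= -/x1 -/x2 -/x3 -/x4 -/x5 E2 eqxx.
have n12 := adj_neq e_irr (edge x1); rewrite -h1 in n12.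
have n14 : head x != head x3 by apply: head_neq.
have n15 : head x != head x4.
  by have := nonbacktrack deg2 x5; rewrite E6 -h5.
have n24 : head x1 != head x3.
  by have := nonbacktrack deg2 x2; rewrite -/x3 -h2 eq_sym.
have n25 : head x1 != head x4.
  rewrite h2 h5; apply: contra d25 => /eqP t25; apply/eqP/head_inj => //.
  by rewrite h0 h3.
have n45 := adj_neq e_irr (edge x4); rewrite -h4 in n45.
by rewrite n12 n14 n15 n24 n25 n45.
Qed.

(** A face of length six is a hexagon unless it repeats a vertex; repetitions at
    distance two are excluded by degrees and at distance three by [bowtie]. *)
Lemma no_hexagon x : len x != 6.
Proof.
apply/eqP => l6.
have E6 : phi (phi (phi (phi (phi (phi x))))) = x.
  by have := iter_len x; rewrite l6.
set x1 := phi x in E6 *; set x2 := phi x1 in E6 *; set x3 := phi x2 in E6 *.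
set x4 := phi x3 in E6 *; set x5 := phi x4 in E6 *.
have l1 : len x1 = 6 by rewrite len_phi.
have l2 : len x2 = 6 by rewrite len_phi.
have h1 : head x = t x1 by rewrite tail_phi.
have h2 : head x1 = t x2 by rewrite tail_phi.
have h3 : head x2 = t x3 by rewrite tail_phi.
have h4 : head x3 = t x4 by rewrite tail_phi.
have h5 : head x4 = t x5 by rewrite tail_phi.
have h0 : head x5 = t x by rewrite -tail_phi E6.
have n03 : t x != t x3 by apply/eqP => /(bowtie l6).
have n14 : t x1 != t x4 by apply/eqP => /(bowtie l1).
have n25 : t x2 != t x5 by apply/eqP => /(bowtie l2).
have n02 : t x != t x2 by have := nonbacktrack deg2 x; rewrite -/x1 h2 eq_sym.
have n13 : t x1 != t x3 by have := nonbacktrack deg2 x1; rewrite -/x2 h3 eq_sym.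
have n24 : t x2 != t x4 by have := nonbacktrack deg2 x2; rewrite -/x3 h4 eq_sym.
have n35 : t x3 != t x5 by have := nonbacktrack deg2 x3; rewrite -/x4 h5 eq_sym.
have n40 : t x4 != t x by have := nonbacktrack deg2 x4; rewrite -/x5 h0 eq_sym.
have n51 : t x5 != t x1 by have := nonbacktrack deg2 x5; rewrite E6 h1 eq_sym.
have e0 := edge x; have e1 := edge x1; have e2 := edge x2.
have e3 := edge x3; have e4 := edge x4; have e5 := edge x5.
rewrite h1 in e0; rewrite h2 in e1; rewrite h3 in e2; rewrite h4 in e3.
rewrite h5 in e4; rewrite h0 in e5.
apply: (noC6 (c := [:: t x; t x1; t x2; t x3; t x4; t x5])) => //.
by cycle_tac e_irr e_sym.
Qed.

(** A pentagon and a triangle behind one of its sides close a hexagon, unless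
    the third vertex of the triangle is opposite on the pentagon; then the ears
    put four vertices of the pentagon in KV. *)
Lemma tri_not_penta x : tri x -> len (a x) != 5.
Proof.
move=> tx; apply/eqP => l5; pose z := a x; rewrite -/z in l5.
have tx' := triW tx.
have nt y : len y = 5 -> ~~ is_tri y by rewrite /is_tri => ->.
have E5 : phi (phi (phi (phi (phi z)))) = z.
  by have := iter_len z; rewrite l5.
set z1 := phi z in E5; set z2 := phi z1 in E5; set z3 := phi z2 in E5.
set z4 := phi z3 in E5.
have h0 : head z = t z1 by rewrite tail_phi.
have h1 : head z1 = t z2 by rewrite tail_phi.
have h2 : head z2 = t z3 by rewrite tail_phi.
have h3 : head z3 = t z4 by rewrite tail_phi.
have h4 : head z4 = t z by rewrite -tail_phi E5.
have Ez1 : z1 = s x by rewrite /z1 /z phi_opp.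
have hz : head z = t x by rewrite head_opp.
pose o := head (phi x).
have o1 : o != t z2.
  by rewrite -h1 Ez1 /o -tri_apex // eq_sym head_rot_neq // tri_deg3.
have o4 : o != t z4.
  have <- : head (s^-1%g z) = t z4.
    by rewrite (@head_rotV _ _ _ z 3 l5) /= -/z1 -/z2 -/z3.
  by rewrite /o phiE head_rot_neq // tri_deg3h.
have e0 := edge z; have e1 := edge z1; have e2 := edge z2.
have e3 := edge z3; have e4 := edge z4.
rewrite h0 in e0; rewrite h1 in e1; rewrite h2 in e2; rewrite h3 in e3.
rewrite h4 in e4.
have n02 : t z != t z2 by have := nonbacktrack deg2 z; rewrite -/z1 h1 eq_sym.
have n13 : t z1 != t z3 by have := nonbacktrack deg2 z1; rewrite -/z2 h2 eq_sym.
have n24 : t z2 != t z4 by have := nonbacktrack deg2 z2; rewrite -/z3 h3 eq_sym.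
have n30 : t z3 != t z by have := nonbacktrack deg2 z3; rewrite -/z4 h4 eq_sym.
have n41 : t z4 != t z1 by have := nonbacktrack deg2 z4; rewrite E5 h0 eq_sym.
have ov : e (t z) o by apply: head_adj.
have ou : e o (t z1) by rewrite -h0 hz tri_adj.
have [o3|o3] := eqVneq o (t z3); last first.
  apply: (noC6 (c := [:: o; t z1; t z2; t z3; t z4; t z])) => //.
  by cycle_tac e_irr e_sym.
have [i1 i2] : is_tri (a z1) /\ s (s (a z1)) = a z1.
  apply: ear; first by apply: nt; rewrite len_phi.
  by rewrite -/z2 h2 -o3.
have b1 : blank (a z1).
  have [//|/andP[+ _]] := low2_blank i2.
  by rewrite -phiE -/z2 /is_tri !len_phi l5.
have k4 : head z3 \in KV.
  apply: ear_KV; first by apply: nt; rewrite !len_phi.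
  by rewrite -/z4 h4 -o3.
move: b1; rewrite /blank head_opp -tri_apex // rotV_eq // -phiE -/z2 h2.
case/and4P=> _; rewrite -/(head z1) h1 => k2 k1 k3; rewrite h3 in k4.
have := KV_no4 k1 k2 k3 k4; apply/negP; rewrite negbK.
have : ucycle e [:: t z; t z1; t z2; t z3; t z4] by cycle_tac e_irr e_sym.
by rewrite /ucycle /= => /and3P[_ _].
Qed.

(** Coordinates for a quadrilateral v u y w with a triangle u v o behind its
    first side.  A diagonal would make a triangle that has to be a face on a
    side already occupied by another one. *)
Lemma quad_tri z : tri (a z) -> len z = 4 ->
  let o := head (phi (a z)) in
  let v := t z in let u := t (phi z) in
  let y := t (phi (phi z)) in let w := t (phi (phi (phi z))) in
  [/\ ucycle e [:: v; u; y; w], ~~ e u w /\ ~~ e v y, e v o /\ e o u, o != y & o != w].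
Proof.
move=> tx l4; set x := a z in tx *; pose z1 := phi z; pose z2 := phi z1.
pose z3 := phi z2; rewrite -/z1 -/z2 -/z3 => o v u y w.
have tx' := triW tx.
have E4 : phi z3 = z by have := iter_len z; rewrite l4.
have h0 : head z = u by rewrite /u tail_phi.
have h1 : head z1 = y by rewrite /y tail_phi.
have h2 : head z2 = w by rewrite /w tail_phi.
have h3 : head z3 = v by rewrite -tail_phi E4.
have Ez1 : z1 = s x by rewrite /z1 /x phiE.
have hx : head x = v by rewrite head_opp.
have oy : o != y.
  by rewrite -h1 Ez1 /o -tri_apex // eq_sym head_rot_neq // tri_deg3.
have ow : o != w.
  have <- : head (s^-1%g z) = w.
    by rewrite (@head_rotV _ _ _ z 2 l4) /= -/z1 -/z2.
  have := head_rot_neq (tri_deg3h tx).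
  by rewrite -phiE /o /x aK.
have e0 : e v u by rewrite -h0 edge.
have e1 : e u y by rewrite -h1 edge.
have e2 : e y w by rewrite -h2 edge.
have e3 : e w v by rewrite -h3 edge.
have ov : e v o by rewrite -hx head_adj.
have ou : e o u by rewrite -h0; have := tri_adj tx'.
have nt : ~~ is_tri z by rewrite /is_tri l4.
split=> //.
- by have := quad_cycle deg2 l4; rewrite -/z1 -/z2 h0 h1 h2.
- split; apply/negP => c.
    have [||[i1 i2]|[i1 i2]] := facial (x := z) (w := w).
    + by rewrite h0.
    + by [].
    + by rewrite i1 in nt.
    + by rewrite -/x -/o in i2; rewrite i2 eqxx in ow.
  have [||[i1 i2]|[i1 i2]] := facial (x := z) (w := y).
  + by rewrite h0.
  + by rewrite e_sym.
  + by rewrite i1 in nt.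
  + by rewrite -/x -/o in i2; rewrite i2 eqxx in oy.
Qed.

(** A vertex of degree two has a corner in the face of KV. *)
Lemma no_quad_deg2 x : s (s x) = x -> len x = 4 -> len (s x) = 4 -> False.
Proof.
by move=> E l1 l2; have [/andP[+ _]|/andP[+ _]] := low2_blank E;
  rewrite /is_tri ?l1 ?l2.
Qed.

Lemma no_tri_tri_quad x : s (s (s x)) = x -> tri x -> tri (s x) -> len (s (s x)) = 4 ->
  False.
Proof.
move=> E /andP[_ n1] /andP[_ n2] l4; have [h|h|/andP[+ _]] := low3_blank E.
- by rewrite h in n1.
- by rewrite h in n2.
- by rewrite /is_tri l4.
Qed.

Lemma ucycle4 u v w q : ucycle e [:: u; v; w; q] ->
  [/\ e u v, e v w, e w q & e q u] /\
  [/\ u != v, v != w, w != q, q != u & (u != w) && (v != q)].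
Proof.
rewrite /ucycle /= !inE !negb_or !andbT => /andP[/and4P[-> -> -> ->]].
by case/and3P=> /and3P[-> -> h] /andP[-> ->] ->; rewrite eq_sym h.
Qed.

(** This and the next two lemmas treat the sides other than the first.  Going
    round the outside of the three faces closes a hexagon; a coincidence of
    vertices produces vertices of degree two or three, and either none of their
    corners is left for the face of KV or KV gets four vertices. *)
Lemma quad_side1 z : tri (a z) -> len z = 4 ->
  ~~ tri (a (phi z)) /\ len (a (phi z)) != 4.
Proof.
move=> tx l4; have := quad_tri tx l4; set o := head _.
set v := t z; set u := t (phi z); set y := t (phi (phi z)); set w := t _.
case=> /ucycle4[[e0 e1 e2 e3] [n0 n1 n2 n3 /andP[n02 n13]]] [nuw nvy] [ov ou] oy ow.
pose x := a z; have Ez1 : phi z = s x by rewrite /x phiE.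
have hx : head x = v by rewrite head_opp.
have tX : t x = u by rewrite -[t x]/(head z) /u tail_phi.
have d3 := tri_deg3 tx; rewrite -/x in d3.
have ap : head (s^-1%g x) = o by rewrite tri_apex // (triW tx).
pose d := a (phi z).
have td : t d = y by rewrite -[t d]/(head (phi z)) -tail_phi.
have hd : head d = u by rewrite head_opp.
have pd : phi d = s (s x) by rewrite /d phi_opp Ez1.
have tpd : t (s (s x)) = u by rewrite !tail_rot.
pose p := head (s (s x)).
have up : e u p by rewrite -tpd edge.
have pv : p != v by rewrite -hx; apply: head_neq => //; rewrite !tail_rot.
have yp : y != p.
  by have := nonbacktrack deg2 d; rewrite pd td eq_sym.
split.
  apply/negP => t2; have t2' := triW t2.
  have py : e p y by rewrite -td /p -pd tri_adj.
  have [po|po] := eqVneq p o.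
    have E3 : s (s (s x)) = x.
      apply: (@perm_inj _ s^-1%g); rewrite permK; apply: head_inj.
        by rewrite tail_rotV !tail_rot.
      by rewrite ap.
    apply: (@no_tri_tri_quad (s (s x))).
    - by rewrite E3.
    - by rewrite -pd tri_phi'.
    - by rewrite E3.
    - by rewrite E3 -Ez1 len_phi.
  have pw : p != w by apply: contra nuw => /eqP <-.
  apply: (noC6 (c := [:: o; v; w; y; p; u])) => //.
  have up' := adj_neq e_irr up; have ov' := adj_neq e_irr ov.
  by cycle_tac e_irr e_sym.
apply/eqP => l4d.
pose q := head (phi (phi d)).
have pq : e p q by rewrite /p -pd head_adj.
have qy : e q y.
  have := edge (phi (phi (phi d))); rewrite tail_phi -/q.
  have E4 : phi (phi (phi (phi d))) = d by have := iter_len d; rewrite l4d.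
  by rewrite -(tail_phi (phi (phi (phi d)))) E4 td.
have pw : p != w by apply: contra nuw => /eqP <-.
have qv : q != v by apply: contra nvy => /eqP <-.
have qu : q != u.
  by have := nonbacktrack deg2 (phi d); rewrite tail_phi hd.
have qw : q != w.
  apply/eqP => qE.
  have E1 : s d = phi (phi z) by rewrite [RHS]phiE.
  have E2 : s^-1%g d = s d.
    apply: head_inj; first by rewrite tail_rotV tail_rot.
    rewrite (@head_rotV _ _ _ d 2 l4d) /= -/q qE E1.
    by rewrite /w tail_phi.
  have E3 : s (s d) = d by rewrite -E2 permKV.
  by apply: (no_quad_deg2 E3) => //; rewrite E1 !len_phi.
apply: (noC6 (c := [:: v; u; p; q; y; w])) => //.
by cycle_tac e_irr e_sym.
Qed.

Lemma quad_side3 z : tri (a z) -> len z = 4 ->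
  ~~ tri (a (phi (phi (phi z)))) /\ len (a (phi (phi (phi z)))) != 4.
Proof.
move=> tx l4; have := quad_tri tx l4; set o := head _.
set v := t z; set u := t (phi z); set y := t (phi (phi z)); set w := t _.
case=> /ucycle4[[e0 e1 e2 e3] [n0 n1 n2 n3 /andP[n02 n13]]] [nuw nvy] [ov ou] oy ow.
pose z3 := phi (phi (phi z)); rewrite -/z3.
have E4 : phi z3 = z by have := iter_len z; rewrite l4.
pose d := a z3.
have Ed : d = s^-1%g z by rewrite -E4 phiE permK.
have td : t d = v by rewrite Ed tail_rotV.
have hd : head d = w by rewrite head_opp.
have sz : s z = phi (a z) by rewrite phi_opp.
have hsz : head (s z) = o by rewrite sz.
have hz : head z = u by rewrite /u tail_phi.
have d3 := tri_deg3h tx; rewrite aK in d3.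
pose p := head (s^-1%g d).
have tp : t (s^-1%g d) = v by rewrite tail_rotV.
have vp : e v p by rewrite -tp edge.
have pu : p != u.
  rewrite -hz; apply: head_neq => //; apply: contra d3 => /eqP E.
  by rewrite -{1}E Ed !permKV.
split.
  apply/negP => t2; have t2' := triW t2.
  have pE : p = head (phi d) by rewrite /p tri_apex.
  have wp : e w p by rewrite -hd pE head_adj.
  have [po|po] := eqVneq p o.
    have E3 : s (s (s z)) = z.
      have : s z = s^-1%g (s^-1%g z).
        apply: head_inj; first by rewrite !tail_rotV tail_rot.
        by rewrite -Ed -/p po hsz.
      by move=> ->; rewrite !permKV.
    apply: (@no_tri_tri_quad (s z)).
    - by rewrite E3.
    - by rewrite sz tri_phi'.
    - have -> : s (s z) = d by rewrite Ed -{2}E3 permK.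
      exact: t2.
    - by rewrite E3.
  have py : p != y by apply: contra nvy => /eqP <-.
  apply: (noC6 (c := [:: o; u; y; w; p; v])) => //.
  have vp' := adj_neq e_irr vp; have wp' := adj_neq e_irr wp.
  by cycle_tac e_irr e_sym.
apply/eqP => l4d.
pose q := head (phi d).
have pE : p = head (phi (phi d)) by rewrite /p (@head_rotV _ _ _ d 2 l4d).
have wq : e w q by rewrite -hd head_adj.
have qp : e q p by rewrite pE -[q]/(head (phi d)) head_adj.
have qv : q != v by have := nonbacktrack deg2 d; rewrite td.
have py : p != y by apply: contra nvy => /eqP <-.
have pw : p != w.
  by rewrite pE; have := nonbacktrack deg2 (phi d); rewrite tail_phi hd.
have qu : q != u by apply: contra nuw => /eqP <-; rewrite e_sym.
have qy : q != y.
  apply/eqP => qE.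
  have E1 : s z3 = phi d by rewrite /d phi_opp.
  have E2 : s^-1%g z3 = s z3.
    apply: head_inj; first by rewrite tail_rotV tail_rot.
    rewrite E1 -/q qE.
    have -> : s^-1%g z3 = a (phi (phi z)) by rewrite /z3 phiE permK.
    by rewrite head_opp.
  have E3 : s (s z3) = z3 by rewrite -E2 permKV.
  apply: (no_quad_deg2 E3); first by rewrite !len_phi.
  by rewrite E1 len_phi.
apply: (noC6 (c := [:: u; v; p; q; w; y])) => //.
by cycle_tac e_irr e_sym.
Qed.

Lemma quad_side2 z : tri (a z) -> len z = 4 ->
  ~~ tri (a (phi (phi z))) /\ len (a (phi (phi z))) != 4.
Proof.
move=> tx l4; have := quad_tri tx l4; set o := head _.
set v := t z; set u := t (phi z); set y := t (phi (phi z)); set w := t _.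
case=> /ucycle4[[e0 e1 e2 e3] [n0 n1 n2 n3 /andP[n02 n13]]] [nuw nvy] [ov ou] oy ow.
pose z1 := phi z; pose z2 := phi z1; pose z3 := phi z2.
rewrite -/z1 -/z2.
have E4 : phi z3 = z by have := iter_len z; rewrite l4.
have hz2 : head z2 = w by rewrite /w -tail_phi.
pose d := a z2.
have td : t d = w by rewrite -[t d]/(head z2).
have hd : head d = y by rewrite head_opp.
have pd : phi d = s z2 by rewrite phi_opp.
pose p := head (phi d).
have yp : e y p by rewrite -hd head_adj.
have pv : p != v by apply: contra nvy => /eqP <-; rewrite e_sym.
have pw : p != w by have := nonbacktrack deg2 d; rewrite td.
have Ev : s^-1%g z2 = a z1 by rewrite /z2 phiE permK.
have nt1 : ~~ is_tri z1 by rewrite /is_tri len_phi l4.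
have nt3 : ~~ is_tri z3 by rewrite /is_tri !len_phi l4.
have lowy : p = u -> s (s z2) = z2.
  move=> pE; have E2 : s z2 = s^-1%g z2.
    apply: head_inj; first by rewrite tail_rotV tail_rot.
    by rewrite -pd -/p pE Ev head_opp.
  by rewrite E2 permKV.
split.
  apply/negP => t2; have t2' := triW t2.
  have wp : e p w by rewrite -td tri_adj.
  have pu : p != u.
    apply/eqP => /lowy; have := tri_deg3 (x := s z2).
    rewrite -pd tri_phi' t2 pd => /(_ isT) + E; by rewrite E eqxx.
  have [po|po] := eqVneq p o; last first.
    apply: (noC6 (c := [:: o; u; y; p; w; v])) => //.
    have yp' := adj_neq e_irr yp.
    by cycle_tac e_irr e_sym.
  (* the apexes coincide: u, v, y and o would all belong to KV *)
  have [||[i1 i2]|[i1 i2]] := facial (x := z1) (w := o).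
  + by rewrite -tail_phi -/z2 -po.
  + exact: ou.
  + by rewrite i1 in nt1.
  have [||[j1 j2]|[j1 j2]] := facial (x := z3) (w := o).
  + by rewrite -tail_phi E4.
  + by rewrite -po.
  + by rewrite j1 in nt3.
  pose x := a z; have Ez1 : z1 = s x by rewrite /z1 /x phiE.
  have tx' := triW tx.
  have ap : head (s^-1%g x) = o by rewrite tri_apex // (triW tx).
  have Eu : s (s (s x)) = x.
    apply: (@perm_inj _ s^-1%g); rewrite permK; apply: head_inj.
      by rewrite tail_rotV !tail_rot.
    by rewrite ap -Ez1 -phi_opp.
  have Ezv : s^-1%g z = a z3 by rewrite -E4 phiE permK.
  have Evv : s (s (s z)) = z.
    have : s z = s^-1%g (s^-1%g z).
      apply: head_inj; first by rewrite !tail_rotV tail_rot.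
      by rewrite Ezv tri_apex // j2 -phi_opp.
    by move=> ->; rewrite !permKV.
  have bu : blank (a z1).
    have [h|h|h] := low3_blank Eu.
    - by case/andP: tx => _; rewrite h.
    - by move: h; rewrite /blank -Ez1 (negbTE nt1).
    - by move: h; rewrite -Ez1 -blank_opp.
  have bv : blank (a z3).
    have [h|h|h] := low3_blank Evv.
    - by move: h; rewrite /blank /is_tri l4.
    - by move: h; rewrite -phi_opp blank_phi; case/andP: tx => _ /negbTE ->.
    - by move: h; rewrite -Ezv -{2}Evv permK.
  move: bu; rewrite /blank head_opp i2 -[t (a z1)]/(head z1) => /and4P[_ ky ku ko].
  move: bv; rewrite /blank => /and4P[_ kv _ _].
  rewrite -[t (a z3)]/(head z3) -tail_phi E4 in kv.
  rewrite -tail_phi in ky.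
  have := @KV_no4 y u o v ky ku ko kv; apply/negP; rewrite negbK /= !inE !negb_or.
  by repeat (apply/andP; split); neq_leaf e_irr e_sym.
apply/eqP => l4d.
pose q := head (phi (phi d)).
have pq : e p q by rewrite /p head_adj.
have E4d : phi (phi (phi (phi d))) = d by have := iter_len d; rewrite l4d.
have qw : e q w.
  have := edge (phi (phi (phi d))); rewrite tail_phi -/q.
  by rewrite -(tail_phi (phi (phi (phi d)))) E4d td.
have pu : p != u.
  apply/eqP => /lowy E; apply: (no_quad_deg2 E); first by rewrite !len_phi.
  by rewrite -pd len_phi.
have qu : q != u by apply: contra nuw => /eqP <-.
have qy : q != y by have := nonbacktrack deg2 (phi d); rewrite tail_phi hd.
have qv : q != v.
  apply/eqP => qE.
  have E1 : s d = z3 by rewrite /d -phiE.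
  have E2 : s^-1%g d = s d.
    apply: head_inj; first by rewrite tail_rotV tail_rot.
    by rewrite (@head_rotV _ _ _ d 2 l4d) /= -/q qE E1 -tail_phi E4.
  have E3 : s (s d) = d by rewrite -E2 permKV.
  by apply: (no_quad_deg2 E3) => //; rewrite E1 !len_phi.
apply: (noC6 (c := [:: u; y; p; q; w; v])) => //.
by cycle_tac e_irr e_sym.
Qed.

Lemma tri_rim y : is_tri y -> e (head (s^-1%g y)) (head y).
Proof. by move=> ty; rewrite tri_apex // e_sym head_adj. Qed.

Lemma spoke y z : t y = t z -> e (t y) (head z).
Proof. by move=> ->; exact: edge. Qed.

Lemma fan3 y : tri y -> is_tri (s y) -> is_tri (s (s y)) ->
  uniq [:: head (s^-1%g y); head y; head (s y); head (s (s y))].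
Proof.
move=> t1 t2 t3; have t1' := triW t1.
have n1 := deg2 y; have n2 := tri_deg3 t1.
have n3 : s (s (s y)) != y by apply/eqP => /(tri_wheel3 t1' t2 t3).
have sV u v : (s^-1%g u == v) = (s v == u).
  by rewrite -(inj_eq (@perm_inj _ s)) permKV eq_sym.
rewrite /= !inE !negb_or !andbT !head_neq ?tail_rotV ?tail_rot //.
- by rewrite (inj_eq (@perm_inj _ s)) eq_sym.
- by rewrite eq_sym.
- by rewrite eq_sym.
- by rewrite sV.
- by rewrite sV.
- by rewrite sV.
Qed.

Lemma fan2 y : tri y -> head (s^-1%g y) != head (s y).
Proof.
move=> /tri_deg3 n2; rewrite head_neq ?tail_rotV ?tail_rot //.
by apply: contra n2 => /eqP <-; rewrite permKV.
Qed.

(** A triangle with a quadrilateral behind one side has no triangle behind the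
    side next to it: the outer boundary of the three faces is a hexagon. *)
Lemma quad_no_tri1 y : tri y -> len (a y) = 4 -> ~~ tri (s^-1%g y).
Proof.
move=> ty l4; apply/negP => t2.
have tay : tri (a (a y)) by rewrite aK.
have := quad_tri tay l4; rewrite aK; set o := head _.
set u := t (a y); set v := t (phi (a y)); set Y := t (phi (phi (a y))); set W := t _.
case=> /ucycle4[[e0 e1 e2 e3] [n0 n1 n2 n3 /andP[n02 n13]]] [nvW nuY] [ov ou] oy ow.
have ho : head (s^-1%g y) = o by rewrite tri_apex // triW.
have hY : head (s y) = Y by rewrite /Y tail_phi phi_opp.
have tv : t y = v by rewrite /v phi_opp tail_rot.
have hu : head y = u by [].
pose c := head (s^-1%g (s^-1%g y)).
have co : e c o by rewrite -ho tri_rim // triW.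
have vc : e v c by rewrite -tv spoke // !tail_rotV.
have cu : c != u.
  have := fan2 t2; rewrite permKV; exact.
have cW : c != W by apply: contra nvW => /eqP <-.
have cY : c != Y.
  apply/eqP => E.
  have E2 : s^-1%g (s^-1%g y) = s y.
    by apply: head_inj; rewrite ?tail_rotV ?tail_rot // -/c E -hY.
  have E3 : s (s (s y)) = y by rewrite -E2 !permKV.
  apply: (@no_tri_tri_quad (s^-1%g y)); rewrite ?permKV //.
    by rewrite -[in RHS]E3 permK.
  by rewrite -phi_opp len_phi.
apply: (noC6 (c := [:: c; o; u; W; Y; v])) => //.
have co' := adj_neq e_irr co; have vc' := adj_neq e_irr vc.
have ov' := adj_neq e_irr ov; have ou' := adj_neq e_irr ou.
by cycle_tac e_irr e_sym.
Qed.

(** The same at the other end of the common side. *)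
Lemma quad_no_tri2 y : tri y -> len (a y) = 4 -> ~~ tri (s (s (a y))).
Proof.
move=> ty l4; apply/negP => t2.
have tay : tri (a (a y)) by rewrite aK.
have := quad_tri tay l4; rewrite aK; set o := head _.
set u := t (a y); set v := t (phi (a y)); set Y := t (phi (phi (a y))); set W := t _.
case=> /ucycle4[[e0 e1 e2 e3] [n0 n1 n2 n3 /andP[n02 n13]]] [nvW nuY] [ov ou] oy ow.
pose z := a y; rewrite -/z in t2 l4.
have tsz : tri (s z) by rewrite -tri_opp' aK.
have ho : head (s z) = o by rewrite /o phiE.
have hW : head (s^-1%g z) = W.
  by rewrite (@head_rotV _ _ _ z 2 l4) /= /W -tail_phi.
have hv : head z = v by rewrite /v tail_phi.
pose c := head (s (s z)).
have co : e o c by rewrite -ho; have := tri_rim (triW t2); rewrite permK.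
have uc : e u c by rewrite spoke // !tail_rot.
have cv : c != v.
  by have := fan2 tsz; rewrite permK hv eq_sym.
have cY : c != Y by apply: contra nuY => /eqP <-.
have cW : c != W.
  apply/eqP => E.
  have E2 : s^-1%g z = s (s z).
    by apply: head_inj; rewrite ?tail_rotV ?tail_rot // -/c E -hW.
  have E3 : s (s (s z)) = z by rewrite -E2 !permKV.
  by apply: (@no_tri_tri_quad (s z)); rewrite ?E3.
apply: (noC6 (c := [:: c; o; v; Y; W; u])) => //.
have co' := adj_neq e_irr co; have uc' := adj_neq e_irr uc.
have ov' := adj_neq e_irr ov; have ou' := adj_neq e_irr ou.
by cycle_tac e_irr e_sym.
Qed.

(** The faces that may lie behind a triangle: faces of length five and six have
    been excluded. *)
Lemma tri_across x : tri x -> ~~ tri (a x) -> len (a x) != 4 ->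
  blank (a x) \/ 7 <= len (a x).
Proof.
move=> tx nt l4; have [b|b] := boolP (blank (a x)); [by left|right].
have := tri_not_penta tx; have := no_hexagon (a x); have := len_ge3 deg2 (a x).
move: nt; rewrite /tri b andbT /is_tri => h1 h2 h3 h4.
by move: h1 h2 h3 h4 l4; case: (len (a x)) => [|[|[|[|[|[|[|n]]]]]]].
Qed.

(** At the end of a row of at least two triangles there is no quadrilateral,
    hence a large face or the face of KV. *)
Lemma cluster_next x : tri x -> tri (s x) -> ~~ tri (s (s x)) ->
  blank (s (s x)) \/ 7 <= len (s (s x)).
Proof.
move=> t1 t2 t3; rewrite -blank_opp -len_opp; apply: tri_across => //.
  by rewrite tri_opp'.
by apply/eqP => /(quad_no_tri1 t2); rewrite permK t1.
Qed.

Lemma cluster_prev x : tri x -> tri (s x) -> ~~ tri (s^-1%g x) ->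
  blank (s^-1%g x) \/ 7 <= len (s^-1%g x).
Proof.
move=> t1 t2 t3; have E : a (a (s^-1%g x)) = s^-1%g x by rewrite aK.
have ty : tri (a (s^-1%g x)) by rewrite tri_opp' permKV.
rewrite -E; apply: tri_across; rewrite ?E //.
by apply/eqP => l4; have := quad_no_tri2 ty; rewrite E permKV t2 => /(_ l4).
Qed.

(** The hub with the five outer vertices of four consecutive triangles would be
    a hexagon if these five were distinct. *)
Lemma four_tri x : tri x -> tri (s x) -> tri (s (s x)) -> tri (s (s (s x))) ->
  s (s (s (s x))) = x.
Proof.
move=> t1 t2 t3 t4; apply/eqP/negPn/negP => n4.
have := fan3 t1 (triW t2) (triW t3); have := fan3 t2 (triW t3) (triW t4).
rewrite permK /= !inE !negb_or !andbT.
case/and3P=> /and3P[q1 q2 q3] /andP[q4 q5] q6.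
case/and3P=> /and3P[p1 p2 p3] /andP[p4 p5] p6.
have q0 : head (s^-1%g x) != head (s (s (s x))).
  apply: head_neq; first by rewrite tail_rotV !tail_rot.
  by apply: contra n4 => /eqP <-; rewrite permKV.
have r1 := tri_rim (triW t1); have := tri_rim (triW t2).
have := tri_rim (triW t3); have := tri_rim (triW t4); rewrite !permK => r4 r3 r2.
have s0 : e (t x) (head (s^-1%g x)) by rewrite spoke ?tail_rotV.
have s1 : e (t x) (head x) by rewrite spoke.
have s2 : e (t x) (head (s x)) by rewrite spoke ?tail_rot.
have s3 : e (t x) (head (s (s x))) by rewrite spoke ?tail_rot.
have s4 : e (t x) (head (s (s (s x)))) by rewrite spoke ?tail_rot.
apply: (noC6 (c := [:: t x; head (s^-1%g x); head x; head (s x);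
   head (s (s x)); head (s (s (s x)))])) => //.
by cycle_tac e_irr e_sym.
Qed.

(** Such an edge would make a triangle with the tail of x.  This triangle is a
    face, so that the tail of x has degree three, against [tri_wheel3]. *)
Lemma no_chord x : tri x -> tri (s x) -> ~~ e (head (s^-1%g x)) (head (s x)).
Proof.
move=> t1 t2; apply/negP => c.
have d3 := tri_deg3 t1.
have [||[h1 h2]|[h1 h2]] := facial (x := s^-1%g x) (w := head (s x)) => //.
- by rewrite e_sym spoke // !tail_rotV !tail_rot.
- have E : s^-1%g (s^-1%g x) = s x.
    apply: head_inj; first by rewrite !tail_rotV tail_rot.
    by rewrite (tri_apex h1).
  have Es : s (s (s x)) = x by rewrite -E !permKV.
  apply: (tri_wheel3 (triW t1) (triW t2)) => //.
  by rewrite -E permKV.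
- have := adj_neq e_irr (tri_rim (y := s x) (triW t2)).
  by rewrite permK -h2 phi_opp permKV eqxx.
Qed.

Lemma tri_third x : is_tri x -> a (phi (phi x)) = s^-1%g x.
Proof. by move=> tx; apply: (@perm_inj _ s); rewrite permKV -phiE is_tri3. Qed.

(** The three outer vertices alternate with those of the triangle on a hexagon.
    *)
Lemma not_all_tri x : tri x -> tri (s x) -> tri (s^-1%g x) -> tri (s (phi x)) -> False.
Proof.
move=> t0 tA tC tB; have t0' := triW t0.
have tp : tri (phi x) by rewrite tri_phi'.
have ta : tri (a x) by rewrite tri_opp'.
have := fan3 tC; rewrite permKV => /(_ t0' (triW tA)).
have := fan3 ta; rewrite -!phiE => /(_ (triW tp) (triW tB)).
have tap : tri (a (phi x)) by rewrite tri_opp'.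
have Ec : s (phi (phi x)) = phi (s^-1%g x) by rewrite -(tri_third t0') phi_opp.
have := fan3 tap; rewrite -!phiE Ec !tri_phi => /(_ t0' (triW tC)).
rewrite (tri_apex (triW tap)) phi_opp (tri_apex (triW ta)) phi_opp.
rewrite -(tri_apex (triW tC)) head_opp -[head (a _)]/(t (a (a _))) aK.
rewrite tri_head2 // -(tri_apex t0').
set v := t x; set u := head x; set o := head (s^-1%g x).
set c := head (s^-1%g (s^-1%g x)); set p := head (s x); set b := head (s (phi x)).
rewrite tail_phi -/u => U1 U2 U3.
have e1 : e v p by rewrite spoke // tail_rot.
have e2 : e u p by have := tri_rim (triW tA); rewrite permK.
have e3 : e u b by rewrite spoke // tail_rot tail_phi.
have e4 : e o b by have := tri_rim (triW tB); rewrite permK -tri_apex.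
have e5 : e c o by rewrite tri_rim // triW.
have e6 : e v c by rewrite spoke // !tail_rotV.
move: U1 U2 U3; rewrite /= !inE !negb_or !andbT.
case/and3P=> /and3P[q1 q2 q3] /andP[q4 q5] q6.
case/and3P=> /and3P[p1 p2 p3] /andP[p4 p5] p6.
case/and3P=> /and3P[r1 r2 r3] /andP[r4 r5] r6.
apply: (noC6 (c := [:: v; p; u; b; o; c])) => //.
by cycle_tac e_irr e_sym.
Qed.

Definition run x := [&& tri x, tri (s x) & tri (s (s x))].

(** The triangle at the corner x belongs to three consecutive triangles at the
    tail of x. *)
Definition hub x := tri x && [|| run x, run (s^-1%g x) | run (s^-1%g (s^-1%g x))].

(** Triangles are faces, and the face on the other side of x is already known.
    *)
Lemma no_common x w : is_tri x -> e (head x) w -> e (t x) w -> w != head (s^-1%g x) ->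
  is_tri (a x) /\ head (s x) = w.
Proof.
move=> tx e1 e2 n; have [||[h1 h2]|[h1 h2]] := facial (x := x) (w := w) => //.
- by rewrite e_sym.
- by rewrite -h2 -tri_apex ?eqxx in n.
by rewrite -phi_opp.
Qed.

(** Names in this and the next three lemmas refer to a triangle x with tail v,
    head u and third vertex o: several triangles around it close a hexagon,
    whatever they are, because the outer vertices cannot coincide by [fan3] and
    [no_common]. *)
Lemma tail_fan_next_hexagon x : tri x -> tri (s x) -> tri (s (s x)) -> tri (s (phi x)) -> False.
Proof.
move=> t0 tA tA2 tB; have t0' := triW t0.
have tp : tri (phi x) by rewrite tri_phi'.
have ta : tri (a x) by rewrite tri_opp'.
have := fan3 t0 (triW tA) (triW tA2).
have := fan3 ta; rewrite -!phiE => /(_ (triW tp) (triW tB)).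
rewrite (tri_apex (triW ta)) phi_opp head_opp -(tri_apex t0').
set v := t x; set u := head x; set o := head (s^-1%g x).
set q := head (s (s x)); set p := head (s x); set b := head (s (phi x)).
move=> U1 U2.
have e1 : e v q by rewrite spoke // !tail_rot.
have e2 : e p q by have := tri_rim (triW tA2); rewrite permK.
have e3 : e u p by have := tri_rim (triW tA); rewrite permK.
have e4 : e u b by rewrite spoke // tail_rot tail_phi.
have e5 : e o b by have := tri_rim (triW tB); rewrite permK -tri_apex.
have e6 : e v o by rewrite spoke // tail_rotV.
move: U1 U2; rewrite /= !inE !negb_or !andbT.
case/and3P=> /and3P[q1 q2 q3] /andP[q4 q5] q6.
case/and3P=> /and3P[p1 p2 p3] /andP[p4 p5] p6.
have vu : v != u by exact: tail_neq_head.
have bq : b != q.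
  apply/eqP => E; have [||| _ E'] := no_common t0' (w := q).
  - by rewrite -E.
  - by [].
  - by rewrite eq_sym.
  by move: p6; rewrite /p E' eqxx.
apply: (noC6 (c := [:: v; q; p; u; b; o])) => //.
by cycle_tac e_irr e_sym.
Qed.

Lemma head_fan_prev_hexagon x : tri x -> tri (s x) -> tri (s^-1%g (a x)) -> tri (s^-1%g x) -> False.
Proof.
move=> t0 tA tA2 tC; have t0' := triW t0.
have tp : tri (phi x) by rewrite tri_phi'.
have ta : tri (a x) by rewrite tri_opp'.
have := fan3 tC; rewrite permKV => /(_ t0' (triW tA)).
have := fan3 tA2; rewrite permKV -phiE => /(_ (triW ta) (triW tp)).
rewrite (tri_apex (triW ta)) phi_opp head_opp -(tri_apex t0').
set v := t x; set u := head x; set o := head (s^-1%g x).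
set q := head _; set p := head (s x); set c := head _.
move=> U1 U2.
have e1 : e u q by rewrite spoke // !tail_rotV.
have e2 : e q p by have := tri_rim (triW tA2); rewrite (tri_apex (triW ta)) phi_opp.
have e3 : e v p by rewrite spoke // tail_rot.
have e4 : e v c by rewrite spoke // !tail_rotV.
have e5 : e c o by rewrite tri_rim // triW.
have e6 : e o u by rewrite tri_rim.
move: U1 U2; rewrite /= !inE !negb_or !andbT.
case/and3P=> /and3P[q1 q2 q3] /andP[q4 q5] q6.
case/and3P=> /and3P[p1 p2 p3] /andP[p4 p5] p6.
have vu : v != u by exact: tail_neq_head.
have cq : c != q.
  apply/eqP => E; have [||| _ E'] := no_common t0' (w := c).
  - by rewrite E.
  - by [].
  - by [].
  by move: p3; rewrite -E' eqxx.
apply: (noC6 (c := [:: o; c; v; p; q; u])) => //.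
by cycle_tac e_irr e_sym.
Qed.

Lemma two_fans_hexagon x : tri x -> tri (s x) -> tri (s (s x)) -> tri (s^-1%g (a x)) -> False.
Proof.
move=> t0 tA tA2 tA3; have t0' := triW t0.
have tp : tri (phi x) by rewrite tri_phi'.
have ta : tri (a x) by rewrite tri_opp'.
have := fan3 t0 (triW tA) (triW tA2).
have := fan3 tA3; rewrite permKV -phiE => /(_ (triW ta) (triW tp)).
rewrite (tri_apex (triW ta)) phi_opp head_opp -(tri_apex t0').
set v := t x; set u := head x; set o := head (s^-1%g x).
set q := head (s (s x)); set p := head (s x); set r := head _.
move=> U1 U2.
have e1 : e v q by rewrite spoke // !tail_rot.
have e2 : e p q by have := tri_rim (triW tA2); rewrite permK.
have e3 : e r p by have := tri_rim (triW tA3); rewrite (tri_apex (triW ta)) phi_opp.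
have e4 : e u r by rewrite spoke // !tail_rotV.
have e5 : e o u by rewrite tri_rim.
have e6 : e v o by rewrite spoke // tail_rotV.
move: U1 U2; rewrite /= !inE !negb_or !andbT.
case/and3P=> /and3P[q1 q2 q3] /andP[q4 q5] q6.
case/and3P=> /and3P[p1 p2 p3] /andP[p4 p5] p6.
have vu : v != u by exact: tail_neq_head.
have rq : r != q.
  apply/eqP => E; have [||| _ E'] := no_common t0' (w := q).
  - by rewrite -E.
  - by [].
  - by rewrite eq_sym.
  by move: p6; rewrite /p E' eqxx.
apply: (noC6 (c := [:: v; q; p; r; u; o])) => //.
by cycle_tac e_irr e_sym.
Qed.

Lemma prev_fan_next_hexagon x : tri x -> tri (s^-1%g x) -> tri (s^-1%g (s^-1%g x)) ->
  tri (s (phi x)) -> False.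
Proof.
move=> t0 tC tC2 tB; have t0' := triW t0.
have tp : tri (phi x) by rewrite tri_phi'.
have := fan3 tC2; rewrite !permKV => /(_ (triW tC) t0').
have := fan2 tp; rewrite [in s^-1%g _]phiE permK head_opp.
set v := t x; set u := head x; set o := head (s^-1%g x).
set c := head (s^-1%g (s^-1%g x)); set c2 := head (s^-1%g (s^-1%g (s^-1%g x))); set b := head (s (phi x)).
move=> vb U1.
have e1 : e v c2 by rewrite spoke // !tail_rotV.
have e2 : e c2 c by rewrite tri_rim // triW.
have e3 : e c o by rewrite tri_rim // triW.
have e4 : e o b by have := tri_rim (triW tB); rewrite permK -tri_apex.
have e5 : e u b by rewrite spoke // tail_rot tail_phi.
have e6 : e v c by rewrite spoke // !tail_rotV.
move: U1; rewrite /= !inE !negb_or !andbT.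
case/and3P=> /and3P[q1 q2 q3] /andP[q4 q5] q6.
have bc : b != c.
  apply/eqP => E; have [|||i1 E'] := no_common t0' (w := c).
  - by rewrite -E.
  - by [].
  - by [].
  have Es : s x = s^-1%g (s^-1%g x).
    by apply: head_inj; rewrite ?tail_rotV ?tail_rot // E'.
  apply: (tri_wheel3 (triW tC2)); rewrite !permKV ?triW //.
have bc2 : b != c2.
  apply/eqP => E; have [|||i1 E'] := no_common t0' (w := c2).
  - by rewrite -E.
  - by [].
  - by [].
  have Es : s^-1%g (a x) = s (phi x).
    apply: head_inj; first by rewrite ?tail_rotV ?tail_rot tail_phi.
    by rewrite (tri_apex i1) phi_opp E'.
  have Ew : s (s (s (a x))) = a x by rewrite -phiE -Es permKV.
  by apply: (tri_wheel3 i1 _ _ Ew); rewrite -phiE triW.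
have ou := tri_rim t0'; rewrite -/o -/u in ou.
have vo : e v o by rewrite spoke // tail_rotV.
have uv : e u v by rewrite e_sym spoke.
apply: (noC6 (c := [:: v; c2; c; o; b; u])) => //.
by cycle_tac e_irr e_sym.
Qed.

(** A triangle takes part in at most one run of three triangles: the nine ways
    to belong to runs at both ends of a side all close a hexagon. *)
Lemma hub_once x : hub x -> hub (phi x) -> False.
Proof.
rewrite /hub /run tri_phi' => /andP[t0].
have -> : s^-1%g (phi x) = a x by rewrite phiE permK.
rewrite -/(is_true _) !permKV -!phiE tri_opp' !tri_phi' t0 /= => h1 h2.
case/or3P: h2 => [/andP[tB tB2]|/andP[tA tB]|/and3P[tA2 tA _]]; last first.
- case/or3P: h1 => [/andP[_ tA1]|/andP[tC _]|/and3P[_ tC _]].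
  + exact: (two_fans_hexagon t0 tA tA1).
  + exact: (head_fan_prev_hexagon t0 tA).
  + exact: (head_fan_prev_hexagon t0 tA).
- case/or3P: h1 => [/andP[_ tA1]|/andP[tC _]|/andP[tC2 tC]].
  + exact: (tail_fan_next_hexagon t0 tA).
  + exact: (not_all_tri t0 tA tC).
  + move: tC; rewrite ?t0 ?andbT => tC; exact: (not_all_tri t0 tA tC).
case/or3P: h1 => [/andP[tA tA1]|/andP[tC tA]|/andP[tC2 tC]].
- exact: (tail_fan_next_hexagon t0 tA).
- exact: (not_all_tri t0 tA tC).
move: tC; rewrite ?t0 ?andbT => tC; exact: (prev_fan_next_hexagon t0 tC).
Qed.

(** All corners at the tail of x are triangles; there are four of them by
    [four_tri]. *)
Definition w4 x := [&& tri x, tri (s x), tri (s (s x)) & tri (s (s (s x)))].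
Definition sh x := tri x && tri (s x).
(** An edge x between two triangles which are the only ones of their row at the
    tail of x. *)
Definition iso x := [&& tri x, tri (s x), ~~ tri (s (s x)) & ~~ tri (s^-1%g x)].
(** The vertices that can pay: degree at least five, or in KV and granted extra
    charge. *)
Definition rich x := (t x \in KV) || (4 < deg x).

Lemma w4_iter x : w4 x -> s (s (s (s x))) = x.
Proof. by case/and4P; apply: four_tri. Qed.

Lemma w4_next x : w4 x -> w4 (s x).
Proof.
move=> h; have E := w4_iter h; move: h; rewrite /w4 E.
by case/and4P=> t1 t2 t3 t4; rewrite t1 t2 t3 t4.
Qed.

Lemma w4_rot x : w4 (s x) = w4 x.
Proof.
apply/idP/idP => [h|]; last exact: w4_next.
have E : s (s (s (s x))) = x by apply: (@perm_inj _ s); exact: (w4_iter h).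
by rewrite -E; do 3 apply: w4_next.
Qed.

Lemma w4_deg x : w4 x -> deg x = 4 /\ t x \notin KV.
Proof.
move=> h; have E := w4_iter h.
have nK : t x \notin KV.
  apply/negP => /KV_corner[y [ty by_]].
  have : [&& w4 y & tri y].
    apply: (porbit_ind (P := fun y => [&& w4 y & tri y])) (tail_orbit (esym ty)).
      by rewrite h; case/and4P: h => ->.
    by move=> z /andP[h1 _]; rewrite w4_rot h1; case/and4P: h1.
  by rewrite /tri by_ !andbF.
split=> //; apply/eqP; rewrite eqn_leq deg4 // andbT.
exact: (card_porbit_le _ (_ : iter 4 s x = x)).
Qed.

(** The triangles of a wheel are in a run at its hub, hence in no run at a rim
    vertex. *)
Lemma w4_iso y : w4 (a y) -> iso y.
Proof.
move=> h; have := h; rewrite /w4 => /and4P[t1 t2 t3 t4]; have E := w4_iter h.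
have ty : tri y by rewrite -(aK y) tri_opp'.
have tsy : tri (s y) by rewrite -tri_opp'.
have hubs z : w4 z -> hub z.
  by rewrite /hub /run => /and4P[-> -> -> _].
have hub1 := hubs _ h; have := hubs (s (a y)); rewrite w4_rot => /(_ h) hub2.
rewrite /iso ty tsy /=; apply/andP; split; apply/negP => t5.
  apply: (hub_once hub1); rewrite phi_opp /hub /run tsy permK ty tsy t5.
  by rewrite orbT.
apply: (@hub_once y); last by rewrite phiE.
by rewrite /hub /run ty permKV t5 tsy ty /= orbT.
Qed.

Hypothesis KV_out : KV != set0 -> exists2 x, t x \in KV & head x \notin KV.
Hypothesis no_diamond : forall x, tri x -> tri (a x) ->
  t x \notin KV -> head x \notin KV ->
  head (phi x) \notin KV -> head (phi (a x)) \notin KV ->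
  deg x = 4 -> deg (a x) = 4 -> deg (phi (phi x)) = 4 ->
  deg (phi (phi (a x))) = 4 -> ~~ e (head (phi x)) (head (phi (a x))) -> False.

Lemma two_runs x : tri (s^-1%g x) -> tri x -> tri (s x) -> tri (s (s x)) -> w4 x.
Proof.
move=> t1 t2 t3 t4; have := @four_tri (s^-1%g x); rewrite permKV.
by move=> /(_ t1 t2 t3 t4) E; rewrite /w4 t2 t3 t4 E.
Qed.

Lemma w4_prev x : w4 (s^-1%g x) = w4 x.
Proof. by rewrite -w4_rot permKV. Qed.

(** Otherwise two adjacent triangles of the wheel would form a diamond of four
    vertices of degree four, whose opposite vertices are not adjacent. *)
Lemma w4_rich x : w4 x ->
  [|| rich (a x), rich (a (s x)), rich (a (s (s x))) | rich (a (s (s (s x))))].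
Proof.
move=> w; have [dx nK] := w4_deg w; have E := w4_iter w.
have /and4P[t1 t2 t3 t4] := w.
have poor y : ~~ rich (a y) -> head y \notin KV /\ deg (a y) = 4.
  rewrite /rich negb_or -leqNgt -[t (a y)]/(head y) => /andP[h1 h2]; split=> //.
  by apply/eqP; rewrite eqn_leq h2 deg4.
have [//|/poor[k1 d1]] := boolP (rich (a x)).
have [|/poor[k2 d2]] := boolP (rich (a (s x))); first by rewrite orbT.
have [|/poor[k4 d4]] := boolP (rich (a (s (s (s x))))); first by rewrite !orbT.
exfalso; move: k4 d4.
have Ev : s (s (s x)) = s^-1%g x by rewrite -{2}E permK.
rewrite Ev => k4 d4.
have Ea : head (phi (a x)) = head (s x) by rewrite phi_opp.
have tx : tri (a x) by rewrite tri_opp'.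
apply: (no_diamond t1 tx); rewrite ?Ea -?(tri_apex (triW t1)) //.
- rewrite -[RHS]d4; apply: deg_tail.
  by rewrite tail_phi -(tri_apex (triW t1)).
- by rewrite -[RHS]d2; apply: deg_tail; rewrite tail_phi Ea.
by rewrite no_chord.
Qed.

(** If the triangle KV has its face on both sides of one edge, it has it on both
    sides of all of them, and its vertices have degree two; but some edge leaves
    KV. *)
Lemma blank_one_side x : blank x -> ~~ blank (a x).
Proof.
have step y : blank y -> blank (a y) -> s (s y) = y /\ blank (a (phi y)).
  move=> b1 b2; have /and4P[t1 k1 k2 k3] := b1; have /and4P[t2 _ _ k4] := b2.
  have E : s y = s^-1%g y.
    apply: head_inj; first by rewrite tail_rot tail_rotV.
    rewrite -phi_opp tri_apex //; apply/eqP/negPn/negP => n.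
    have := KV_no4 k1 k2 k3 k4; apply/negP; rewrite negbK /= !inE !negb_or.
    have n1 := tail_neq_head y; have n2 := tail_neq_head (phi y).
    have n3 := tail_neq_head (phi (a y)); have n4 := nonbacktrack deg2 y.
    have n5 := nonbacktrack deg2 (a y).
    rewrite tail_phi head_opp in n3; rewrite -[t (a y)]/(head y) in n5.
    rewrite tail_phi in n2.
    rewrite n1 n2 n3 ![t y == _]eq_sym n4 /= andbT.
    by rewrite ![head y == _]eq_sym ![_ == head (phi (a y))]eq_sym n n5.
  have Es : s (s y) = y by rewrite E permKV.
  split=> //; rewrite blank_opp phiE.
  have -> : s (s (a y)) = a y; last by [].
  have h : head (s (a y)) = head (s^-1%g (a y)).
    by rewrite (tri_apex t2) phi_opp E (tri_apex t1) phiE.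
  have -> : s (a y) = s^-1%g (a y).
    by apply: head_inj; rewrite ?tail_rot ?tail_rotV.
  by rewrite permKV.
move=> b1; apply/negP => b2; have /and4P[tx k1 k2 k3] := b1.
have [|x0 x0K x0N] := KV_out; first by apply/set0Pn; exists (t x).
have only y : blank y -> blank (a y) -> t y = t x0 -> False.
  move=> b3 b4 ty; have [E _] := step y b3 b4.
  have /and4P[_ q1 q2 q3] := b3; have /and4P[_ _ _ q4] := b4.
  have : (x0 == y) || (x0 == s y).
    apply: (porbit_ind (P := fun z => (z == y) || (z == s y))) (tail_orbit ty).
      by rewrite eqxx.
    by move=> z /orP[] /eqP ->; rewrite ?E eqxx ?orbT.
  by case/orP=> /eqP h; move: x0N; rewrite h ?q2 // -phi_opp q4.
have [_ b3] := step x b1 b2.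
have bp : blank (phi x) by rewrite blank_phi.
have [_ b4] := step _ bp b3.
have bpp : blank (phi (phi x)) by rewrite !blank_phi.
have n0 : t x != t x0 by apply/eqP; exact: only.
have n1 : t (phi x) != t x0 by apply/eqP; exact: only.
have n2 : t (phi (phi x)) != t x0 by apply/eqP; exact: only.
have := KV_no4 k1 k2 k3 x0K; apply/negP; rewrite negbK /= !inE !negb_or.
rewrite !tail_phi in n1 n2; rewrite n0 n1 n2 tail_neq_head.
have := tail_neq_head (phi x); rewrite tail_phi => ->.
by rewrite eq_sym nonbacktrack.
Qed.

Lemma iso_shift x : iso x -> ~~ iso (s x) /\ ~~ iso (s (s x)).
Proof.
case/and4P=> t1 t2 t3 t4; rewrite /iso t2 (negbTE t3) /=; split=> //.
Qed.

Lemma low_no_iso x : iso x -> 4 <= deg x.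
Proof.
case/and4P=> t1 t2 t3 t4; rewrite leqNgt; apply/negP => d3.
have n2 := tri_deg3 t1; have := deg2 x; have := iter_deg x.
have n3 : s (s (s x)) != x.
  apply/eqP => E; have [b|b|b] := low3_blank E.
  - by case/andP: t1; rewrite b.
  - by case/andP: t2; rewrite b.
  by apply: (tri_wheel3 (triW t1) (triW t2)) => //; case/andP: b.
have := card_porbit_gt0 s x; rewrite -/(deg x).
move: d3; case: (deg x) => [|[|[|[|//]]]] //= _ _ E; rewrite ?E ?eqxx // in n2 n3 *.
Qed.

Lemma iso_deg4 x : iso x -> deg x = 4 -> ~~ iso (s (s (s x))).
Proof.
case/and4P=> t1 t2 t3 t4 d4; have E : s (s (s (s x))) = x.
  by have := iter_deg x; rewrite d4.
have Ev : s (s (s x)) = s^-1%g x by rewrite -{2}E permK.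
by rewrite /iso Ev (negbTE t4).
Qed.

Lemma iso_deg5 x : iso x -> deg x = 5 -> ~~ iso (s (s (s x))) /\ ~~ iso (s (s (s (s x)))).
Proof.
case/and4P=> t1 t2 t3 t4 d4; have E : s (s (s (s (s x)))) = x.
  by have := iter_deg x; rewrite d4.
have Ev : s (s (s (s x))) = s^-1%g x by rewrite -{2}E permK.
by rewrite /iso Ev (negbTE t4) andbF.
Qed.

Lemma blank_tail_inj : {in blank &, injective t}.
Proof.
move=> y z; rewrite !unfold_in => b1 b2 tyz; apply/eqP/negPn/negP => n.
have /and4P[t1 k1 k2 k3] := b1; have /and4P[t2 _ q2 q3] := b2.
rewrite -tri_apex // in k3; rewrite -tri_apex // in q3.
have in3 v : v \in KV -> v != t y -> v != head y -> v == head (s^-1%g y).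
  move=> vK n1 n2; apply/negPn/negP => n3.
  have := KV_no4 k1 k2 k3 vK; apply/negP; rewrite negbK /= !inE !negb_or.
  rewrite ![_ == v]eq_sym n1 n2 n3 /= !andbT tail_neq_head.
  have := tail_neq_head (s^-1%g y); rewrite tail_rotV => -> /=.
  rewrite eq_sym head_neq ?tail_rotV //; apply/eqP => E.
  by have := deg2 y; rewrite -{1}E permKV eqxx.
have zE : z = s^-1%g y.
  apply: head_inj; first by rewrite tail_rotV.
  apply/eqP; apply: in3 => //; last by apply: head_neq; rewrite // eq_sym.
  by rewrite tyz eq_sym tail_neq_head.
by have := blank_one_side b2; rewrite blank_opp zE permKV => /negP; apply.
Qed.

Lemma card_blank : #|blank| <= 3.
Proof.
rewrite -(card_in_imset blank_tail_inj).
have : #|t @: blank| <= #|KV|.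
  by apply/subset_leq_card/fintype.subsetP => v /imsetP[x /and4P[_ h _ _] ->].
by case: KV_card => ->; rewrite ?cards0 => h; apply: leq_trans h _.
Qed.

Definition low2 := [set v in KV | [exists x, (t x == v) && (deg x == 2)]].

(** The edge that leaves KV starts at a vertex of degree at least three. *)
Lemma card_low2 : #|low2| <= 2.
Proof.
have sub : low2 \subset KV by apply/fintype.subsetP => v; rewrite inE => /andP[].
case: KV_card => [E|E]; first by have := subset_leq_card sub; rewrite E cards0; lia.
have [|x0 x0K x0N] := KV_out; first by rewrite -card_gt0 E.
suff n : t x0 \notin low2.
  have := subset_leq_card (_ : low2 \subset KV :\ t x0).
  rewrite subsetD1 sub n => /(_ isT); have := cardsD1 (t x0) KV; rewrite x0K E; lia.
rewrite inE x0K /=; apply/existsP => -[z /andP[/eqP tz /eqP d2]].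
have [y [ty by_]] := KV_corner x0K.
have E2 : s (s y) = y by have := iter_deg y; rewrite (deg_tail (y := z)) ?d2 // tz.
have : (x0 == y) || (x0 == s y).
  apply: (porbit_ind (P := fun z => (z == y) || (z == s y))) (tail_orbit ty).
    by rewrite eqxx.
  by move=> w /orP[] /eqP ->; rewrite ?E2 eqxx ?orbT.
have /and4P[t1 k1 k2 k3] := by_.
case/orP=> /eqP h; move: x0N; rewrite h ?k2 //.
by rewrite -(rotV_eq E2) tri_apex ?k3.
Qed.

(** Faces that are not triangles to be paid and not quadrilaterals: those that
    can give 1/7 per side. *)
Definition giver x := [|| 6 < len x, len x == 5 | blank x].

Lemma giver_or x : ~~ tri x -> len x != 4 -> giver x.
Proof.
rewrite /giver /tri /is_tri => h1 h2.
have := no_hexagon x; have := len_ge3 deg2 x; move: h1 h2.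
by case: (blank x) => /=; rewrite ?andbF ?orbT // andbT orbF;
  case: (len x) => [|[|[|[|[|[|[|n]]]]]]].
Qed.

Lemma quad_givers z : tri (a z) -> len z = 4 ->
  [/\ giver (a (phi z)), giver (a (phi (phi z))) & giver (a (phi (phi (phi z))))].
Proof.
move=> t4 l4; have [a1 a2] := quad_side1 t4 l4; have [b1 b2] := quad_side2 t4 l4.
by have [c1 c2] := quad_side3 t4 l4; split; apply: giver_or.
Qed.

(** The row of two triangles is continued on both sides by large faces. *)
Lemma poor_iso x : iso x -> ~~ rich x -> (6 < len (s (s x))) && (6 < len (a (s (s x)))).
Proof.
case/and4P=> t1 t2 t3 t4; rewrite /rich negb_or -leqNgt => /andP[nK d4].
have dx : deg x = 4 by apply/eqP; rewrite eqn_leq d4 deg4.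
have E : s (s (s (s x))) = x by have := iter_deg x; rewrite dx.
have Ev : s (s (s x)) = s^-1%g x by rewrite -{2}E permK.
rewrite len_opp Ev; apply/andP; split.
  have [/and4P[_ h _ _]|//] := cluster_next t1 t2 t3.
  by rewrite !tail_rot (negbTE nK) in h.
have [/and4P[_ h _ _]|//] := cluster_prev t1 t2 t4.
by rewrite tail_rotV (negbTE nK) in h.
Qed.

Local Open Scope ring_scope.
Variable K : realFieldType.
Let q (b : bool) : K := if b then 1 else 0.

Let q_ge0 b : 0 <= q b. Proof. by case: b => /=; lra. Qed.

Lemma sum_q (A : {pred D}) : \sum_(x : D) q (x \in A) = #|A|%:R.
Proof. by rewrite /q -big_mkcond /= sumr_const. Qed.

Lemma sum_tail_le (W : {set V}) :
  \sum_(x : D) q (t x \in W) * (deg x)%:R^-1 <= #|W|%:R :> K.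
Proof.
rewrite (partition_big t xpredT) //=.
have -> : #|W|%:R = \sum_(v : V) q (v \in W).
  by rewrite /q -big_mkcond /= sumr_const.
apply: ler_sum => v _; case: (pickP (fun x : D => t x == v)) => [x0 /eqP tx0|no]; last first.
  by rewrite big_pred0 //; exact: q_ge0.
rewrite (eq_bigr (fun=> q (v \in W) * (deg x0)%:R^-1)); last first.
  by move=> x /eqP tx; rewrite tx (deg_tail (y := x0)) // tx.
rewrite sumr_const.
have -> : #|[pred x : D | t x == v]| = deg x0.
  apply: eq_card => x; rewrite !inE -tx0; apply/eqP/idP => [h|].
    exact: tail_orbit.
  move=> xo; apply/eqP; move: x xo; apply: porbit_ind => // x.
  by rewrite tail_rot.
rewrite -[X in X <= _]mulr_natr -mulrA mulVf ?mulr1 //.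
by rewrite pnatr_eq0 -lt0n card_porbit_gt0.
Qed.

(** One unit of charge for each vertex of KV and a second one for those of
    degree two; at most five in all, see [sum_bonus]. *)
Let bonus x : K := q (t x \in KV) * (deg x)%:R^-1 + q (t x \in low2) * (deg x)%:R^-1.

Lemma sum_bonus : \sum_(x : D) bonus x <= 5.
Proof.
rewrite big_split /=; have := sum_tail_le KV; have := sum_tail_le low2.
have h1 : #|low2|%:R <= 2 :> K by rewrite ler_nat card_low2.
have h2 : #|KV|%:R <= 3 :> K.
  by rewrite ler_nat; case: KV_card => ->; rewrite ?cards0.
lra.
Qed.

(** An isolated edge between two triangles costs its vertex at most one unit.
    Around a vertex two such edges are at distance at least three, so that there
    is at most one at degrees four and five, and there is none below four; a
    vertex of degree d >= 4 owns d - 4, and one more unit if it is in KV. *)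
Lemma sum_iso : \sum_(x : D) q (rich x && iso x) <=
  \sum_(x : D) (1 - 4 * (deg x)%:R^-1 + bonus x).
Proof.
pose c x : K := 1 - 4 * (deg x)%:R^-1 + bonus x.
have rs x : rich (s x) = rich x by rewrite /rich tail_rot deg_rot.
have cs x : c (s x) = c x by rewrite /c /bonus tail_rot deg_rot.
have c0 x : 0 <= c x.
  rewrite /c /bonus; have [d4|d4] := leqP 4 (deg x).
    have := @nat_inv_le K 4 (deg x); rewrite d4 => /(_ isT).
    have d0 : 0 <= (deg x)%:R^-1 :> K by rewrite invr_ge0 ler0n.
    have := mulr_ge0 (q_ge0 (t x \in KV)) d0.
    have := mulr_ge0 (q_ge0 (t x \in low2)) d0; lra.
  have tK : t x \in KV by apply/negPn/negP => /deg4; rewrite leqNgt d4.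
  have : (t x \in low2) = (deg x == 2)%N.
    rewrite inE tK /=; apply/existsP/eqP => [[y /andP[/eqP ty /eqP <-]]|dx].
      exact: deg_tail.
    by exists x; rewrite eqxx dx eqxx.
  rewrite tK => ->; have := deg2 x; have := iter_deg x.
  have := card_porbit_gt0 s x; rewrite -/(deg x) /q.
  move: d4; case: (deg x) => [|[|[|[|//]]]] //= _ _ E; rewrite ?E ?eqxx // => _; lra.
pose dk k x := (deg x == k)%N.
have part x : q (rich x && iso x) - c x =
   (if dk 4 x then q (rich x && iso x) - c x else 0) +
   (if dk 5 x then q (rich x && iso x) - c x else 0) +
   (if ~~ dk 4 x && ~~ dk 5 x then q (rich x && iso x) - c x else 0).
  by rewrite /dk; case: eqP => [->|] /=; [lra|case: eqP => /=; lra].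
suff : \sum_(x : D) (q (rich x && iso x) - c x) <= 0 by rewrite sumrB; lra.
rewrite (eq_bigr _ (fun x _ => part x)) !big_split /=.
have dks k x : dk k (s x) = dk k x by rewrite /dk deg_rot.
have low x : 0 <= q (t x \in low2) * (deg x)%:R^-1.
  by apply: mulr_ge0; rewrite ?q_ge0 // invr_ge0 ler0n.
have lowK x : 0 <= q (t x \in KV) * (deg x)%:R^-1.
  by apply: mulr_ge0; rewrite ?q_ge0 // invr_ge0 ler0n.
have c4 x : rich x -> deg x = 4 -> 1 / 4 <= c x.
  have := low x; rewrite /rich /c /bonus => + + d4; rewrite d4 /= orbF => + tK.
  by rewrite tK /q; lra.
have c5 x : deg x = 5 -> 1 / 5 <= c x.
  by have := low x; have := lowK x; rewrite /c /bonus => + + d5; rewrite d5; lra.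
have c6 x : (5 < deg x)%N -> 1 / 3 <= c x.
  have := low x; have := lowK x; rewrite /c /bonus => + + d6.
  by have := @nat_inv_le K 6 (deg x); rewrite d6 => /(_ isT); lra.
have ex1 x : iso x && iso (s x) = false.
  by apply/negP => /andP[/iso_shift[/negP h _]] /h.
have ex2 x : iso x && iso (s (s x)) = false.
  by apply/negP => /andP[/iso_shift[_ /negP h]] /h.
have F4 : \sum_(x : D) (if dk 4 x then q (rich x && iso x) - c x else 0) <= 0.
  apply: (@sum_shift_le0 _ _ s _ 4) => // x.
  rewrite !big_ord_recl big_ord0 /= /bump /= ?add1n /= !dks !rs !cs.
  case: ifP => [/eqP d4|_]; last by lra.
  have := c0 x; have := c4 x; case: (rich x) => /= [/(_ isT d4)|_]; last by rewrite /q; lra.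
  have ex3 : iso x && iso (s (s (s x))) = false.
    by apply/negP => /andP[i1]; apply/negP; exact: iso_deg4.
  have := ex1 x; have := ex1 (s x); have := ex1 (s (s x)).
  have := ex2 x; have := ex2 (s x); move: ex3; rewrite /q.
  by case: (iso x); case: (iso (s x)); case: (iso (s (s x))); case: (iso _) => //= *; lra.
have F5 : \sum_(x : D) (if dk 5 x then q (rich x && iso x) - c x else 0) <= 0.
  apply: (@sum_shift_le0 _ _ s _ 5) => // x.
  rewrite !big_ord_recl big_ord0 /= /bump /= ?add1n /= !dks !rs !cs.
  case: ifP => [/eqP d4|_]; last by lra.
  have := c0 x; have := c5 x d4; case: (rich x) => /=; last by rewrite /q; lra.
  have ex3 : iso x && iso (s (s (s x))) = false.
    by apply/negP => /andP[/iso_deg5 /(_ d4)[/negP h _]] /h.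
  have ex4 : iso x && iso (s (s (s (s x)))) = false.
    by apply/negP => /andP[/iso_deg5 /(_ d4)[_ /negP h]] /h.
  have ex3' : iso (s x) && iso (s (s (s (s x)))) = false.
    by apply/negP => /andP[/iso_deg5]; rewrite deg_rot => /(_ d4)[/negP h _] /h.
  have := ex1 x; have := ex1 (s x); have := ex1 (s (s x)); have := ex1 (s (s (s x))).
  have := ex2 x; have := ex2 (s x); have := ex2 (s (s x)); move: ex3 ex4 ex3'; rewrite /q.
  by case: (iso x); case: (iso (s x)); case: (iso (s (s x)));
    case: (iso (s (s (s x)))); case: (iso _) => //= *; lra.
have F6 : \sum_(x : D) (if ~~ dk 4 x && ~~ dk 5 x then q (rich x && iso x) - c x else 0) <= 0.
  apply: (@sum_shift_le0 _ _ s _ 3) => // x.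
  rewrite !big_ord_recl big_ord0 /= /bump /= ?add1n /= !dks !rs !cs.
  case: ifP => [/andP[/eqP n4 /eqP n5]|_]; last by lra.
  have i6 : iso x || iso (s x) || iso (s (s x)) -> 1 / 3 <= c x.
    move=> i; apply: c6; suff : (4 <= deg x)%N by lia.
    by case/orP: i => [/orP[]|] /low_no_iso; rewrite ?deg_rot.
  have := c0 x; have := ex1 x; have := ex1 (s x); have := ex2 x; move: i6; rewrite /q.
  case: (rich x) => /=; last by lra.
  by case: (iso x); case: (iso (s x)); case: (iso (s (s x))) => //=;
    do ?[move/(_ isT)]; lra.
lra.
Qed.

Let L x := (6 < len x)%N.
Let LL x := L x && L (a x).

(** The list of what a side of a face has to give to the face behind it: 3/7 to
    a triangle, 1/7 to a quadrilateral, 3/7 kept for an isolated edge when both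
    faces are large. *)
Lemma face_pay x :
  q (tri (a x) && (L x || blank x)) * (3 / 7) + q ((len (a x) == 4) && giver x) * (1 / 7)
    + q (LL x) * (3 / 7) - q (tri x) / 3
  <= 1 - 4 * (len x)%:R^-1 + q (blank x) * (16 / 21).
Proof.
have b3 : blank x -> len x = 3 by case/and4P=> /eqP.
have ta3 : tri (a x) -> len (a x) = 3 by case/andP=> /eqP.
rewrite /giver /LL /L /tri /is_tri; case bx: (blank x).
  rewrite b3 //= ?andbF ?orbT /= ?andbF ?andbT.
  move: ta3; rewrite /tri /is_tri.
  case: eqP => [-> _|_ _] /=; first by case: (blank (a x)); rewrite /q /=; lra.
  by case: eqP => _; rewrite /q /=; lra.
rewrite !orbF andbT; case: (leqP 7 (len x)) => [l7|l7].
  have -> : (len x == 3) = false by apply/eqP; lia.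
  have := @nat_inv_le K 7 (len x); rewrite l7 => /(_ isT).
  have : (0 : K) <= (len x)%:R^-1 by rewrite invr_ge0 ler0n.
  case: eqP => [->|_] /=; first by case: (blank (a x)); rewrite /q /=; lra.
  case: eqP => [->|_] /=; first by rewrite /q /=; lra.
  by case: (_ <= _)%N; rewrite /q /=; lra.
have := len_ge3 deg2 x; have := no_hexagon x; move: l7; rewrite ?andbF /=.
case: (len x) => [|[|[|[|[|[|[|//]]]]]]] //= _ _ _; rewrite ?andbF ?andbT /q /=; try lra.
by case: (_ == _); lra.
Qed.

(** A quadrilateral with a triangle behind one side collects 1/7 from behind
    each of the other three. *)
Lemma quad_pay : \sum_(x : D) q (tri x && (len (a x) == 4)%N) * 3 <=
  \sum_(x : D) q ((len (a x) == 4)%N && giver x).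
Proof.
rewrite -(sum_inv (fun x => q (tri x && (len (a x) == 4)%N) * 3) aK).
rewrite -(sum_inv (fun x => q ((len (a x) == 4)%N && giver x)) aK).
have -> : \sum_(x : D) q (tri (a x) && (len (a (a x)) == 4)%N) * 3 =
  \sum_(x : D) q ((len x == 4)%N && tri (a x)) * 3.
  by apply: eq_bigr => x _; rewrite aK andbC.
have -> : \sum_(x : D) q ((len (a (a x)) == 4)%N && giver (a x)) =
  \sum_(x : D) q ((len x == 4)%N && giver (a x)).
  by apply: eq_bigr => x _; rewrite aK.
suff : \sum_(x : D) (q ((len x == 4)%N && tri (a x)) * 3 -
   q ((len x == 4)%N && giver (a x))) <= 0 by rewrite sumrB; lra.
apply: (@sum_shift_le0 _ _ phi _ 4) => // x.
rewrite !big_ord_recl big_ord0 /= /bump /= ?add1n /= !len_phi.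
case: eqP => l4 /=; last by rewrite /q; lra.
have E4 : phi (phi (phi (phi x))) = x by have := iter_len x; rewrite l4.
have H y : len y = 4%N -> tri (a y) ->
  [/\ ~~ tri (a (phi y)), ~~ tri (a (phi (phi y))) & ~~ tri (a (phi (phi (phi y))))]
  /\ [&& giver (a (phi y)), giver (a (phi (phi y))) & giver (a (phi (phi (phi y))))].
  move=> l t0; have [-> -> ->] := quad_givers t0 l.
  by have [-> _] := quad_side1 t0 l; have [-> _] := quad_side2 t0 l;
    have [-> _] := quad_side3 t0 l.
have := H x l4; have := H (phi x); have := H (phi (phi x)).
have := H (phi (phi (phi x))); rewrite !len_phi E4 {H}.
move=> /(_ l4) h3 /(_ l4) h2 /(_ l4) h1 h0; move: h0 h1 h2 h3; rewrite /q.
case: (tri (a x)) => [/(_ isT)[[/negbTE -> /negbTE -> /negbTE ->] /and3P[-> -> ->]]|_].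
  by move=> *; case: (giver _); lra.
case: (tri (a (phi x))) => [/(_ isT)[[/negbTE -> /negbTE -> _] /and3P[-> -> ->]]|_].
  by move=> *; case: (giver _); lra.
case: (tri (a (phi (phi x)))) => [/(_ isT)[[/negbTE -> _ _] /and3P[-> -> ->]]|_].
  by move=> *; case: (giver _); lra.
case: (tri (a (phi (phi (phi x))))) => [/(_ isT)[_ /and3P[-> -> ->]]|_].
  by case: (giver _); lra.
by case: (giver _); case: (giver _); case: (giver _); case: (giver _); lra.
Qed.

Lemma hub_pay : \sum_(x : D) q (hub x) * 3 <= \sum_(x : D) q (tri x).
Proof.
suff : \sum_(x : D) (q (hub x) * 3 - q (tri x)) <= 0 by rewrite sumrB; lra.
apply: (@sum_shift_le0 _ _ phi _ 3) => // x.
rewrite !big_ord_recl big_ord0 /= /bump /= ?add1n /= !tri_phi'.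
have ht y : hub y -> tri y by case/andP.
have := @ht x; have := @ht (phi x); have := @ht (phi (phi x)); rewrite !tri_phi'.
have := @hub_once x; have := @hub_once (phi x); have := @hub_once (phi (phi x)).
case tx : (tri x); last first.
  case: (hub x); case: (hub (phi x)); case: (hub _) => _ _ _ h1 h2 h3;
    try (by have := h1 isT); try (by have := h2 isT); try (by have := h3 isT).
  by rewrite /q; lra.
rewrite is_tri3 ?triW //.
case: (hub x); case: (hub (phi x)); case: (hub _) => h1 h2 h3 _ _ _;
  try (by case: (h1 isT isT)); try (by case: (h2 isT isT)); try (by case: (h3 isT isT));
  by rewrite /q; lra.
Qed.

(** Runs of three triangles have two inner edges and three hub corners; in a
    wheel of four the four rotated runs overlap, which is corrected by the terms
    in [w4]. *)
Lemma run_pay x :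
  q (run x) + q (run (s^-1%g x)) + q (run (s^-1%g (s^-1%g x))) - q (w4 x) * 2 <= q (hub x) /\
  q (sh x) <= q (iso x) + q (run x) + q (run (s^-1%g x)) - q (w4 x).
Proof.
have w1 := @two_runs x; have := @two_runs (s^-1%g x); rewrite w4_prev permKV => w2.
have w3 : w4 x -> [&& tri x, tri (s x), tri (s (s x)), tri (s^-1%g x) & tri (s^-1%g (s^-1%g x))].
  move=> w; have /and4P[-> -> -> _] := w.
  have wp : w4 (s^-1%g x) by rewrite w4_prev.
  have /and4P[-> _ _ _] := wp.
  by have := wp; rewrite -w4_prev => /and4P[-> _ _ _].
rewrite /hub /sh /iso /run !permKV; move: w1 w2 w3; rewrite /q.
case: (w4 x) => [_ _ /(_ isT)/and5P[-> -> -> -> ->] /=|]; first by split; lra.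
case: (tri (s^-1%g (s^-1%g x))); case: (tri (s^-1%g x)); case: (tri x); case: (tri (s x));
 case: (tri (s (s x))) => //= w1 w2 _;
  try (by have := w1 isT isT isT isT); try (by have := w2 isT isT isT isT); split; lra.
Qed.

Lemma w4_pay : \sum_(x : D) q (w4 x) <= \sum_(x : D) q (rich x && iso x) * 4.
Proof.
have H : \sum_(x : D) (q (w4 x) - q (w4 x && rich (a x)) * 4) <= 0.
  apply: (@sum_shift_le0 _ _ s _ 4) => // x.
  rewrite !big_ord_recl big_ord0 /= /bump /= ?add1n /= !w4_rot.
  have := @w4_rich x; case: (w4 x) => /=; last by rewrite /q; lra.
  by move/(_ isT); case: (rich _); case: (rich _); case: (rich _); case: (rich _) => //= _;
    rewrite /q; lra.
have E : \sum_(x : D) q (w4 x && rich (a x)) * 4 = \sum_(x : D) q (w4 (a x) && rich x) * 4.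
  rewrite -(sum_inv (fun x => q (w4 x && rich (a x)) * 4) aK).
  by apply: eq_bigr => x _; rewrite aK.
have G : \sum_(x : D) q (w4 (a x) && rich x) * 4 <= \sum_(x : D) q (rich x && iso x) * 4.
  apply: ler_sum => x _; have := @w4_iso x; case: (w4 (a x)) => /=; last first.
    by move=> _; case: (_ && _); rewrite /q; lra.
  by move/(_ isT) => ->; rewrite andbT.
by rewrite sumrB E in H; lra.
Qed.

(** A triangle is short of 1/3 on each of its sides, and takes 3/7 through every
    side behind which there is no triangle: from a face of length at least
    seven, which owns 3/7 per side; from a quadrilateral, the other three sides
    of which are given 1/7 each from behind; or from the face of KV, which is
    granted 3/7 + 1/3 per side.  What a triangle has in excess, 2/21 per side,
    pays for two sides shared with triangles at a vertex with three consecutive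
    triangles, since a triangle takes part in at most one such run.  There
    remain the edges between two triangles that are isolated in this sense, at a
    cost of 3/7 each, and the wheels of four triangles, at a cost of 4/7 each.
    The former are paid for by an edge between two large faces at vertices of
    degree four, and by the vertex itself otherwise; the latter by a rich
    neighbour of the hub, one in KV or of degree at least five.  All this uses
    grants of at most 5 at the vertices of KV and 3 (3/7 + 1/3) at its face,
    less than the 8 of Euler's formula. *)
Lemma no_C6_no_dart : (0 < #|dart M|)%N -> False.
Proof.
move/(@euler_sum _ _ M K) => EU.
have Hf : \sum_(x : D) q (tri (a x) && (L x || blank x)) * (3 / 7) +
   \sum_(x : D) q ((len (a x) == 4)%N && giver x) * (1 / 7) +
   \sum_(x : D) q (LL x) * (3 / 7) - \sum_(x : D) q (tri x) / 3 <=
   \sum_(x : D) (1 - 4 * (len x)%:R^-1) + \sum_(x : D) q (blank x) * (16 / 21).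
  by rewrite -!big_split /= -sumrB; apply: ler_sum => x _; exact: face_pay.
have Hb : \sum_(x : D) q (blank x) <= 3 by rewrite sum_q ler_nat card_blank.
have Ht : \sum_(x : D) q (tri x) - \sum_(x : D) q (sh x) -
    \sum_(x : D) q (tri x && (len (a x) == 4)%N) <=
    \sum_(x : D) q (tri (a x) && (L x || blank x)).
  rewrite -(sum_inv (fun x => q (tri (a x) && (L x || blank x))) aK) -!sumrB.
  apply: ler_sum => x _; rewrite aK /sh -tri_opp'.
  have := @tri_across x; rewrite /L; case: (tri x) => /=; last by rewrite /q; lra.
  move=> /(_ isT); case: (tri (a x)) => /=.
    by case: (_ == _); case: (_ || _); rewrite /q; lra.
  move=> /(_ isT); case: (_ == _) => [_|/(_ isT) [->|->]];
    rewrite ?orbT /q /=; try lra.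
  by case: (_ || _); lra.
have Hq := quad_pay; have Hh := hub_pay; have Hw := w4_pay.
have Hi := sum_iso; have HB := sum_bonus.
have R1 : \sum_(x : D) q (run (s^-1%g x)) = \sum_(x : D) q (run x).
  exact: (sum_perm s^-1%g (fun x => q (run x))).
have R2 : \sum_(x : D) q (run (s^-1%g (s^-1%g x))) = \sum_(x : D) q (run x).
  exact: (sum_iter s^-1%g (fun x => q (run x)) 2).
have H1 : \sum_(x : D) q (run x) * 3 - \sum_(x : D) q (w4 x) * 2 <= \sum_(x : D) q (hub x).
  have H := ler_sum (index_enum D) (fun x (_ : true) => proj1 (run_pay x)).
  rewrite sumrB !big_split /= R1 R2 in H; rewrite -!mulr_suml; rewrite -!mulr_suml in H; lra.
have H2 : \sum_(x : D) q (sh x) <= \sum_(x : D) q (iso x) + \sum_(x : D) q (run x) * 2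
    - \sum_(x : D) q (w4 x).
  have H := ler_sum (index_enum D) (fun x (_ : true) => proj2 (run_pay x)).
  rewrite sumrB !big_split /= R1 in H; rewrite -!mulr_suml; lra.
have H3 : \sum_(x : D) q (iso x) <= \sum_(x : D) q (rich x && iso x) + \sum_(x : D) q (LL x).
  rewrite -(sum_iter s (fun x => q (LL x)) 2) -big_split /=.
  apply: ler_sum => x _.
  have : iso x -> ~~ rich x -> LL (s (s x)) := @poor_iso x.
  case: (iso x); case: (rich x); case: (LL _) => /=;
    try (by move=> _; rewrite /q; lra).
  by move/(_ isT isT).
have EC : \sum_(x : D) ((deg x)%:R^-1 + (len x)%:R^-1 - 2^-1 : K) * (-4) =
   \sum_(x : D) (1 - 4 * (deg x)%:R^-1 : K) + \sum_(x : D) (1 - 4 * (len x)%:R^-1 : K).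
  by rewrite -big_split /=; apply: eq_bigr => x _; lra.
rewrite -mulr_suml in EC; rewrite big_split /= in Hi.
rewrite -!mulr_suml in Hf Hq Hh Hw H1 H2.
lra.
Qed.

End NoC6.

(** * DP-colourings and reducible cycles *)

Section Coloring.
Variables (V : finType) (e : rel V) (m : nat).
Variables (L : list_assignment V m) (Mt : matching_family V m).
Hypothesis e_sym : symmetric e.
Hypothesis e_irr : irreflexive e.
Hypothesis L4 : is_t_list_assignment 4 L.
Hypothesis MtP : is_matching_assignment e L Mt.
Implicit Types (S T : {set V}) (f : {ffun V -> 'I_m}) (u v w : V).

Definition colors S f :=
  [forall (u | u \in S), f u \in L u] &&
  [forall (u | u \in S), forall (v | v \in S), e u v ==> ~~ Mt u v (f u) (f v)].

Definition colorable S := [exists f, colors S f].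

(** The colours still possible for w when S has been coloured by f. *)
Definition free S f w :=
  [set c in L w | [forall (u | u \in S), e u w ==> ~~ Mt u w (f u) c]].

Definition nbrs S w := [set u in S | e w u].

Lemma colorsP S f : reflect
  ((forall u, u \in S -> f u \in L u) /\
   (forall u v, u \in S -> v \in S -> e u v -> ~~ Mt u v (f u) (f v)))
  (colors S f).
Proof.
apply: (iffP andP) => -[h1 h2]; split.
- by move=> u uS; exact: (forall_inP h1).
- move=> u v uS vS uv.
  by have /forall_inP/(_ v vS)/implyP/(_ uv) := forall_inP h2 u uS.
- by apply/forall_inP.
by apply/forall_inP => u uS; apply/forall_inP => v vS; apply/implyP; apply: h2.
Qed.

Lemma freeP S f w c : reflect
  (c \in L w /\ forall u, u \in S -> e u w -> ~~ Mt u w (f u) c) (c \in free S f w).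
Proof.
rewrite inE; apply: (iffP andP) => -[h1 h2]; split=> //.
  by move=> u uS uw; have /implyP := forall_inP h2 u uS; apply.
by apply/forall_inP => u uS; apply/implyP; apply: h2.
Qed.

(** Each coloured neighbour forbids at most one colour, the matchings being
    matchings. *)
Lemma free_size S f w : #|L w| <= #|free S f w| + #|nbrs S w|.
Proof.
have sub : free S f w \subset L w by apply/subsetP => c; rewrite inE => /andP[].
rewrite -(cardsID (free S f w) (L w)).
rewrite (setIidPr sub) leq_add2l.
have bad c : c \in L w :\: free S f w -> exists2 u, u \in nbrs S w & Mt u w (f u) c.
  rewrite !inE => /andP[+ cL]; rewrite cL /= => /forall_inPn[u uS].
  by rewrite negb_imply negbK => /andP[uw h]; exists u => //; rewrite inE uS e_sym.
pose g c := odflt w [pick u in nbrs S w | Mt u w (f u) c].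
have gP c : c \in L w :\: free S f w -> g c \in nbrs S w /\ Mt (g c) w (f (g c)) c.
  rewrite /g; case: pickP => [u /andP[h1 h2] _ //|no /bad[u h1 h2]].
  by have := no u; rewrite h1 h2.
rewrite -(card_in_imset (f := g) (D := mem (L w :\: free S f w))).
  by apply/subset_leq_card/subsetP => u /imsetP[c /gP[h _] ->].
move=> c c' /gP[h1 h2] /gP[h3 h4] E; rewrite -E in h4.
move: h1; rewrite inE e_sym => /andP[_ gw].
by have [_ _ h _] := MtP gw; exact: h h2 h4.
Qed.

Definition upd f v c : {ffun V -> 'I_m} := [ffun z => if z == v then c else f z].

Lemma colors_upd S f v c : colors S f -> v \notin S -> c \in free S f v ->
  colors (v |: S) (upd f v c).
Proof.
move=> /colorsP[h1 h2] vS /freeP[cL h3]; apply/colorsP.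
have ne u : u \in S -> (u == v) = false.
  by move=> uS; apply: contraNF vS => /eqP <-.
split=> [u|u w]; rewrite !inE !ffunE.
  by case: eqP => [->|_] //=; apply: h1.
case/orP=> [/eqP ->|uS] /orP[/eqP ->|wS]; rewrite ?eqxx ?ne //.
- by rewrite e_irr.
- move=> vw; have [-> // _ _ _] := MtP vw.
  by apply: h3 => //; rewrite e_sym.
- by move=> uv; apply: h3.
exact: h2.
Qed.

Lemma free_upd S f v c w : v \notin S ->
  [set d in free S f w | e v w ==> ~~ Mt v w c d] \subset free (v |: S) (upd f v c) w.
Proof.
move=> vS; apply/subsetP => d; rewrite !inE => /andP[/andP[-> /forall_inP h1] /implyP h2] /=.
apply/forall_inP => u; rewrite !inE ffunE; case: eqP => [-> _|_ /= uS].
  by apply/implyP.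
exact: h1.
Qed.

Lemma free_upd_size S f v c w : v \notin S ->
  #|free S f w| <= #|free (v |: S) (upd f v c) w| + e w v.
Proof.
move=> vS; apply: leq_trans (_ : _ <= #|[set d in free S f w | e v w ==> ~~ Mt v w c d]| + e w v) _;
  last by rewrite leq_add2r subset_leq_card // free_upd.
rewrite -(cardsID [set d | e v w ==> ~~ Mt v w c d] (free S f w)).
apply: leq_add; first by apply/subset_leq_card/subsetP => d; rewrite !inE.
rewrite [e w v]e_sym; case vw: (e v w); last first.
  by rewrite /= leqn0 cards_eq0; apply/eqP/setP => d; rewrite !inE.
apply/card_le1_eqP => d d'; rewrite !inE /= !negbK => /andP[h1 _] /andP[h2 _].
by have [_ _ h _] := MtP vw; first [exact: h h1 h2 | exact: h h2 h1].
Qed.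

(** If v has more free colours than k and w has exactly k, the matching between
    them cannot cover the free colours of v. *)
Lemma save S f v w k : v \notin S -> e v w -> k < #|free S f v| -> k <= #|free S f w| ->
  exists2 c, c \in free S f v & k <= #|free (v |: S) (upd f v c) w|.
Proof.
move=> vS vw kv; rewrite leq_eqVlt => /orP[/eqP kw|kw]; last first.
  have /card_gt0P[c cv] : 0 < #|free S f v| by lia.
  by exists c => //; have := free_upd_size f c w vS; rewrite e_sym vw; lia.
have [c cv h] : exists2 c, c \in free S f v & forall d, d \in free S f w -> ~~ Mt v w c d.
  have [/existsP[c /andP[cv /forall_inP h]]|no] :=
    boolP [exists c, (c \in free S f v) && [forall (d | d \in free S f w), ~~ Mt v w c d]].
    by exists c.
  move: kv; rewrite ltnNge kw => /negP[].
  have H c : c \in free S f v -> exists2 d, d \in free S f w & Mt v w c d.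
    move=> cv; move/existsPn: no => /(_ c); rewrite cv /= => /forall_inPn[d dw].
    by rewrite negbK; exists d.
  pose g c := odflt c [pick d in free S f w | Mt v w c d].
  have gP c : c \in free S f v -> g c \in free S f w /\ Mt v w c (g c).
    rewrite /g; case: pickP => [d /andP[]// |no' /H[d h1 h2]].
    by have := no' d; rewrite h1 h2.
  rewrite -(card_in_imset (f := g) (D := mem (free S f v))).
    by apply/subset_leq_card/subsetP => d /imsetP[c /gP[h _] ->].
  move=> c c' /gP[_ h2] /gP[_ h4] E; rewrite -E in h4.
  by have [_ _ _ h] := MtP vw; exact: h h2 h4.
exists c => //; rewrite kw subset_leq_card //; apply: subset_trans (free_upd f c w vS).
by apply/subsetP => d dw; rewrite inE dw vw /= h.
Qed.

Lemma colorable_upd S f v : colors S f -> v \notin S -> 0 < #|free S f v| ->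
  colorable (v |: S).
Proof.
move=> cf vS /card_gt0P[c cv]; apply/existsP; exists (upd f v c).
exact: colors_upd.
Qed.

Lemma colorable_low S v : v \in S -> #|nbrs S v| <= 3 -> colorable (S :\ v) -> colorable S.
Proof.
move=> vS n3 /existsP[f cf]; rewrite -(setD1K vS).
apply: (colorable_upd cf); first by rewrite !inE eqxx.
have := free_size (S :\ v) f v; have := L4 v.
have : #|nbrs (S :\ v) v| <= #|nbrs S v|.
  by apply/subset_leq_card/subsetP => u; rewrite !inE => /andP[/andP[_ ->]].
lia.
Qed.

(** Each vertex of the path but the last is coloured while its successor is not,
    so it has a free colour left; the last one has one more free colour than
    required by its neighbours. *)
Lemma color_path q w S f : colors S f -> uniq (rcons q w) ->
  {in rcons q w, forall u, u \notin S} -> sorted e (rcons q w) ->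
  {in q, forall u, count (e u) (rcons q w) <= #|free S f u|} ->
  count (e w) (rcons q w) < #|free S f w| ->
  colorable (S :|: [set u in rcons q w]).
Proof.
elim: q S f => [|u q IH] S f cf.
  move=> _ out _ _ lw; rewrite setUC -[[set _ in _]]/[set x in [:: w]] set_seq1.
  by apply: (colorable_upd cf); [apply: out; rewrite inE eqxx | apply: leq_ltn_trans lw].
rewrite rcons_cons; set r := rcons q w => /= /andP[ur uniq_r] out srt le lw.
have uS : u \notin S by apply: out; rewrite inE eqxx.
have /card_gt0P[c cu] : 0 < #|free S f u|.
  apply: leq_trans (le u _); last by rewrite inE eqxx.
  rewrite /= e_irr add0n -has_count; move: srt; rewrite /r.
  by case: (q) => [|x q'] /= /andP[-> _].
have -> : S :|: [set x in u :: r] = (u |: S) :|: [set x in r].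
  by apply/setP => x; rewrite !inE orbA [(x \in S) || _]orbC.
apply: (IH _ (upd f u c)) => //.
- exact: colors_upd.
- move=> x xr; rewrite !inE negb_or; apply/andP; split.
    by apply: contraNneq ur => <-.
  by apply: out; rewrite inE xr orbT.
- exact: path_sorted srt.
- move=> x xq; have := le x; rewrite inE xq orbT => /(_ isT) /= h.
  rewrite -(leq_add2l (e x u)) [X in _ <= X]addnC; apply: leq_trans h _.
  exact: free_upd_size.
rewrite -(ltn_add2l (e w u)) [X in _ < X]addnC; apply: leq_trans lw _.
exact: free_upd_size.
Qed.

(** Each vertex has at least as many free colours as neighbours on the cycle.
    Colour v so that w loses nothing, which is possible since v has more
    neighbours on the cycle than w; then follow the cycle from v away from w. *)
Lemma reducible_cycle S v q w : let c := v :: rcons q w in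
  ucycle e c -> {subset c <= S} -> {in c, forall u, #|nbrs S u| <= 4} ->
  count (e w) c < count (e v) c ->
  colorable (S :\: [set u in c]) -> colorable S.
Proof.
move=> c /andP[cyc uc] cS deg4 lt /existsP[f cf].
set T := S :\: _ in cf.
have big u : u \in c -> count (e u) c <= #|free T f u|.
  move=> ucc; have := free_size T f u; have := L4 u; have := deg4 u ucc.
  have : #|nbrs T u| + count (e u) c <= #|nbrs S u|.
    rewrite -size_filter -(card_uniqP (filter_uniq (e u) uc)).
    rewrite -(cardsID [set x in c] (nbrs S u)) addnC leq_add //; last first.
      by apply/subset_leq_card/subsetP => x; rewrite !inE => /andP[/andP[-> ->]->].
    apply/subset_leq_card/subsetP => x; rewrite mem_filter !inE -/c => /andP[-> xc].
    by rewrite (cS x xc) /=.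
  lia.
have vc : v \in c by rewrite inE eqxx.
have wc : w \in c by rewrite inE mem_rcons inE eqxx orbT.
have vT : v \notin T by rewrite !inE eqxx.
have wv : e w v.
  by move: cyc; rewrite /c /= rcons_path last_rcons => /andP[].
have [d dv kd] := @save T f v w _ vT (etrans (e_sym v w) wv)
  (leq_trans lt (big v vc)) (big w wc).
have := uc; rewrite /c /= => /andP[vr ur].
have eqS : S = (v |: T) :|: [set u in rcons q w].
  apply/setP => x; rewrite !inE; have := cS x; rewrite /c !inE.
  case: (x == v) => /=; first by move=> ->.
  by case: (x \in rcons q w) => /=; [move=> -> | rewrite orbF].
rewrite eqS; apply: (@color_path q w (v |: T) (upd f v d)) => //.
- exact: colors_upd.
- move=> x xr; rewrite !inE xr orbT /= orbF.
  by apply: contraNneq vr => <-.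
- by move: cyc; rewrite /c /= rcons_path => /andP[/path_sorted].
- move=> x xq; have xc : x \in c by rewrite !inE mem_rcons inE xq !orbT.
  rewrite -(leq_add2l (e x v)) [X in _ <= X]addnC; apply: leq_trans (big x xc) _.
  exact: free_upd_size.
by move: kd; rewrite /c /= wv add1n.
Qed.

Lemma colorable0 : 0 < m -> colorable set0.
Proof.
move=> m0; apply/existsP; exists [ffun _ => Ordinal m0].
by apply/colorsP; split=> u; rewrite inE.
Qed.

Lemma colorable_DP : colorable setT -> exists I, is_DP_coloring e L Mt I.
Proof.
case/existsP=> f /colorsP[h1 h2]; exists [set (u, f u) | u : V]; split.
- by apply/subsetP => p /imsetP[u _ ->]; rewrite inE /= h1 ?inE.
- move=> p q /imsetP[u _ ->] /imsetP[v _ ->]; rewrite /cover_adj /=.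
  have [->|uv] /= := eqVneq u v; first by rewrite eqxx e_irr.
  by case euv: (e u v) => //=; apply: h2; rewrite ?inE.
by rewrite card_imset // => u v [].
Qed.

End Coloring.

(** * Reducible cycles in plane graphs *)

Section Reducible.
Variables (V : finType) (e : rel V).
Hypothesis e_sym : symmetric e.
Hypothesis e_irr : irreflexive e.
Implicit Types (S T C : {set V}) (u v w : V).

Definition edges_in S : rel V := fun u v => [&& e u v, u \in S & v \in S].

Lemma edges_in_sym S : symmetric (edges_in S).
Proof. by move=> u v; rewrite /edges_in e_sym [(u \in S) && _]andbC. Qed.

Lemma edges_in_irr S : irreflexive (edges_in S).
Proof. by move=> u; rewrite /edges_in e_irr. Qed.

Lemma edges_in_sub S : subrel (edges_in S) e.
Proof. by move=> u v /and3P[]. Qed.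

Lemma ucycle_sub (e' : rel V) c : subrel e' e -> ucycle e' c -> ucycle e c.
Proof.
move=> sub /andP[h1 h2]; rewrite /ucycle h2 andbT; move: h1; case: c {h2} => //= x c.
exact: sub_path.
Qed.

Lemma no_cycle_edges_in S k : no_cycle e k -> no_cycle (edges_in S) k.
Proof. by move=> h c sc /(ucycle_sub (@edges_in_sub S)); apply: h. Qed.

Definition reducible S := exists v q w, let c := v :: rcons q w in
  [/\ ucycle e c, {subset c <= S}, {in c, forall u, #|nbrs e S u| <= 4} &
      count (e w) c < count (e v) c].

Section Map.
Variables (S : {set V}) (M : plane_map (edges_in S)).
Notation D := (dart M).
Notation s := (rot M).
Notation a := (@opp _ _ M).
Notation t := (@tail _ _ M).
Notation phi := (phi M).
Implicit Types x y z : D.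

Lemma edgeE x : [/\ e (t x) (head x), t x \in S & head x \in S].
Proof. by have /and3P[] := edge x. Qed.

Lemma deg_nbrs x : deg x = #|nbrs e S (t x)|.
Proof.
have [_ tS _] := edgeE x; rewrite degE; apply: eq_card => v.
by rewrite !inE /edges_in tS /= andbC.
Qed.

Lemma nbrs_dart v : v \in S -> 0 < #|nbrs e S v| -> exists x, t x = v.
Proof.
move=> vS /card_gt0P[u]; rewrite inE => /andP[uS vu].
have [|x [h1 h2]] := @edge_dart _ _ M v u; first by rewrite /edges_in vu vS.
by exists x.
Qed.

(** Go round the pentagon v1 ... v5 and through the apex o behind the side v1
    v2.  Chords are excluded by the absence of quadrilaterals, so that v1 has
    three neighbours on this cycle and o two. *)
Lemma pentagon_reducible x : (forall y, 3 < deg y) -> no_cycle e 4 -> len x == 5 ->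
  is_tri (a x) -> [forall (y | y \in porbit phi x), deg y == 4] ->
  deg (phi (phi (a x))) = 4 -> reducible S.
Proof.
move=> deg4 noC4 /eqP l5 ta /forall_inP face4 d4.
have deg2 := deg4_no_leaf deg4.
have cyc := ucycle_sub (@edges_in_sub S) (penta_cycle deg2 l5).
have inS y : head y \in S by have [] := edgeE y.
have fd i : #|nbrs e S (t (iter i phi x))| = 4.
  by rewrite -deg_nbrs; apply/eqP/face4; rewrite porbit_iter.
have := fd 0; have := fd 1; have := fd 2; have := fd 3; have := fd 4.
have E5 : phi (phi (phi (phi (phi x)))) = x by have := iter_len x; rewrite l5.
rewrite /= !tail_phi => d5 d4' d3 d2 d1.
have [_ tS _] := edgeE x.
move: cyc; set v1 := t x; set v2 := head x; set v3 := head (phi x).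
set v4 := head (phi (phi x)); set v5 := head (phi (phi (phi x))).
rewrite deg_nbrs tail_phi in d4; set o := head (phi (a x)) in d4 *.
have o2 : e o v2 by apply: (@edges_in_sub S); have := tri_adj ta.
have o1 : e v1 o by apply: (@edges_in_sub S); have := head_adj (a x); rewrite head_opp.
rewrite /ucycle /= !inE !negb_or !andbT => /andP[/and5P[e1 e2 e3 e4 e5]].
case/and4P=> /and4P[n12 n13 n14 n15] /and3P[n23 n24 n25] /andP[n34 n35] n45.
have no c1 c2 c3 c4 : ucycle e [:: c1; c2; c3; c4] -> False by exact: noC4.
have on3 : o != v3.
  by apply/eqP => E; rewrite E in o1; apply: (no v1 v3 v4 v5); cycle_tac e_irr e_sym.
have on4 : o != v4.
  by apply/eqP => E; rewrite E in o1; apply: (no v1 v2 v3 v4); cycle_tac e_irr e_sym.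
have on5 : o != v5.
  by apply/eqP => E; rewrite E in o2; apply: (no v2 v3 v4 v5); cycle_tac e_irr e_sym.
exists v1, [:: v5; v4; v3; v2], o; split.
- by cycle_tac e_irr e_sym.
- move=> u; rewrite /= !inE => /or4P[/eqP ->|/eqP ->|/eqP ->|/or3P[]/eqP ->];
    rewrite ?tS //; exact: inS.
- move=> u; rewrite /= !inE => /or4P[/eqP ->|/eqP ->|/eqP ->|/or3P[]/eqP ->];
    rewrite ?d1 ?d2 ?d3 ?d4' ?d5 ?d4 //.
have -> : count (e o) (v1 :: rcons [:: v5; v4; v3; v2] o) = 2.
  rewrite /= e_irr o2 [e o v1]e_sym o1.
  have -> : e o v5 = false.
    by apply/negP => E; apply: (no o v5 v1 v2); cycle_tac e_irr e_sym.
  have -> : e o v4 = false.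
    by apply/negP => E; apply: (no o v4 v5 v1); cycle_tac e_irr e_sym.
  have -> : e o v3 = false.
    by apply/negP => E; apply: (no o v3 v2 v1); cycle_tac e_irr e_sym.
  by [].
by rewrite /= e_irr e1 o1 [e v1 v5]e_sym e5; case: (e v1 v4); case: (e v1 v3).
Qed.

(** An end of the common edge has three neighbours on the boundary of the two
    triangles, the vertices opposite to this edge have two. *)
Lemma diamond_reducible (S0 : {set V}) x : S \subset S0 ->
  is_tri x -> is_tri (a x) ->
  ~~ edges_in S (head (phi x)) (head (phi (a x))) ->
  2 < deg x ->
  {in [:: t x; head x; head (phi x); head (phi (a x))], forall u, #|nbrs e S0 u| <= 4} ->
  reducible S0.
Proof.
move=> SS t1 t2 nadj d3 d4.
have [_ tS hS] := edgeE x; have [_ _ bS] := edgeE (phi x).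
have [_ _ dS] := edgeE (phi (a x)).
move: nadj; rewrite /edges_in bS dS !andbT => nadj.
have bd : head (phi x) != head (phi (a x)).
  rewrite eq_sym -[head (phi x)](tri_apex t1) phi_opp head_rot_neq //.
  apply: contraTneq d3 => E; rewrite -leqNgt.
  exact: (card_porbit_le _ (_ : iter 2 s x = x)).
have e1 : e (t x) (head x) by have [] := edgeE x.
have e2 : e (head x) (head (phi x)) by apply: (@edges_in_sub S); exact: head_adj.
have e3 : e (head (phi x)) (t x) by apply: (@edges_in_sub S); exact: tri_adj.
have e4 : e (t x) (head (phi (a x))).
  by apply: (@edges_in_sub S); have := head_adj (a x); rewrite head_opp.
have e5 : e (head (phi (a x))) (head x) by apply: (@edges_in_sub S); have := tri_adj t2.
exists (t x), [:: head (phi (a x)); head x], (head (phi x)); split.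
- by cycle_tac e_irr e_sym.
- move=> u; rewrite !inE => /or4P[] /eqP -> ; exact: (subsetP SS).
- move=> u uc; apply: d4; move: uc; rewrite !inE.
  by case/or4P=> ->; rewrite ?orbT.
rewrite /= !e_irr e1 e4 [e (t x) (head (phi x))]e_sym e3.
by rewrite [e (head (phi x)) (head x)]e_sym e2 (negbTE nadj) /=.
Qed.

End Map.
Section Separation.
Variable S : {set V}.

Definition triangle T := (#|T| == 3) && [forall (u | u \in T), forall (v | v \in T), (u != v) ==> e u v].

(** The pair (T, C): a nonempty set C whose neighbours in S outside of C lie in
    the triangle T, or C is closed when T is empty. *)
Definition piece (p : {set V} * {set V}) :=
  [&& (p.1 == set0) || triangle p.1, p.1 :|: p.2 \subset S, p.2 != set0,
      [disjoint p.1 & p.2]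
    & [forall (c | c \in p.2), forall (u | u \in S), e c u ==> (u \in p.1 :|: p.2)]].

(** Fewest vertices in C first, then an empty T if possible; T has at most three
    vertices, whence the factor. *)
Definition weight (p : {set V} * {set V}) := 4 * #|p.2| + #|p.1|.

Lemma triangleP T : reflect (#|T| = 3 /\ {in T &, forall u v, u != v -> e u v}) (triangle T).
Proof.
apply: (iffP andP) => -[h1 h2]; split.
- exact/eqP.
- by move=> u v uT vT; apply/implyP; have /forall_inP := forall_inP h2 u uT; apply.
- exact/eqP.
by apply/forall_inP => u uT; apply/forall_inP => v vT; apply/implyP; apply: h2.
Qed.

Lemma pieceP T C : reflect
  [/\ T = set0 \/ triangle T, T :|: C \subset S, C != set0, [disjoint T & C]
    & forall c u, c \in C -> u \in S -> e c u -> u \in T :|: C] (piece (T, C)).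
Proof.
apply: (iffP and5P) => /= -[h1 h2 h3 h4 h5]; split=> //.
- by case/orP: h1 => [/eqP|]; [left|right].
- move=> c u cC uS cu; have /forall_inP/(_ u uS)/implyP/(_ cu) // := forall_inP h5 c cC.
- by case: h1 => [->|->]; rewrite ?eqxx ?orbT.
by apply/forall_inP => c cC; apply/forall_inP => u uS; apply/implyP; apply: h5.
Qed.

Variables (T C : {set V}).
Hypothesis TC : piece (T, C).
Hypothesis minTC : forall p, piece p -> weight (T, C) <= weight p.
Hypothesis deg4S : forall v, v \in S -> 3 < #|nbrs e S v|.
Let S' := T :|: C.

Lemma nbrs_piece v : v \in C -> nbrs e S' v = nbrs e S v.
Proof.
have /pieceP[_ sub _ _ cl] := TC; move=> vC; apply/setP => u; rewrite !inE.
case vu: (e v u); rewrite ?andbF ?andbT //; apply/idP/idP => [h|uS].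
  by apply: (subsetP sub); rewrite inE.
by have := cl _ _ vC uS vu; rewrite inE.
Qed.

Lemma card_T : #|T| <= 3.
Proof.
have /pieceP[[->|/triangleP[-> _]] _ _ _ _] := TC; by rewrite ?cards0.
Qed.

Lemma smaller T' C' : piece (T', C') -> C' \proper C -> False.
Proof.
move=> p lt; have := minTC p; have := proper_card lt; rewrite /weight /=.
have /pieceP[[->|/triangleP[-> _]] _ _ _ _] := p; rewrite ?cards0; lia.
Qed.

(** A component of the rest that avoids T would be a smaller piece, cut off by
    the separating triangle.  Since what remains of T is connected, of any two
    components one avoids T; it is all of C only if the triangle is T itself,
    and then the other component is a part of C as well. *)
Lemma piece_connected T' u v : triangle T' -> T' \subset S' ->
  u \in S' :\: T' -> v \in S' :\: T' ->
  connect (fun p q => [&& edges_in S' p q, p \notin T' & q \notin T']) u v.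
Proof.
move=> tT' sT' uS vS; set r := fun _ _ => _; apply/negPn/negP => nuv.
have /triangleP[T3 _] := tT'.
have /pieceP[tT sub C0 dis cl] := TC.
have rs : connect_sym r.
  by apply: sym_connect_sym => p q; rewrite /r edges_in_sym [(p \notin T') && _]andbC.
pose X w := [set z | connect r w z].
have XS w : w \in S' :\: T' -> X w \subset S' :\: T'.
  move=> wS; apply/subsetP => z; rewrite inE => wz.
  have cl' : closed r (S' :\: T').
    apply: intro_closed; first exact: rs.
    by move=> p q /and3P[/and3P[_ _ qS] _ qT] _; rewrite !inE qT -in_setU.
  by rewrite -(closed_connect cl' wz).
have disX : [disjoint X u & X v].
  apply/pred0Pn => -[z /andP[]]; rewrite /= !inE => uz vz; move/negP: nuv; apply.
  by apply: connect_trans uz _; rewrite rs.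
have pX w : w \in S' :\: T' -> [disjoint X w & T] -> piece (T', X w).
  move=> wS dw; have XC z : z \in X w -> (z \in C) && (z \notin T').
    move=> zX; have := subsetP (XS w wS) z zX; rewrite !inE => /andP[-> /orP[zT|->]] //.
    by have := disjointFr dw zX; rewrite zT.
  apply/pieceP; split.
  - by right.
  - apply: subset_trans sub; rewrite subUset sT'; apply/subsetP => z /XC /andP[zC _].
    by rewrite inE zC orbT.
  - by apply/set0Pn; exists w; rewrite inE connect0.
  - rewrite disjoint_sym; apply/pred0P => z /=; apply/negP => /andP[/XC/andP[_ /negP h] zT].
    exact: h.
  move=> c z cX zS cz; have /andP[cC cT] := XC c cX.
  have zS' : z \in S' by apply: cl cz.
  rewrite inE; case zT: (z \in T') => //=.
  move: cX; rewrite !inE => wc; apply: connect_trans wc (connect1 _).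
  by rewrite /r /edges_in cz zS' zT cT inE cC orbT.
have main w1 w2 : w1 \in S' :\: T' -> w2 \in S' :\: T' -> [disjoint X w1 & X w2] ->
    [disjoint X w1 & T] -> False.
  move=> h1 h2 d12 d1; apply: (smaller (pX _ h1 d1)).
  have XC : X w1 \subset C :\: T'.
    apply/subsetP => z zX; have := subsetP (XS _ h1) z zX; rewrite !inE.
    by rewrite (disjointFr d1 zX).
  rewrite properEneq (subset_trans XC) ?subsetDl // andbT; apply/eqP => E.
  rewrite E in XC; have dC : [disjoint C & T'].
    apply/pred0P => z /=; apply/negP => /andP[zC zT].
    by have := subsetP XC z zC; rewrite !inE zT.
  have TT : T' = T.
    apply/eqP; rewrite eqEcard T3 card_T andbT; apply/subsetP => z zT.
    have := subsetP sT' z zT; rewrite inE => /orP[//|zC].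
    by have := disjointFr dC zC; rewrite zT.
  have w2X : w2 \in X w2 by rewrite inE connect0.
  have : w2 \in X w1.
    by rewrite E; move: h2; rewrite TT !inE => /andP[/negbTE ->].
  by rewrite (disjointFl d12 w2X).
have [d|/pred0Pn[z /= /andP[zu zT]]] := boolP [disjoint X u & T].
  exact: (main u v).
have [d|/pred0Pn[z' /= /andP[zv zT']]] := boolP [disjoint X v & T].
  by apply: (main v u) => //; rewrite disjoint_sym.
case: tT => [T0|/triangleP[_ cT]]; first by rewrite T0 inE in zT.
have ne : z != z'.
  by apply/eqP => E; move: zu; rewrite E (disjointFl disX zv).
have : connect r z z'.
  have := subsetP (XS u uS) z zu; have := subsetP (XS v vS) z' zv; rewrite !inE.
  move=> /andP[n1 s1] /andP[n2 s2]; apply: connect1.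
  by rewrite /r /edges_in cT // !inE s1 s2 n1 n2.
move=> c; move/negP: nuv; apply; move: zu zv; rewrite !inE => c1 c2.
by apply: connect_trans c1 (connect_trans c _); rewrite rs.
Qed.

Variable M : plane_map (edges_in S').
Notation D := (dart M).
Notation t := (@tail _ _ M).

Lemma piece_deg4 (x : D) : t x \notin T -> 3 < deg x.
Proof.
have /pieceP[_ sub _ _ _] := TC.
move=> xT; have [_ tS _] := edgeE x; rewrite deg_nbrs nbrs_piece.
  by apply: deg4S; exact: (subsetP sub).
by move: tS; rewrite inE (negbTE xT).
Qed.

Lemma piece_deg2 (x : D) : 1 < deg x.
Proof.
have [xT|/piece_deg4] := boolP (t x \in T); last by lia.
have /pieceP[[T0|/triangleP[T3 cT]] _ _ _ _] := TC; first by rewrite T0 inE in xT.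
rewrite deg_nbrs; have : #|T :\ t x| = 2 by move: T3; rewrite (cardsD1 (t x)) xT; lia.
move=> <-; apply/subset_leq_card/subsetP => v; rewrite !inE => /andP[vx vT].
by rewrite vT cT // eq_sym.
Qed.

Lemma piece_no_leaf : no_leaf M.
Proof.
move=> x; apply: contraTneq (piece_deg2 x) => E; rewrite -leqNgt.
exact: (card_porbit_le _ (_ : iter 1 _ x = x)).
Qed.

Lemma piece_facial (x : D) w : edges_in S' (head x) w -> edges_in S' w (t x) ->
  (is_tri x /\ head (phi M x) = w) \/ (is_tri (opp x) /\ head (phi M (opp x)) = w).
Proof.
move=> e1 e2; apply: (nonseparating_facial piece_no_leaf e1 e2) => y z ny nz.
have [e3 s1 s2] := edgeE x; have /and3P[e4 _ s3] := e1; have /and3P[e5 _ _] := e2.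
have [_ sy _] := edgeE y; have [_ sz _] := edgeE z.
apply: (@piece_connected [set t x; head x; w]); try by rewrite in_setD ?ny ?nz.
- apply/triangleP; split.
    rewrite setUC cardsU1 cards2 !inE negb_or.
    by rewrite (adj_neq e_irr e3) (adj_neq e_irr e5) [w == head x]eq_sym (adj_neq e_irr e4).
  by move=> u v; rewrite !inE => /orP[/orP[]|] /eqP -> /orP[/orP[]|] /eqP ->;
    rewrite ?eqxx // => _; rewrite // e_sym.
by apply/subsetP => u; rewrite !inE => /orP[/orP[]|] /eqP ->; rewrite -in_setU.
Qed.

(** If T is nonempty, some edge leaves it, as otherwise T could be dropped.  The
    vertices of C have all their neighbours in the piece, so their degrees there
    are the degrees in S. *)
Lemma piece_reducible : no_cycle e 6 -> ~ reducible S -> False.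
Proof.
move=> noC6 nored; have /pieceP[tT sub C0 dis cl] := TC.
have card : T = set0 \/ #|T| = 3.
  by case: tT => [|/triangleP[]]; [left|right].
have clique : {in T &, forall u v, u != v -> edges_in S' u v}.
  case: tT => [->|/triangleP[_ cT]] u v; first by rewrite inE.
  by move=> uT vT uv; rewrite /edges_in cT // !inE uT vT.
have out : T != set0 -> exists2 x : D, t x \in T & head x \notin T.
  move=> T0; have [/existsP[x /andP[h1 h2]]|no] := boolP [exists x : D, (t x \in T) && (head x \notin T)].
    by exists x.
  have p : piece (set0, C).
    apply/pieceP; split=> //; [by left| |by rewrite -setI_eq0 set0I|].
      by rewrite set0U; apply: subset_trans sub; exact: subsetUr.
    move=> c u cC uS cu; have := cl c u cC uS cu; rewrite !inE => /orP[uT|//].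
    have [|x [tx hx]] := @edge_dart _ _ M u c.
      by rewrite /edges_in e_sym cu !inE uT cC orbT.
    move/existsPn: no => /(_ x); rewrite tx uT /= negbK /head hx => cT.
    by have := disjointFr dis cT; rewrite cC.
  have := minTC p; rewrite /weight /= cards0; have : 0 < #|T| by rewrite card_gt0.
  by lia.
have dpos : 0 < #|D|.
  have /set0Pn[c cC] := C0; have cS' : c \in S' by rewrite inE cC orbT.
  have [|x _] := @nbrs_dart S' M c cS'.
    rewrite nbrs_piece //; apply: leq_trans (deg4S _); first by [].
    by apply: (subsetP sub).
  by apply/card_gt0P; exists x.
apply: (@no_C6_no_dart _ _ M T piece_no_leaf piece_deg4 piece_facial _ clique card out _ rat dpos).
  exact: no_cycle_edges_in.
move=> x t1 t2 n1 n2 n3 n4 d1 d2 d3 d4 nadj; apply: nored.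
apply: (@diamond_reducible S' M S x sub _ _ nadj).
- by case/andP: t1.
- by case/andP: t2.
- by rewrite d1.
have inC y : t y \notin T -> t y \in C.
  by have [_ + _] := edgeE y; rewrite inE => /orP[->|].
have nb y : t y \notin T -> deg y = 4 -> #|nbrs e S (t y)| <= 4.
  by move=> yT d; rewrite -nbrs_piece ?inC // -deg_nbrs d.
move=> u; rewrite !inE => /or4P[]/eqP ->.
- exact: nb.
- by apply: (nb (opp x)).
- by rewrite -(tail_phi (phi M x)); apply: nb => //; rewrite tail_phi.
- by rewrite -(tail_phi (phi M (opp x))); apply: nb => //; rewrite tail_phi.
Qed.
End Separation.

End Reducible.

(** Every subgraph of a planar graph has a plane map; the case k = 6 takes a
    lightest piece of S. *)
Lemma planar_reducible k (V : finType) (e : rel V) (S : {set V}) :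
  k \in [:: 3; 4; 5; 6] -> symmetric e -> irreflexive e ->
  (forall S', inhabited (plane_map (edges_in e S'))) ->
  no_cycle e k -> S != set0 -> (forall v, v \in S -> 3 < #|nbrs e S v|) ->
  ~ reducible e S -> False.
Proof.
move=> hk e_sym e_irr maps noCk S0 deg4 nored.
have [M] := maps S.
have degM (x : dart M) : 3 < deg x.
  by have [_ tS _] := edgeE x; rewrite deg_nbrs deg4.
have noCr := no_cycle_edges_in (S := S) noCk.
have D0 : 0 < #|dart M|.
  have /set0Pn[v vS] := S0; have [|x _] := nbrs_dart M vS.
    by apply: leq_trans (deg4 v vS).
  by apply/card_gt0P; exists x.
move: hk noCk noCr; rewrite !inE => /or4P[] /eqP -> noCk noCr.
- exact: (no_triangle_no_dart rat degM noCr D0).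
- apply: (no_C4_no_dart rat degM noCr _ D0) => x l5 ta f4 d4; apply: nored.
  exact: (pentagon_reducible e_sym e_irr degM noCk l5 ta f4 d4).
- exact: (no_C5_no_dart rat degM noCr D0).
have pS : piece e S (set0, S).
  apply/pieceP; split=> //; first by left.
  - by rewrite set0U.
  - by rewrite -setI_eq0 set0I.
  by move=> c u _ uS _; rewrite set0U.
case: (arg_minnP (@weight V) pS) => -[T C] TC minTC.
have [M'] := maps (T :|: C).
exact: (piece_reducible e_sym e_irr TC minTC deg4 M' noCk nored).
Qed.

Lemma planar_colorable k (V : finType) (e : rel V) m
    (L : list_assignment V m) (Mt : matching_family V m) (S : {set V}) :
  k \in [:: 3; 4; 5; 6] -> symmetric e -> irreflexive e ->
  (forall S', inhabited (plane_map (edges_in e S'))) ->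
  no_cycle e k -> 0 < m -> is_t_list_assignment 4 L -> is_matching_assignment e L Mt ->
  colorable e L Mt S.
Proof.
move=> hk e_sym e_irr maps noCk m0 L4 MtP.
have [n] := ubnP #|S|; elim: n S => // n IH S; rewrite ltnS => Sn.
have [->|S0] := eqVneq S set0; first exact: colorable0.
have [/existsP[v /andP[vS n3]]|big] := boolP [exists v, (v \in S) && (#|nbrs e S v| <= 3)].
  apply: (colorable_low e_sym e_irr L4 MtP vS n3); apply: IH.
  by apply: leq_trans Sn; rewrite [X in _ < X](cardsD1 v) vS.
have [//|/negP nc] := boolP (colorable e L Mt S).
exfalso; apply: (planar_reducible hk e_sym e_irr maps noCk S0).
  by move=> v vS; move/existsPn: big => /(_ v); rewrite vS -ltnNge.
move=> [v [q [w [cyc cS d4 lt]]]]; apply: nc.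
apply: (reducible_cycle e_sym e_irr L4 MtP cyc cS d4 lt); apply: IH.
apply: leq_trans Sn; apply: proper_card; rewrite properE subsetDl /=.
apply/negP => /subsetP/(_ v); rewrite cS ?inE eqxx //= => /(_ isT).
by [].
Qed.

From mathcomp Require Import all_classical all_reals all_analysis.
Import numFieldNormedType.Exports.

(** * Arcs and pixels *)

Section Curves.
Variable R : realType.
Local Open Scope ring_scope.
Local Open Scope classical_set_scope.
Implicit Types (p q : R * R) (f g : R -> R * R).

(** Distance in the maximum norm. *)
Definition close (d : R) p q := `|p.1 - q.1| < d /\ `|p.2 - q.2| < d.

Lemma close_sym d p q : close d p q -> close d q p.
Proof. by rewrite /close (distrC p.1) (distrC p.2). Qed.

Lemma close_triangle d1 d2 p q r :
  close d1 p q -> close d2 q r -> close (d1 + d2) p r.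
Proof.
move=> [h1 h2] [h3 h4]; split.
  by apply: le_lt_trans (ler_distD q.1 _ _) (ltrD h1 h3).
by apply: le_lt_trans (ler_distD q.2 _ _) (ltrD h2 h4).
Qed.

Lemma close_le d1 d2 p q : d1 <= d2 -> close d1 p q -> close d2 p q.
Proof. by move=> h [h1 h2]; split; apply: lt_le_trans h. Qed.

(** Continuity on a segment without subspace topologies, as the arcs will be cut
    in pieces and reversed. *)
Definition seg_continuous (a b : R) f := forall x, a <= x <= b ->
  forall d, 0 < d -> exists2 r, 0 < r &
    forall y, a <= y <= b -> `|y - x| < r -> close d (f y) (f x).

Lemma within_seg_continuous a b f :
  {within `[a, b], continuous f} -> seg_continuous a b f.
Proof.
move=> /subspace_continuousP fc x xab d d0.
have xI : `[a, b] x by rewrite /= in_itv.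
have := fc x xI (ball (f x) d) (nbhsx_ballx (f x) d d0).
rewrite /nbhs /= /within /= => /nbhs_ballP[r /= r0 rP].
exists r => // y yab yx.
have /= : (f @^-1` ball (f x) d) y.
  by apply: rP; [rewrite /ball /= distrC | rewrite /= in_itv].
by case=> h1 h2; split; rewrite distrC.
Qed.

Lemma seg_continuousW a b c d f : a <= c -> d <= b ->
  seg_continuous a b f -> seg_continuous c d f.
Proof.
move=> ac db fc x /andP[cx xd] e e0.
have [|r r0 rP] := fc x _ e e0; first by apply/andP; split; lra.
by exists r => // y /andP[cy yd] yx; apply: rP => //; apply/andP; split; lra.
Qed.

Lemma seg_continuous_rev f : seg_continuous 0 1 f ->
  seg_continuous 0 1 (fun t => f (1 - t)).
Proof.
move=> fc x /andP[x0 x1] e e0.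
have [|r r0 rP] := fc (1 - x) _ e e0; first by apply/andP; split; lra.
exists r => // y /andP[y0 y1] yx; apply: rP; first by apply/andP; split; lra.
by rewrite distrC; have -> : 1 - x - (1 - y) = y - x by lra.
Qed.

(** Compactness of the segment: a property of points and scales that holds
    locally at all small scales holds everywhere at one scale. *)
Lemma seg_uniform (a b : R) (P : R -> R -> Prop) :
  (forall x, a <= x <= b -> exists2 r, 0 < r & forall d x', 0 < d < r ->
     a <= x' <= b -> `|x' - x| < r -> P d x') ->
  exists2 d, 0 < d & forall x, a <= x <= b -> P d x.
Proof.
move=> H.
have /compact_near_coveringP cov := @segment_compact R a b.
pose Q (d x : R) := a <= x <= b -> P d x.
have : \forall d \near (0 : R)^'+, `[a, b] `<=` Q d.
  apply: cov => x /=; rewrite in_itv /= => xab.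
  have [r r0 rP] := H x xab.
  exists (ball x r, [set d | 0 < d < r]); first split => /=.
  - exact: nbhsx_ballx.
  - near=> d; apply/andP; split; first by near: d; apply: nbhs_right_gt.
    by near: d; apply: nbhs_right_lt.
  case=> x' d [/= xx' dr] x'ab; apply: rP => //.
  by rewrite distrC.
move=> nd.
have : \forall d \near (0 : R)^'+, 0 < d /\ `[a, b] `<=` Q d.
  near=> d; split; first by near: d; apply: nbhs_right_gt.
  by near: d.
case/filter_ex => d [d0 dP]; exists d => // x xab.
by apply: (dP x) => //=; rewrite in_itv.
Unshelve. all: by end_near. Qed.

Lemma seg_unif_continuous a b f : seg_continuous a b f ->
  forall e, 0 < e -> exists2 d, 0 < d & forall x y,
    a <= x <= b -> a <= y <= b -> `|y - x| < d -> close e (f y) (f x).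
Proof.
move=> fc e e0.
pose P d x := forall y, a <= y <= b -> `|y - x| < d -> close e (f y) (f x).
have [x xab|d d0 dP] := @seg_uniform a b P.
  have e20 : 0 < e / 2 by lra.
  have [r r0 rP] := fc x xab _ e20.
  exists (r / 2); first lra.
  move=> d x' /andP[d0 dr] x'ab xx' y yab yx'.
  have -> : e = e / 2 + e / 2 by lra.
  apply: (close_triangle (q := f x)).
    apply: rP => //; apply: le_lt_trans (ler_distD x' _ _) _; lra.
  by apply/close_sym/rP => //; lra.
by exists d => // x y xab yab; apply: dP.
Qed.

Lemma seg_bounded a b f : seg_continuous a b f ->
  exists2 K, 0 < K & forall x, a <= x <= b -> close K (f x) (0, 0).
Proof.
move=> fc.
have [x xab|d d0 dP] := @seg_uniform a b (fun d x => close (1 / d) (f x) (0, 0)).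
  have [r r0 rP] := fc x xab 1 ltr01.
  pose K := `|(f x).1| + `|(f x).2| + 1.
  have K0 : 0 < K.
    by rewrite ltr_wpDl // addr_ge0.
  exists (Num.min r K^-1); first by rewrite lt_min r0 invr_gt0.
  move=> d x' /andP[d0]; rewrite !lt_min => /andP[dr dK] x'ab /andP[xr _].
  have Kd : K <= 1 / d.
    by rewrite div1r -(invrK K) lef_pV2 ?posrE ?invr_gt0 // ltW.
  apply: (close_le Kd).
  have [h1 h2] := rP _ x'ab xr.
  have n1 := normr_ge0 (f x).1; have n2 := normr_ge0 (f x).2.
  split; rewrite /= subr0.
    have := ler_normD ((f x').1 - (f x).1) (f x).1; rewrite subrK /K; lra.
  have := ler_normD ((f x').2 - (f x).2) (f x).2; rewrite subrK /K; lra.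
by exists (1 / d) => //; rewrite div1r invr_gt0.
Qed.

(** Two arcs without common points are at a positive distance. *)
Lemma seg_separated a b c d f g : seg_continuous a b f -> seg_continuous c d g ->
  (forall x y, a <= x <= b -> c <= y <= d -> f x <> g y) ->
  exists2 e, 0 < e & forall x y, a <= x <= b -> c <= y <= d ->
    ~ close e (f x) (g y).
Proof.
move=> fc gc fg.
have H1 x : a <= x <= b ->
    exists2 e, 0 < e & forall y, c <= y <= d -> ~ close e (f x) (g y).
  move=> xab; apply: seg_uniform => y ycd.
  have [m m0 mP] : exists2 m, 0 < m & ~ close m (f x) (g y).
    have ne := fg x y xab ycd.
    case: (eqVneq (f x).1 (g y).1) => [e1|n1].
      have n2 : (f x).2 != (g y).2.
        apply/eqP => e2; apply: ne.
        by rewrite (surjective_pairing (f x)) (surjective_pairing (g y)) e1 e2.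
      exists `|(f x).2 - (g y).2|; first by rewrite normr_gt0 subr_eq0.
      by case=> _; rewrite ltxx.
    exists `|(f x).1 - (g y).1|; first by rewrite normr_gt0 subr_eq0.
    by case; rewrite ltxx.
  have m20 : 0 < m / 2 by lra.
  have [r r0 rP] := gc y ycd _ m20.
  exists (Num.min r (m / 2)); first by rewrite lt_min r0.
  move=> e y'; rewrite !lt_min => /and3P[e0 er em] y'cd /andP[yr _] cl.
  apply: mP; have -> : m = m / 2 + m / 2 by lra.
  apply: (close_triangle (q := g y')); last exact: rP.
  by apply: close_le cl; apply: ltW.
have [x xab|e e0 eP] := @seg_uniform a b (fun e x => forall y, c <= y <= d ->
  ~ close e (f x) (g y)); last first.
  by exists e => // x y xab ycd; apply: eP.
have [m m0 mP] := H1 x xab.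
have m20 : 0 < m / 2 by lra.
have [r r0 rP] := fc x xab _ m20.
exists (Num.min r (m / 2)); first by rewrite lt_min r0.
move=> e x'; rewrite !lt_min => /and3P[e0 er em] x'ab /andP[xr _] y ycd cl.
apply: (mP y) => //; have -> : m = m / 2 + m / 2 by lra.
apply: (close_triangle (q := f x')); first exact/close_sym/rP.
by apply: close_le cl; apply: ltW.
Qed.

Section Pixels.
Variables (K e : R) (n : nat).
Hypotheses (e_gt0 : 0 < e) (n_large : K + K < n.+1%:R * e).

(** The square [-K, K]^2 is cut into cells of side e; truncation is harmless as
    x + K is nonnegative there. *)
Definition pixel_index (x : R) : 'I_n.+1 := inord (Num.truncn ((x + K) / e)).
Definition pixel_of p := (pixel_index p.1, pixel_index p.2).
Definition corner (q : 'I_n.+1 * 'I_n.+1) : R * R :=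
  (q.1%:R * e - K, q.2%:R * e - K).

Lemma pixel_indexP x : `|x| < K ->
  (pixel_index x)%:R * e - K <= x < (pixel_index x).+1%:R * e - K.
Proof.
have e0 := e_gt0; have nK := n_large.
move=> /ltr_normlP[h1 h2].
have xK : 0 <= x + K by lra.
have ge0 : 0 <= (x + K) / e by rewrite divr_ge0 // ltW.
have /andP[t1 t2] := truncn_itv ge0.
rewrite /pixel_index inordK; last first.
  rewrite truncn_lt_nat // ltr_pdivrMr //; apply: lt_trans nK; lra.
rewrite lerBlDr ltrBrDr -ler_pdivlMr // -ltr_pdivrMr //.
by rewrite t1 t2.
Qed.

Lemma pixel_index_le x y : `|x| < K -> `|y| < K -> `|x - y| < e ->
  (pixel_index x <= (pixel_index y).+1)%N.
Proof.
have e0 := e_gt0; have nK := n_large.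
move=> /pixel_indexP/andP[h1 _] /pixel_indexP/andP[_ h2] /ltr_normlP[_ h3].
rewrite -ltnS -(@ltr_nat R) -(@ltr_pM2r _ e) //.
have : (pixel_index y).+2%:R * e = (pixel_index y).+1%:R * e + e.
  by rewrite -[X in X%:R]addn1 natrD mulrDl mul1r.
by move=> ->; lra.
Qed.

Definition near_pixel (q : 'I_n.+1 * 'I_n.+1) p := close (3 * e) p (corner q).

Lemma near_pixel_close z p1 p2 : near_pixel z p1 -> near_pixel z p2 ->
  close (6 * e) p1 p2.
Proof.
have e0 := e_gt0; have nK := n_large.
move=> h1 h2; have -> : 6 * e = 3 * e + 3 * e by lra.
exact: close_triangle h1 (close_sym h2).
Qed.

Lemma pixel_near x : `|x| < K -> `|x - ((pixel_index x)%:R * e - K)| <= e.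
Proof.
have e0 := e_gt0; have nK := n_large.
move=> /pixel_indexP/andP[h1 h2]; rewrite ger0_norm; last lra.
move: h2; rewrite -[X in X%:R * e]addn1 natrD mulrDl mul1r; lra.
Qed.

Lemma pixel_of_near p : close K p (0, 0) -> near_pixel (pixel_of p) p.
Proof.
have e0 := e_gt0; have nK := n_large.
rewrite /close /= !subr0 => -[/pixel_near h1 /pixel_near h2].
by rewrite /near_pixel /close /corner /=; split; lra.
Qed.

Lemma pixel_of_step p q : close K p (0, 0) -> close K q (0, 0) -> close e q p ->
  exists s, [/\ path (@touch n) (pixel_of p) s,
    last (pixel_of p) s = pixel_of q & {in s, forall r, near_pixel r q}].
Proof.
have e0 := e_gt0; have nK := n_large.
rewrite /close /= !subr0 => -[p1 p2] [q1 q2] [d1 d2].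
exists [:: (pixel_index q.1, pixel_index p.2); pixel_of q]; split=> //=.
  rewrite touch_hor ?touch_ver //; try exact: pixel_index_le;
  by apply: pixel_index_le => //; rewrite distrC.
move=> r; rewrite !inE => /orP[/eqP|/eqP] ->; last first.
  by apply: pixel_of_near; rewrite /close /= !subr0.
rewrite /near_pixel /close /corner /=.
split; first by have := pixel_near q1; lra.
have := ler_distD p.2 q.2 ((pixel_index p.2)%:R * e - K).
have := pixel_near p2; lra.
Qed.

(** An arc is followed by a walk that stays near it: sample it finely enough for
    successive points to lie in the same or in adjacent rows and columns. *)
Lemma trace (a b : R) f : a <= b -> seg_continuous a b f ->
  (forall t, a <= t <= b -> close K (f t) (0, 0)) ->
  exists s, [/\ path (@touch n) (pixel_of (f a)) s,
    last (pixel_of (f a)) s = pixel_of (f b)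
    & {in pixel_of (f a) :: s, forall z,
        exists2 t, a <= t <= b & near_pixel z (f t)}].
Proof.
have e0 := e_gt0; have nK := n_large.
move=> ab fc box; have [d d0 dP] := seg_unif_continuous fc e0.
have aab : a <= a <= b by rewrite lexx.
have H m : forall x, a <= x <= b -> x - a <= m%:R * (d / 2) ->
  exists s, [/\ path (@touch n) (pixel_of (f a)) s,
    last (pixel_of (f a)) s = pixel_of (f x)
    & {in pixel_of (f a) :: s, forall z,
        exists2 t, a <= t <= b & near_pixel z (f t)}].
  elim: m => [|m IH] x xab xm.
    exists [::]; have -> : x = a by move: xm xab; rewrite mul0r => ? /andP[]; lra.
    split=> // q; rewrite inE => /eqP ->; exists a => //.
    exact/pixel_of_near/box.
  pose y := Num.max a (x - d / 2).
  have /andP[ax xb] := xab.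
  have yab : a <= y <= b by rewrite /y le_max lexx ge_max ab /=; lra.
  have ym : y - a <= m%:R * (d / 2).
    rewrite /y; case: (leP a (x - d / 2)) => h.
      by move: xm; rewrite -[X in X%:R]addn1 natrD mulrDl mul1r; lra.
    by rewrite subrr mulr_ge0 //; lra.
  have yx : `|x - y| < d.
    rewrite /y; case: (leP a (x - d / 2)) => h; rewrite ger0_norm; lra.
  have [s [s1 s2 s3]] := IH y yab ym.
  have [t [t1 t2 t3]] := pixel_of_step (box _ yab) (box _ xab) (dP _ _ yab xab yx).
  exists (s ++ t); split.
  - by rewrite cat_path s1 s2.
  - by rewrite last_cat s2.
  move=> q; rewrite -cat_cons mem_cat => /orP[|/t3 h]; first exact: s3.
  by exists x.
have [m mP] : exists m : nat, b - a <= m%:R * (d / 2).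
  exists (Num.truncn ((b - a) / (d / 2))).+1.
  rewrite -ler_pdivrMr; last lra.
  by apply/ltW; rewrite truncnS_gt.
by apply: (H m) => //; rewrite ab lexx.
Qed.
End Pixels.

(** Finitely many scales have a common lower bound. *)
Lemma finite_pos (I : finType) (P : I -> R -> Prop) :
  (forall i d d', 0 < d' <= d -> P i d -> P i d') ->
  (forall i, exists2 d, 0 < d & P i d) ->
  exists2 d, 0 < d & forall i, P i d.
Proof.
move=> mono ex.
suff [d d0 dP] : exists2 d, 0 < d & forall i, i \in enum I -> P i d.
  by exists d => // i; apply: dP; rewrite mem_enum.
elim: (enum I) => [|i s [d d0 dP]]; first by exists 1.
have [d' d'0 d'P] := ex i.
have m0 : 0 < Num.min d d' by rewrite lt_min d0.
exists (Num.min d d') => // j; rewrite in_cons => /predU1P[->|js].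
  by apply: mono d'P; rewrite m0 ge_min lexx orbT.
by apply: mono (dP _ js); rewrite m0 ge_min lexx.
Qed.

End Curves.

(** * From a drawing to a plane map *)

Section Drawing.
Variables (R : realType) (V : finType) (e : rel V).
Hypotheses (e_sym : symmetric e) (e_irr : irreflexive e).
Variables (pos : V -> R * R) (curve : V -> V -> set (R * R)).
Hypothesis drawing : plane_drawing e pos curve.
Local Open Scope ring_scope.
Local Open Scope classical_set_scope.

Local Notation lt u v := (enum_rank u < enum_rank v)%N.

Lemma lt_total u v : e u v -> lt u v = ~~ lt v u.
Proof.
move=> uv; rewrite -leqNgt [RHS]leq_eqVlt.
by case: eqP => // /ord_inj /enum_rank_inj E; rewrite E e_irr in uv.
Qed.

Lemma edge_params : exists g : V -> V -> R -> R * R, forall u v, e u v ->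
  [/\ seg_continuous 0 1 (g u v),
      g u v 0 = pos u,
      forall s t : R, 0 <= s <= 1 -> 0 <= t <= 1 -> g u v s = g u v t -> s = t,
      forall t : R, 0 <= t <= 1 -> curve u v (g u v t)
    & forall t, g v u t = g u v (1 - t)].
Proof.
have ex (uv : V * V) : exists f : R -> R * R, e uv.1 uv.2 ->
    [/\ seg_continuous 0 1 f, f 0 = pos uv.1, f 1 = pos uv.2,
     forall s t : R, 0 <= s <= 1 -> 0 <= t <= 1 -> f s = f t -> s = t
     & forall t : R, 0 <= t <= 1 -> curve uv.1 uv.2 (f t)].
  case: (boolP (e uv.1 uv.2)) => [h|_]; last by exists (fun _ => (0, 0)).
  have [f [fc fi f0 f1 fA]] := curve_arc drawing h.
  exists f => _; split=> //; first exact: within_seg_continuous.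
  by move=> t ht; rewrite -fA /=; exists t; rewrite //= in_itv.
have [F FP] := choice ex.
exists (fun u v t => if lt u v then F (u, v) t else F (v, u) (1 - t)) => u v uv.
have vu : e v u by rewrite e_sym.
have lvu := lt_total vu.
have rev (t : R) : 0 <= t <= 1 -> 0 <= 1 - t <= 1 by move=> /andP[? ?]; apply/andP; split; lra.
have [c0 c1 c2 c3 c4] := FP (u, v) uv; have [d0 d1 d2 d3 d4] := FP (v, u) vu.
case: (boolP (lt u v)) lvu => luv lvu; rewrite lvu /=; split=> //.
- exact: seg_continuous_rev.
- by rewrite subr0.
- by move=> s t hs ht /d3 E; have := E (rev _ hs) (rev _ ht); lra.
- by move=> t ht; rewrite (curve_sym drawing uv); apply: d4; apply: rev.
- by move=> t; congr (F _ _); lra.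
Qed.

(** Cut each edge at one third and two thirds.  First thirds of edges at
    different vertices, middle thirds of different edges, and a middle third and
    a first third at a vertex not on that edge are disjoint, hence at distance
    at least r for some r; at a scale of r / 6 the walks following them share no
    pixel. *)
Theorem drawing_plane_map : inhabited (plane_map e).
Proof.
have [g gP] := edge_params.
have g1 u v : e u v -> g u v 1 = pos v.
  move=> uv; have vu : e v u by rewrite e_sym.
  have [_ <- _ _ h] := gP v u vu.
  by have := h 1; rewrite subrr.
have t1 : 0 <= (1 / 3 : R) by lra.
(* where two edges can meet *)
have meet u v x y s t : e u v -> e x y -> 0 <= s <= 1 -> 0 <= t <= 1 ->
    g u v s = g x y t ->
    [\/ [/\ x = u, y = v & t = s], [/\ x = v, y = u & t = 1 - s]
      | exists w, (w = u /\ s = 0 \/ w = v /\ s = 1) /\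
                  (w = x /\ t = 0 \/ w = y /\ t = 1)].
  move=> uv xy hs ht E.
  have [_ p0 inj cu sy] := gP u v uv; have [_ q0 inj' cx _] := gP x y xy.
  have [E1|n1] := pselect ((x, y) = (u, v)).
    case: E1 => xu yv; rewrite xu yv in E; apply: Or31.
    by split=> //; apply/esym/inj.
  have [E2|n2] := pselect ((x, y) = (v, u)).
    case: E2 => xv yu; rewrite xv yu sy in E; apply: Or32; split=> //.
    have := inj _ _ hs _ E; move: ht => /andP[? ?] h.
    by rewrite h; [lra | apply/andP; split; lra].
  have := curve_disjoint drawing uv xy n1 n2 (cu _ hs).
  rewrite E => /(_ (cx _ ht))[w [pw wu wx]]; apply: Or33; exists w.
  have le01 : 0 <= (0 : R) <= 1 by rewrite lexx ler01.
  have le11 : 0 <= (1 : R) <= 1 by rewrite lexx ler01.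
  split.
    case: wu => wE; [left|right]; split=> //; apply: inj => //.
      by rewrite E pw p0 wE.
    by rewrite E pw g1 // wE.
  case: wx => wE; [left|right]; split=> //; apply: inj' => //.
    by rewrite pw q0 wE.
  by rewrite pw g1 // wE.
pose third : R := 1 / 3.
have th : third = 1 / 3 by [].
clearbody third.
have hh u v x y s t : e u v -> e x y -> u <> x ->
    0 <= s <= third -> 0 <= t <= third -> g u v s <> g x y t.
  move=> uv xy ux /andP[s0 s1] /andP[q0 q1] E.
  have hs : 0 <= s <= 1 by apply/andP; split; lra.
  have ht : 0 <= t <= 1 by apply/andP; split; lra.
  case: (meet _ _ _ _ _ _ uv xy hs ht E) => [[h _ _]|[_ _ h]|].
  - by apply: ux.
  - lra.
  - case=> w [[[wu h]|[wv h]] [[wx h']|[wy h']]]; try lra.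
    by apply: ux; rewrite -wu.
have mh u v x y s t : e u v -> e x y -> x <> u -> x <> v ->
    third <= s <= third + third -> 0 <= t <= third -> g u v s <> g x y t.
  move=> uv xy xu xv /andP[s0 s1] /andP[q0 q1] E.
  have hs : 0 <= s <= 1 by apply/andP; split; lra.
  have ht : 0 <= t <= 1 by apply/andP; split; lra.
  case: (meet _ _ _ _ _ _ uv xy hs ht E) => [[h _ _]|[h _ _]|] //.
  by case=> w [[[wu h]|[wv h]] _]; lra.
have mm u v x y s t : e u v -> e x y -> (x, y) <> (u, v) -> (x, y) <> (v, u) ->
    third <= s <= third + third -> third <= t <= third + third ->
    g u v s <> g x y t.
  move=> uv xy n1 n2 /andP[s0 s1] /andP[q0 q1] E.
  have hs : 0 <= s <= 1 by apply/andP; split; lra.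
  have ht : 0 <= t <= 1 by apply/andP; split; lra.
  case: (meet _ _ _ _ _ _ uv xy hs ht E) => [[h1 h2 _]|[h1 h2 _]|].
  - by apply: n1; rewrite h1 h2.
  - by apply: n2; rewrite h1 h2.
  by case=> w [[[wu h]|[wv h]] _]; lra.
have gc a b u v : e u v -> 0 <= a -> b <= 1 -> seg_continuous a b (g u v).
  by move=> uv a0 b1; have [c _ _ _ _] := gP u v uv; apply: seg_continuousW c.
have third01 : third + third <= 1 by lra.
have third1 : third <= 1 by lra.
have third0 : 0 <= third by lra.
(* one scale at which the disjoint pieces are seen as disjoint *)
pose far a b c d (u v x y : V) (r : R) := forall s t, a <= s <= b ->
  c <= t <= d -> ~ close r (g u v s) (g x y t).
have far_le a b c d u v x y r r' : 0 < r' <= r -> far a b c d u v x y r ->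
    far a b c d u v x y r'.
  by move=> /andP[_ rr] h s t hs ht cl; apply: (h s t) => //; apply: close_le cl.
pose P (i : (V * V) * (V * V)) r := let: ((u, v), (x, y)) := i in
  e u v -> e x y ->
  [/\ u <> x -> far 0 third 0 third u v x y r,
      x <> u -> x <> v -> far third (third + third) 0 third u v x y r
    & (x, y) <> (u, v) -> (x, y) <> (v, u) ->
      far third (third + third) third (third + third) u v x y r].
have [r r0 rP] : exists2 r, 0 < r & forall i, P i r.
  apply: finite_pos => [[[u v] [x y]] d d' dd /= H uv xy|[[u v] [x y]]].
    have [h1 h2 h3] := H uv xy.
    by split=> *; [apply: far_le dd (h1 _) | apply: far_le dd (h2 _ _)
      | apply: far_le dd (h3 _ _)].
  case: (boolP (e u v)) => [uv|n]; last by exists 1 => //= h; rewrite h in n.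
  case: (boolP (e x y)) => [xy|n]; last by exists 1 => //= _ h; rewrite h in n.
  have sep a b c d (Q : Prop) : 0 <= a -> b <= 1 -> 0 <= c -> d <= 1 ->
     (Q -> forall s t, a <= s <= b -> c <= t <= d -> g u v s <> g x y t) ->
     exists2 r, 0 < r & (Q -> far a b c d u v x y r).
    move=> a0 b1 c0 d1 H; have [q|nq] := pselect Q; last by exists 1.
    have [r r0 rP] := seg_separated (gc a b u v uv a0 b1) (gc c d x y xy c0 d1) (H q).
    by exists r.
  have [r1 r10 h1] := sep 0 third 0 third (u <> x) (lexx _) third1 (lexx _) third1
    (fun h s t => hh u v x y s t uv xy h).
  have [r2 r20 h2] := sep third (third + third) 0 third (x <> u /\ x <> v) third0
    third01 (lexx _) third1 (fun h s t => mh u v x y s t uv xy h.1 h.2).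
  have [r3 r30 h3] := sep third (third + third) third (third + third)
    ((x, y) <> (u, v) /\ (x, y) <> (v, u)) third0
    third01 third0 third01 (fun h s t => mm u v x y s t uv xy h.1 h.2).
  exists (Num.min r1 (Num.min r2 r3)); first by rewrite !lt_min r10 r20.
  move=> _ _; split=> *; [apply: far_le (h1 _) | apply: far_le (h2 _)
      | apply: far_le (h3 _)]; by rewrite ?lt_min ?ge_min ?r10 ?r20 ?r30 ?lexx ?orbT.
have [K' K'0 KP] : exists2 d, 0 < d & forall uv : V * V, e uv.1 uv.2 ->
    forall t : R, 0 <= t <= 1 -> close (1 / d) (g uv.1 uv.2 t) (0, 0).
  apply: finite_pos => [[u v] d d' /andP[d0 dd] H uv t ht|[u v] /=].
    apply: close_le (H uv t ht); rewrite !div1r lef_pV2 // posrE //.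
    exact: lt_le_trans dd.
  case: (boolP (e u v)) => [uv|n]; last by exists 1.
  have [K K0 KP] := seg_bounded (gc 0 1 u v uv (lexx _) (lexx _)).
  by exists K^-1; rewrite ?invr_gt0 // => _ t /KP; rewrite div1r invrK.
pose K := 1 / K'.
have box u v t : e u v -> 0 <= t <= 1 -> close K (g u v t) (0, 0).
  by move=> uv ht; apply: (KP (u, v)).
pose eps := r / 6.
have eps0 : 0 < eps by rewrite /eps; lra.
pose n := Num.truncn ((K + K) / eps).
have nK : K + K < n.+1%:R * eps.
  by rewrite -ltr_pdivrMr // truncnS_gt.
pose pix p := pixel_of K eps n p.
have tr a b u v : e u v -> 0 <= a -> a <= b -> b <= 1 ->
    exists s, [/\ path (@touch n) (pix (g u v a)) s,
    last (pix (g u v a)) s = pix (g u v b)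
    & {in pix (g u v a) :: s, forall z,
        exists2 t, a <= t <= b & near_pixel K eps z (g u v t)}].
  move=> uv a0 ab b1; apply: trace => //; first exact: gc.
  move=> t /andP[h1 h2]; apply: box => //; apply/andP; split; lra.
have tot a b (uv : V * V) : exists s : seq ('I_n.+1 * 'I_n.+1),
    e uv.1 uv.2 -> 0 <= a -> a <= b -> b <= 1 ->
    [/\ path (@touch n) (pix (g uv.1 uv.2 a)) s,
    last (pix (g uv.1 uv.2 a)) s = pix (g uv.1 uv.2 b)
    & {in pix (g uv.1 uv.2 a) :: s, forall z,
        exists2 t, a <= t <= b & near_pixel K eps z (g uv.1 uv.2 t)}].
  case: (boolP (e uv.1 uv.2)) => [h|n']; last by exists [::].
  have [h0|/negP h0] := boolP [&& 0 <= a, a <= b & b <= 1]; last first.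
    by exists [::] => _ ? ? ?; case: h0; apply/and3P.
  have /and3P[a0 ab b1] := h0.
  by have [s sP] := tr a b _ _ h a0 ab b1; exists s.
have [hw hwP] := choice (tot 0 third).
have [mw mwP] := choice (tot third (third + third)).
have hwE u v : e u v -> [/\ path (@touch n) (pix (pos u)) (hw (u, v)),
    last (pix (pos u)) (hw (u, v)) = pix (g u v third)
    & {in pix (pos u) :: hw (u, v), forall z,
        exists2 t, 0 <= t <= third & near_pixel K eps z (g u v t)}].
  move=> uv; have [_ <- _ _ _] := gP u v uv.
  exact: (hwP (u, v) uv (lexx _) third0 third1).
have mwE u v : e u v -> [/\ path (@touch n) (pix (g u v third)) (mw (u, v)),
    last (pix (g u v third)) (mw (u, v)) = pix (g u v (third + third))
    & {in pix (g u v third) :: mw (u, v), forall z,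
        exists2 t, third <= t <= third + third & near_pixel K eps z (g u v t)}].
  move=> uv; apply: (mwP (u, v) uv third0 _ third01); lra.
have nearP (z : 'I_n.+1 * 'I_n.+1) p q : near_pixel K eps z p -> near_pixel K eps z q -> close r p q.
  move=> h1 h2; have := near_pixel_close eps0 nK h1 h2.
  by have -> : 6 * eps = r by rewrite /eps; lra.
apply: (@grid_model_planar n V e e_sym e_irr (fun u => pix (pos u))
  (fun u v => hw (u, v)) (fun u v => mw (u, v))).
- by move=> u v uv; have [] := hwE u v uv.
- by move=> u v uv _; have [_ -> _] := hwE u v uv; have [] := mwE u v uv.
- move=> u v uv _; have vu : e v u by rewrite e_sym.
  have [_ -> _] := hwE u v uv; have [_ -> _] := hwE v u vu.
  have [_ -> _] := mwE u v uv; have [_ _ _ _ ->] := gP u v uv.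
  by congr (pix (g u v _)); lra.
- move=> u v x y p uv xy pu px; have [//|ux] := pselect (u = x).
  have [_ _ /(_ p pu)[s hs ps]] := hwE u v uv.
  have [_ _ /(_ p px)[t ht pt]] := hwE x y xy.
  have [/(_ ux) H _ _] := rP ((u, v), (x, y)) uv xy.
  by case: (H s t hs ht); apply: nearP ps pt.
- move=> u v x y p uv _ xy pu px.
  have [xu|xu] := pselect (x = u); first by left.
  have [xv|xv] := pselect (x = v); first by right.
  have pu' : p \in pix (g u v third) :: mw (u, v) by rewrite in_cons pu orbT.
  have [_ _ /(_ p pu')[s hs ps]] := mwE u v uv.
  have [_ _ /(_ p px)[t ht pt]] := hwE x y xy.
  have [_ /(_ xu xv) H _] := rP ((u, v), (x, y)) uv xy.
  by case: (H s t hs ht); apply: nearP ps pt.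
- move=> u v x y p uv luv xy lxy pu px.
  have [[-> ->]|n1] := pselect ((x, y) = (u, v)); first by [].
  have [[xv yu]|n2] := pselect ((x, y) = (v, u)).
    by move: lxy; rewrite xv yu => lvu; rewrite (lt_total uv) lvu in luv.
  have pu' : p \in pix (g u v third) :: mw (u, v) by rewrite in_cons pu orbT.
  have px' : p \in pix (g x y third) :: mw (x, y) by rewrite in_cons px orbT.
  have [_ _ /(_ p pu')[s hs ps]] := mwE u v uv.
  have [_ _ /(_ p px')[t ht pt]] := mwE x y xy.
  have [_ _ /(_ n1 n2) H] := rP ((u, v), (x, y)) uv xy.
  by case: (H s t hs ht); apply: nearP ps pt.
Qed.
End Drawing.

Lemma planar_plane_map (R : realType) (V : finType) (e : rel V) :
  symmetric e -> irreflexive e -> planar R e -> inhabited (plane_map e).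
Proof. by move=> es ei [pos [curve d]]; apply: drawing_plane_map d. Qed.

Lemma planar_sub (R : realType) (V : finType) (e e' : rel V) :
  subrel e' e -> planar R e -> planar R e'.
Proof.
move=> sub [pos [curve [h1 h2 h3 h4 h5]]]; exists pos, curve; split=> //.
- by move=> u v /sub; apply: h2.
- by move=> u v /sub; apply: h3.
- by move=> u v w /sub; apply: h4.
- by move=> u v x y p /sub uv /sub xy; apply: h5.
Qed.

(** * DP-4-colourability *)

Theorem theorem6 (R : realType) (k : nat) (hk : k \in [:: 3; 4; 5; 6])
    (V : finType) (e : rel V) (e_sym : symmetric e) (e_irr : irreflexive e)
    (e_planar : planar R e) (e_Ck : ~ contains_cycle e k) :
  DP_colorable e 4.
Proof.
have maps S : inhabited (plane_map (edges_in e S)).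
  apply: (@planar_plane_map R); [exact: edges_in_sym | exact: edges_in_irr|].
  exact: planar_sub (@edges_in_sub _ e S) e_planar.
have noCk : no_cycle e k by move=> c sc cyc; apply: e_Ck; exists c.
have all4 : all_DP_colorings_exist e 4.
  move=> m L Mt m0 L4 MtP; apply: colorable_DP => //.
  exact: (planar_colorable finset.setT hk e_sym e_irr maps noCk m0 L4 MtP).
have ex : exists n, `[< all_DP_colorings_exist e n >] by exists 4; apply/asboolP.
have [n /asboolP all_n min_n] := ex_minnP ex.
exists n; split; last by apply/min_n/asboolP.
by split=> // j /asboolP; apply: min_n.
Qed.
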